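(* Assume $n\geqslant 3$ and $n\neq 4$. Let $V$ be an irreducible real representation of $\mathrm{SO}_n(\mathbb{R})$. If $\dim V\leqslant\dim\mathrm{Sym}_n^{tr=0}(\mathbb{R})$ and $H$ fixes some non-zero vector in $V$, then $V$ is isomorphic either to the trivial representation or to $\mathrm{Sym}_n^{tr=0}(\mathbb{R})$.
   Context: $H\subseteq\mathrm{SO}_n(\mathbb{R})$ is the subgroup of diagonal matrices (diagonal entries $\pm1$ with product $1$). $\mathrm{Sym}_n^{tr=0}(\mathbb{R})$, called the (traceless) isospectral model, is the space of traceless real symmetric $n\times n$ matrices with $\mathrm{SO}_n(\mathbb{R})$-action $A\cdot T=ATA^t$; its dimension is $(n+2)(n-1)/2$. Representations are finite-dimensional. *)

(* Defs.v *)
From HB Require Import structures.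
From mathcomp Require Import all_boot all_order all_algebra.
From mathcomp Require Import all_classical all_reals all_analysis.
Set Implicit Arguments.
Unset Strict Implicit.
Unset Printing Implicit Defensive.
Import Order.TTheory GRing.Theory Num.Theory.
Import numFieldNormedType.Exports.
Local Open Scope classical_set_scope.
Local Open Scope ring_scope.

Definition SO (R : realType) (n : nat) : set 'M[R]_n :=
  [set A | A *m A^T = 1%:M /\ \det A = 1].

(* Orthogonality forces the diagonal entries to be 1 or -1, and the
   determinant condition forces their product to be 1. *)
Definition diagSO (R : realType) (n : nat) : set 'M[R]_n :=
  [set A | SO A /\ is_diag_mx A].

(* As for mx_representation, rep_act is a total function on matrices, of which
   only the restriction to SO R n is meaningful.  Representations of this Lie
   group are continuous by convention; on a finite-dimensional V this means
   that all matrix coefficients A |-> f (A . v), with f in the dual of V, are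
   continuous. *)
Record SOrep (R : realType) (n : nat) := {
  rep_space :> vectType R;
  rep_act : 'M[R]_n -> 'End(rep_space);
  rep_act1 : rep_act 1%:M = \1%VF;
  rep_actM : forall A B, SO A -> SO B ->
    rep_act (A *m B) = (rep_act A \o rep_act B)%VF;
  rep_act_continuous : forall (f : 'Hom(rep_space, R^o)) (v : rep_space),
    {within SO (R := R) (n := n),
      continuous (fun A : 'M[R]_n => f (rep_act A v) : R)}
}.

Definition rep_stable (R : realType) (n : nat) (V : SOrep R n)
    (U : {vspace V}) : Prop :=
  forall A, SO A -> (rep_act V A @: U <= U)%VS.

Definition rep_irreducible (R : realType) (n : nat) (V : SOrep R n) : Prop :=
  (0 < \dim {:V})%N /\
  forall U : {vspace V}, rep_stable U -> U = 0%VS \/ U = fullv.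

Definition rep_iso (R : realType) (n : nat) (V W : SOrep R n) : Prop :=
  exists2 phi : 'Hom(V, W), bijective phi &
    forall A v, SO A -> phi (rep_act V A v) = rep_act W A (phi v).

Section Trivial.
Variables (R : realType) (n : nat).

Let triv_act (_ : 'M[R]_n) : 'End(R^o) := \1%VF.

Fact triv_actM A B : SO A -> SO B ->
  triv_act (A *m B) = (triv_act A \o triv_act B)%VF.
Proof. by move=> _ _; rewrite /triv_act comp_lfun1l. Qed.

Fact triv_act_continuous (f : 'Hom(R^o, R^o)) (v : R^o) :
  {within SO (R := R) (n := n),
    continuous (fun A : 'M[R]_n => f (triv_act A v) : R)}.
Proof.
apply: continuous_subspaceT; rewrite /triv_act.
exact: (@cst_continuous 'M[R]_n R (f (\1%VF v))).
Qed.

Definition trivial_rep : SOrep R n :=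
  @Build_SOrep R n R^o triv_act erefl triv_actM triv_act_continuous.

End Trivial.

Section SymTraceless.
Variables (R : realType) (n : nat).

Definition skew_part (T : 'M[R]_n) : 'M[R]_n := T - T^T.

Fact skew_part_is_linear : linear skew_part.
Proof.
by move=> a S T; rewrite /skew_part linearP scalerBr opprD addrACA.
Qed.
HB.instance Definition _ :=
  GRing.isLinear.Build R 'M[R]_n 'M[R]_n _ skew_part skew_part_is_linear.

Definition tr_form (T : 'M[R]_n) : R^o := \tr T.

Fact tr_form_is_linear : linear tr_form.
Proof. by move=> a S T; rewrite /tr_form linearP. Qed.
HB.instance Definition _ :=
  GRing.isLinear.Build R 'M[R]_n R^o _ tr_form tr_form_is_linear.

Definition Sym0 : {vspace 'M[R]_n} :=
  (lker (linfun skew_part) :&: lker (linfun tr_form))%VS.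

Lemma Sym0P (T : 'M[R]_n) : reflect (T^T = T /\ \tr T = 0) (T \in Sym0).
Proof.
rewrite memv_cap !memv_ker !lfunE /= /skew_part /tr_form subr_eq0 eq_sym.
by apply: (iffP andP) => [] [/eqP ? /eqP ?].
Qed.

Definition Sym0_conj (A : 'M[R]_n) (T : subvs_of Sym0) : subvs_of Sym0 :=
  vsproj Sym0 (A *m vsval T *m A^T).

Fact Sym0_conj_is_linear A : linear (Sym0_conj A).
Proof.
move=> a S T; rewrite /Sym0_conj -linearP; congr (vsproj _ _).
rewrite (_ : vsval _ = a *: vsval S + vsval T); last exact: linearP.
by rewrite mulmxDr mulmxDl -scalemxAr -scalemxAl.
Qed.
HB.instance Definition _ A :=
  GRing.isLinear.Build R (subvs_of Sym0) (subvs_of Sym0) _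
    (Sym0_conj A) (Sym0_conj_is_linear A).

Definition Sym0_act (A : 'M[R]_n) : 'End(subvs_of Sym0) :=
  linfun (Sym0_conj A).

(* The projection in Sym0_conj is the identity on A T A^t when A is in SO. *)
Lemma Sym0_actE A T : SO A -> vsval (Sym0_act A T) = A *m vsval T *m A^T.
Proof.
move=> [AAt _]; rewrite lfunE /= vsprojK //; apply/Sym0P.
have [Ts Tt] := Sym0P _ (subvsP T); split.
  by rewrite !trmx_mul trmxK Ts mulmxA.
by rewrite mxtrace_mulC mulmxA (mulmx1C AAt) mul1mx.
Qed.

Fact Sym0_act1 : Sym0_act 1%:M = \1%VF.
Proof.
apply/lfunP => T; apply: val_inj.
by rewrite lfunE /= /Sym0_conj trmx1 mul1mx mulmx1 id_lfunE vsvalK.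
Qed.

Lemma SO_mul (A B : 'M[R]_n) : SO A -> SO B -> SO (A *m B).
Proof.
move=> [A1 A2] [B1 B2]; split; last by rewrite det_mulmx A2 B2 mulr1.
by rewrite trmx_mul mulmxA -(mulmxA A) B1 mulmx1.
Qed.

Fact Sym0_actM A B : SO A -> SO B ->
  Sym0_act (A *m B) = (Sym0_act A \o Sym0_act B)%VF.
Proof.
move=> SA SB; apply/lfunP => T; apply: val_inj; rewrite comp_lfunE.
change (vsval (Sym0_act (A *m B) T) = vsval (Sym0_act A (Sym0_act B T))).
by rewrite !Sym0_actE //; [rewrite trmx_mul !mulmxA | exact: SO_mul].
Qed.

Fact sum_continuous (T : topologicalType) (I : finType) (F : I -> T -> R) :
  (forall i, continuous (F i)) -> continuous (fun x => \sum_i F i x).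
Proof.
move=> Fc; have -> : (fun x => \sum_i F i x) = \sum_i F i.
  by apply/funext => x; rewrite fct_sumE.
elim/big_ind: _ => // [|f g fc gc] x; first exact: cvg_cst.
by apply: cvgD; [exact: fc | exact: gc].
Qed.

Fact mul_continuous (T : topologicalType) (F G : T -> R) :
  continuous F -> continuous G -> continuous (fun x => F x * G x).
Proof. by move=> Fc Gc x; apply: cvgM; [exact: Fc | exact: Gc]. Qed.

Fact Sym0_act_continuous (f : 'Hom(subvs_of Sym0, R^o)) (T : subvs_of Sym0) :
  {within SO (R := R) (n := n),
    continuous (fun A : 'M[R]_n => f (Sym0_act A T) : R)}.
Proof.
apply: continuous_subspaceT.
have -> : (fun A : 'M[R]_n => f (Sym0_act A T) : R) =
  (fun A : 'M[R]_n => \sum_i \sum_j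
    (\sum_k (\sum_l A i l * vsval T l k) * A j k) *
    (f (vsproj Sym0 (delta_mx i j)) : R)).
  apply/funext => B; rewrite lfunE /= /Sym0_conj.
  rewrite [X in vsproj _ X]matrix_sum_delta !linear_sum.
  apply: eq_bigr => i _; rewrite !linear_sum; apply: eq_bigr => j _.
  rewrite !linearZ /= mxE; congr (_ * _); apply: eq_bigr => k _.
  by rewrite !mxE.
apply: sum_continuous => i; apply: sum_continuous => j.
apply: mul_continuous; last exact: (@cst_continuous _ R).
apply: sum_continuous => k.
apply: mul_continuous; last exact: coord_continuous.
apply: sum_continuous => l.
apply: mul_continuous; last exact: (@cst_continuous _ R).
exact: coord_continuous.
Qed.

Definition Sym0_rep : SOrep R n :=
  @Build_SOrep R n (subvs_of Sym0) Sym0_act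
    Sym0_act1 Sym0_actM Sym0_act_continuous.

End SymTraceless.

(* Main.v *)
From HB Require Import structures.
Require Import Defs.
From mathcomp Require Import all_boot all_order all_algebra.
From mathcomp Require Import all_classical all_reals all_analysis.
From mathcomp Require Import fingroup perm zify ring lra.
Set Implicit Arguments.
Unset Strict Implicit.
Unset Printing Implicit Defensive.
Import Order.TTheory GRing.Theory Num.Theory.
Import numFieldNormedType.Exports.
Local Open Scope classical_set_scope.
Local Open Scope ring_scope.

(** The group H is generated by the half turns h_kl = rot k l pi.  On V they are
    commuting involutions, and a subset S of the indices gives the joint
    eigenspace V_S (wt V S) where h_kl acts by the sign (-1)^([k in S] + [l in S]).
    Only the empty set and the pairs matter: wt0 V is the space of vectors fixed
    by H, non-zero by hypothesis, and wt2 V i j belongs to the pair {i, j}.  The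
    even part C and the odd part D of t |-> rot i j t acting on V satisfy
    C^2 - D^2 = 1, C preserves V_S, and D maps V_S to V_S' where S' is
    the symmetric difference of S and {i, j}.

    If every D vanishes on V_0, then V_0 is a subrepresentation, so V = V_0; then
    rot i j (2 t) = 1 + 2 D(t)^2 = 1 and V is trivial (trivial_case).  Otherwise
    conjugation by quarter turns shows that no V_ij is zero.  For n >= 3, n <> 4,
    the eigencharacters of V_0 and of the V_ij are pairwise distinct (for n = 4
    complementary pairs give the same one), so these spaces are independent;
    they have the same dimension, and with dimension at least 2 they would already
    exceed the bound on dim V, hence every V_ij is a line (lines_dim1).

    On such lines a one-parameter rotation acts through homomorphisms from R to
    the circle, with unknown frequencies.  Three indices i, j, k give two unknown
    homomorphisms, and the relation
      rot i j t * rot j k x = rot j k b * rot k i g * rot i j a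
    (a right spherical triangle, rot_refactor), read off on V_jk + V_ki, gives
    functional equations between them.  They have a single solution
    (circle_homs_rigid), the one of the symmetric matrices: on V_ij and V_0 the
    plane rotation of angle t acts with frequency 2, and with X = D(pi/4) one has
    X^2 w = - w and X_ij (quarter j k) X_ij w = - w / 2 for w in V_ij
    (triple_structure).

    These constants suffice to rebuild the matrix model.  Fix the axes o = 0,
    p = 1.  The sum of the transforms of X_op w under the transpositions that fix o
    is a non-zero vector v0 (axis_vec) fixed by the stabiliser SO_(n-1) of the
    vector e_o, as is the matrix 1 - n E_oo.  So r^2 (g v0) depends only on the
    vector r (g e_o), and it defines a homogeneous map of degree 2 from R^n to V.
    Any two vectors can be rotated into the plane (o, p), where the map is a
    quadratic polynomial; hence it satisfies the parallelogram law, is a quadratic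
    form, and its polarisation defines an equivariant linear map from matrices to V
    (symmap).  Its restriction to traceless symmetric matrices is injective: the
    coefficients off the diagonal are seen on the independent lines V_ij, and a
    symmetric matrix all of whose rotates are diagonal is scalar.  It is onto by
    irreducibility. *)

(** * Homomorphisms from the line to the circle *)

Section CircleHom.
Variable R : realType.
Implicit Types (c s q f : R -> R) (a b e t x : R) (k m : nat).

(** The points a m / 2^k are dense in the half line. *)
Lemma eq0_dyadic f a : continuous f -> 0 < a ->
  (forall m k : nat, f (a * m%:R / 2 ^+ k) = 0) -> forall t, 0 <= t -> f t = 0.
Proof.
move=> fc a0 fz t t0; apply/eqP; apply: contraT => ftN0.
have /nbhs_ballP[e /= e0 be] : \forall x \near t, f x != 0.
  exact: (cvgr_neq0 (f t) (fc t) ftN0).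
have [k ak] : exists k : nat, a / 2 ^+ k < e.
  have ke := archi_boundP (ltW (divr_gt0 a0 e0)).
  set k := Num.bound _ in ke; exists k; rewrite ltr_pdivrMr ?exprn_gt0 // mulrC -ltr_pdivrMr //.
  apply: (@lt_le_trans _ _ k%:R).
    exact: ke.
  by rewrite -natrX ler_nat ltnW // ltn_expl.
pose d := a / 2 ^+ k; have d0 : 0 < d by rewrite divr_gt0 ?exprn_gt0.
pose m := Num.truncn (t / d).
have /andP[m1 m2] := truncn_itv (divr_ge0 t0 (ltW d0)).
have := be (a * m%:R / 2 ^+ k).
rewrite fz eqxx => H; exfalso; apply/notF/H.
rewrite /ball /= mulrAC -/d.
move: m1 m2; rewrite -/m ler_pdivlMr // ltr_pdivrMr // => m1 m2.
rewrite ger0_norm ?subr_ge0; last by rewrite mulrC.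
apply: lt_trans ak; rewrite -/d ltrBlDr.
by move: m2; rewrite -natr1 mulrDl mul1r addrC [d * _]mulrC.
Qed.

Lemma cos_double x : cos (2 * x) = 2 * cos x ^+ 2 - 1.
Proof. by rewrite mulrC mulr_natr cos_mulr2n mulr_natl. Qed.

Lemma sin_double x : sin (2 * x) = 2 * sin x * cos x.
Proof. by rewrite mulrC mulr_natr sin_mulr2n; lra. Qed.

Definition circle_hom c s :=
  [/\ continuous c, continuous s,
      forall a b, c (a + b) = c a * c b - s a * s b,
      forall a b, s (a + b) = s a * c b + c a * s b &
      forall a, c a ^+ 2 + s a ^+ 2 = 1].

Lemma circle_hom0 c s : circle_hom c s -> c 0 = 1 /\ s 0 = 0.
Proof.
move=> [_ _ cD sD cs1].
have := cD 0 0; have := sD 0 0; rewrite addr0 => s0 c0; have := cs1 0 => u.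
have s00 : s 0 = 0.
  have : s 0 * (1 - 2 * c 0) = 0 by lra.
  move/eqP; rewrite mulf_eq0 => /orP[/eqP //|/eqP h]; nra.
by split=> //; rewrite s00 in u c0; nra.
Qed.

Lemma circle_homN c s t : circle_hom c s -> c (- t) = c t /\ s (- t) = - s t.
Proof.
move=> h; have [c0 s0] := circle_hom0 h; case: h => _ _ cD sD cs1.
have := cD t (- t); have := sD t (- t); rewrite subrr c0 s0 => e1 e2.
have u := cs1 t; split.
  have : c t * (c t * c (- t) - s t * s (- t)) + s t * (s t * c (- t) + c t * s (- t)) =
    (c t ^+ 2 + s t ^+ 2) * c (- t) by ring.
  by rewrite -e1 -e2 u; lra.
have : c t * (s t * c (- t) + c t * s (- t)) - s t * (c t * c (- t) - s t * s (- t)) =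
    (c t ^+ 2 + s t ^+ 2) * s (- t) by ring.
by rewrite -e1 -e2 u; lra.
Qed.

Lemma circle_hom2 c s t : circle_hom c s ->
  c (2 * t) = 2 * c t ^+ 2 - 1 /\ s (2 * t) = 2 * s t * c t.
Proof.
case=> _ _ cD sD cs1.
by rewrite (_ : 2 * t = t + t) ?cD ?sD; [have := cs1 t; split; lra|lra].
Qed.

Lemma circle_hom_cossin l : circle_hom (fun t => cos (l * t)) (fun t => sin (l * t)).
Proof.
have lc : continuous (fun t : R => l * t).
  by move=> t; apply: cvgM; [exact: cvg_cst|exact: cvg_id].
split.
- by move=> t; apply: continuous_comp; [exact: lc|exact: continuous_cos].
- by move=> t; apply: continuous_comp; [exact: lc|exact: continuous_sin].
- by move=> a b; rewrite mulrDr cosD.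
- by move=> a b; rewrite mulrDr sinD.
- by move=> a; exact: cos2Dsin2.
Qed.

(** A value determines the value at half the argument as soon as the cosine there
    is known to be positive; so two homomorphisms that agree at e agree at all
    dyadic multiples of e, hence everywhere. *)
Lemma circle_hom_ext c s c' s' e : circle_hom c s -> circle_hom c' s' -> 0 < e ->
  (forall t, `|t| <= e -> 0 < c t) -> (forall t, `|t| <= e -> 0 < c' t) ->
  c e = c' e -> s e = s' e -> forall t, c t = c' t /\ s t = s' t.
Proof.
move=> h h' e0 cp cp' ce se.
have dy k : c (e / 2 ^+ k) = c' (e / 2 ^+ k) /\ s (e / 2 ^+ k) = s' (e / 2 ^+ k).
  elim: k => [|k [IHc IHs]]; first by rewrite expr0 divr1.
  set x := e / 2 ^+ k.+1.
  have xE : e / 2 ^+ k = 2 * x.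
    rewrite /x exprS; field; by rewrite expf_neq0.
  have x0 : 0 < x by rewrite divr_gt0 ?exprn_gt0.
  have xe : `|x| <= e.
    rewrite gtr0_norm // ler_pdivrMr ?exprn_gt0 // ler_peMr ?(ltW e0) //.
    by rewrite exprn_ege1 // ler1n.
  move: IHc IHs; rewrite xE.
  have [-> ->] := circle_hom2 x h; have [-> ->] := circle_hom2 x h'.
  move=> IHc IHs; have p := cp _ xe; have p' := cp' _ xe.
  have cE : c x = c' x.
    have /eqP : (c x - c' x) * (c x + c' x) = 0 by lra.
    by rewrite mulf_eq0 => /orP[/eqP|/eqP]; lra.
  split=> //; rewrite cE in IHs.
  by apply: (mulIf (lt0r_neq0 p')); lra.
have dm m k : c (e * m%:R / 2 ^+ k) = c' (e * m%:R / 2 ^+ k)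
    /\ s (e * m%:R / 2 ^+ k) = s' (e * m%:R / 2 ^+ k).
  elim: m => [|m [IHc IHs]].
    by rewrite mulr0 mul0r; have [-> ->] := circle_hom0 h; have [-> ->] := circle_hom0 h'.
  have -> : e * m.+1%:R / 2 ^+ k = e * m%:R / 2 ^+ k + e / 2 ^+ k.
    by rewrite -natr1 mulrDr mulr1 mulrDl.
  have [dc ds] := dy k.
  case: h => _ _ cD sD _; case: h' => _ _ cD' sD' _.
  by rewrite cD cD' sD sD' IHc IHs dc ds.
have [cc sc _ _ _] := h; have [cc' sc' _ _ _] := h'.
have pos t : 0 <= t -> c t = c' t /\ s t = s' t.
  move=> t0; split; apply/eqP; rewrite -subr_eq0; apply/eqP.
    apply: (@eq0_dyadic (fun t => c t - c' t) e) => //.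
      by move=> x; apply: cvgB; [exact: cc|exact: cc'].
    by move=> m k; rewrite (dm m k).1 subrr.
  apply: (@eq0_dyadic (fun t => s t - s' t) e) => //.
    by move=> x; apply: cvgB; [exact: sc|exact: sc'].
  by move=> m k; rewrite (dm m k).2 subrr.
move=> t; have [/pos //|t0] := leP 0 t.
rewrite -[t]opprK.
have [-> ->] := circle_homN (- t) h; have [-> ->] := circle_homN (- t) h'.
by have [|-> ->] := pos (- t); rewrite // oppr_ge0 ltW.
Qed.

(** Take e so small that c stays positive on [-e, e] and compare with the
    homomorphism of frequency asin (s e) / e. *)
Lemma circle_homP c s : circle_hom c s ->
  exists l, forall t, c t = cos (l * t) /\ s t = sin (l * t).
Proof.
move=> h; have [c0 s0] := circle_hom0 h.
have [cc _ _ _ cs1] := h.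
have /nbhs_ballP[d /= d0 bd] : \forall x \near (0 : R), 0 < c x.
  by apply: (cvgr_gt (c 0) (cc 0)); rewrite c0 ltr01.
pose e := d / 2; have e0 : 0 < e by rewrite divr_gt0.
have cp t : `|t| <= e -> 0 < c t.
  move=> te; apply: bd; rewrite /ball /= sub0r normrN (le_lt_trans te) // /e.
  lra.
have ce := cp e; rewrite gtr0_norm // lexx in ce; have {}ce := ce isT.
have s1 : -1 < s e < 1 by apply/andP; have := cs1 e; split; nra.
have s1' : -1 <= s e <= 1 by case/andP: s1 => /ltW -> /ltW ->.
pose th := asin (s e); exists (th / e).
have thE : sin th = s e by rewrite asinK // in_itv.
have [/andP[u1 u2]] := (s1).
have th1 : - (pi / 2) < th by apply: asin_gtNpi2; rewrite u1 ltW.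
have th2 : th < pi / 2 by apply: asin_ltpi2; rewrite u2 ltW.
have cE : cos th = c e.
  have := cos2Dsin2 th; rewrite thE -(cs1 e) => /addIr /eqP.
  have cth : 0 < cos th by apply: cos_gt0_pihalf; rewrite th1.
  by rewrite eqrXn2 // ?ltW // => /eqP.
apply: (circle_hom_ext h (circle_hom_cossin (th / e)) e0 cp).
- move=> t te; apply: cos_gt0_pihalf.
  rewrite -ltr_norml mulrAC -mulrA normrM normrM normfV (gtr0_norm e0).
  apply: (@le_lt_trans _ _ `|th|).
    by rewrite ler_piMr // ler_pdivrMr // mul1r.
  by rewrite ltr_norml th1.
- by rewrite divfK ?gt_eqF.
- by rewrite divfK ?gt_eqF.
Qed.

Lemma sin_quotient_continuous l :
  {for 0, continuous (fun x : R => if x == 0 then l else sin (l * x) / x)}.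
Proof.
have d : is_derive (0 : R) 1 (fun x : R => sin (l * x)) l.
  have dl : is_derive (0 : R) 1 (l \*: @idfun R : R -> R) (l *: (1 : R^o)).
    by apply: is_deriveZ; exact: is_derive_id.
  have := @is_derive1_comp _ sin (l \*: @idfun R : R -> R) 0 (cos (l * 0)) _ _ dl.
  rewrite mulr0 cos0 mul1r /GRing.scale /= mulr1; apply.
  by have := is_derive_sin (0 : R); rewrite /= scaler0 cos0.
apply/continuous_withinNx; rewrite eqxx.
have := ex_derive; rewrite /derivable => /(_ _ _ _ _ _ _ _ d).
have := derive_val; rewrite /derive => /(_ _ _ _ _ _ _ _ d) dv.
rewrite /(cvg _) dv; apply: cvg_trans.
apply: near_eq_cvg; near=> x.
have x0 : x != 0 by near: x; exact: nbhs_dnbhs_neq.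
rewrite (negbTE x0) /= addr0 mulr0 sin0 subr0 /GRing.scale /= mulr1 mulrC //.
Unshelve. all: by end_near.
Qed.

(** This makes it possible to divide by sin x ^ 2 and let x tend to 0 in identities
    between homomorphisms of unknown frequencies. *)
Lemma sin_square_ratio l : exists g : R -> R,
  [/\ {for 0, continuous g}, g 0 = l ^+ 2 &
      forall x, - pi < x < pi -> sin (l * x) ^+ 2 = g x * sin x ^+ 2].
Proof.
pose G l x : R := if x == 0 then l else sin (l * x) / x.
have GE (m x : R) : sin (m * x) = G m x * x.
  rewrite /G; case: eqP => [->|/eqP x0]; first by rewrite !mulr0 sin0.
  by rewrite divfK.
exists (fun x => (G l x / G 1 x) ^+ 2); split.
- have G0 (m : R) : G m 0 = m by rewrite /G eqxx.
  apply: (@continuous_comp _ _ _ (fun x => G l x / G 1 x) (fun y => y ^+ 2)).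
    apply: cvgM; first exact: sin_quotient_continuous.
    apply: cvgV; first by rewrite G0 oner_neq0.
    exact: sin_quotient_continuous.
  exact: exprn_continuous.
- by rewrite /G eqxx divr1.
- move=> x /andP[x1 x2]; rewrite GE -[X in sin X]mul1r GE.
  have [->|x0] := eqVneq x 0; first by rewrite !mulr0 expr0n /= mulr0.
  have : G 1 x != 0.
    apply: contraTneq isT => G0; have := GE 1 x; rewrite G0 mul0r mul1r => s0.
    have [xp|xn] := ltP 0 x.
      by have := @sin_gt0_pi R x; rewrite xp x2 s0 ltxx => /(_ isT).
    have := @sin_gt0_pi R (- x); rewrite sinN s0 oppr0 ltxx.
    by rewrite oppr_gt0 lt_neqAle x0 xn ltrNl x1 => /(_ isT).
  by move=> G0; field.
Qed.

(** A spherical triangle with a right angle, hypotenuse [x], legs [b] and [g], where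
    [t] is the angle opposite to [g]. *)
Definition pythagorean t x b g :=
  [/\ sin g = sin x * sin t, cos g * sin b = sin x * cos t &
      cos g * cos b = cos x].

Lemma angle_exists u v : u ^+ 2 + v ^+ 2 = 1 -> exists a, cos a = u /\ sin a = v.
Proof.
move=> uv; have u1 : -1 <= u <= 1 by apply/andP; split; nra.
have cu : cos (acos u) = u by rewrite acosK // in_itv.
have := cos2Dsin2 (acos u); rewrite cu -uv => /addrI /eqP.
rewrite -subr_eq0 subr_sqr mulf_eq0 subr_eq0 addr_eq0 => /orP[/eqP su|/eqP su].
  by exists (acos u).
by exists (- acos u); rewrite cosN sinN su opprK.
Qed.

(** The legs as functions of the hypotenuse, continuous near 0. *)
Definition leg1 t x := asin (sin x * sin t).
Definition leg2 t x := asin (sin x * cos t / cos (leg1 t x)).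

Lemma legsP t x : 0 < cos x ->
  [/\ pythagorean t x (leg2 t x) (leg1 t x), 0 < cos (leg1 t x) & 0 < cos (leg2 t x)].
Proof.
move=> cx; have ux := cos2Dsin2 x; have ut := cos2Dsin2 t.
have abs1 (y : R) : y ^+ 2 < 1 -> (-1 < y < 1) /\ (-1 <= y <= 1).
  by move=> y1; split; apply/andP; split; nra.
have cos_asin_gt0 (y : R) : -1 < y < 1 -> 0 < cos (asin y).
  case/andP=> y1 y2; apply: cos_gt0_pihalf.
  by rewrite asin_gtNpi2 ?asin_ltpi2 // ?y1 ?y2 ltW.
have [g1 g2] : (-1 < sin x * sin t < 1) /\ (-1 <= sin x * sin t <= 1).
  by apply: abs1; rewrite exprMn; nra.
have sg : sin (leg1 t x) = sin x * sin t by rewrite asinK // in_itv.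
have cg : 0 < cos (leg1 t x) by exact: cos_asin_gt0.
have ug := cos2Dsin2 (leg1 t x).
have cg2 : cos (leg1 t x) ^+ 2 = 1 - (sin x * sin t) ^+ 2 by rewrite -sg; lra.
set z := sin x * cos t / cos (leg1 t x).
have zE : z * cos (leg1 t x) = sin x * cos t by rewrite divfK ?gt_eqF.
have zE2 : (1 - z ^+ 2) * cos (leg1 t x) ^+ 2 = cos x ^+ 2.
  rewrite mulrBl -exprMn zE cg2 !exprMn mul1r.
  by rewrite (_ : cos t ^+ 2 = 1 - sin t ^+ 2); [lra|lra].
have [z1 z2] : (-1 < z < 1) /\ (-1 <= z <= 1).
  apply: abs1; rewrite -subr_gt0 -(pmulr_lgt0 _ (exprn_gt0 2 cg)) zE2.
  exact: exprn_gt0.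
have sb : sin (leg2 t x) = z by rewrite asinK // in_itv.
have cb : 0 < cos (leg2 t x) by exact: cos_asin_gt0.
have ub := cos2Dsin2 (leg2 t x).
split=> //; split=> //; first by rewrite sb mulrC.
apply/eqP; rewrite -(@eqrXn2 _ 2) ?mulr_ge0 ?ltW // exprMn mulrC.
by rewrite -zE2; apply/eqP; congr (_ * _); rewrite -sb; lra.
Qed.

Lemma asin_zero : asin 0 = 0 :> R.
Proof.
rewrite -[X in asin X]sin0 sinK // in_itv /=.
by have := @pi_gt0 R => p; apply/andP; split; lra.
Qed.

Lemma legs_continuous t : {for 0, continuous (leg1 t)} /\ {for 0, continuous (leg2 t)}.
Proof.
have s0 (a : R) : {for 0, continuous (fun x => sin x * a)}.
  by apply: cvgM; [exact: continuous_sin|exact: cvg_cst].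
have c1 : {for 0, continuous (leg1 t)}.
  apply: (@continuous_comp _ _ _ (fun x => sin x * sin t) asin); first exact: s0.
  by apply: continuous_asin; rewrite sin0 mul0r ltrN10 ltr01.
split=> //.
have cl : {for 0, continuous (fun x => cos (leg1 t x))}.
  by apply: continuous_comp => //; exact: continuous_cos.
apply: (@continuous_comp _ _ _ (fun x => sin x * cos t / cos (leg1 t x)) asin).
  apply: cvgM; first exact: s0.
  by apply: cvgV => //; rewrite /leg1 sin0 mul0r asin_zero cos0 oner_neq0.
by apply: continuous_asin; rewrite sin0 !mul0r ltrN10 ltr01.
Qed.

Lemma leg_at0 t : leg1 t 0 = 0 /\ leg2 t 0 = 0.
Proof. by rewrite /leg2 /leg1 sin0 !mul0r asin_zero. Qed.

Lemma eq_continuous_at0 (f g : R -> R) : {for 0, continuous f} -> {for 0, continuous g} ->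
  (\forall x \near (0 : R), x != 0 -> f x = g x) -> f 0 = g 0.
Proof.
move=> /continuous_withinNx fc /continuous_withinNx gc fg.
apply: (cvg_unique _ fc); last 1 first.
  apply: cvg_trans gc; apply: near_eq_cvg; rewrite near_withinE.
  by near=> x => x0; apply/esym; apply: (near fg x) x0.
exact: norm_hausdorff.
Unshelve. all: by end_near.
Qed.

(** Write l and m for the frequencies of the two homomorphisms.  Dividing the
    identity by sin x ^ 2 and letting x tend to 0 with t fixed leaves
    (l^2 - m^2) (s t ^ 2 - sin t ^ 2) = 0, and l^2 differs from m^2 because the
    cosines differ at pi. *)
Lemma sin_square_rigid c s q (k : R -> R) : circle_hom c s -> circle_hom q k ->
  c pi != q pi ->
  (forall t x b g, pythagorean t x b g ->
     q x ^+ 2 * s t ^+ 2 + c x ^+ 2 * c t ^+ 2 =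
     s g ^+ 2 * s b ^+ 2 + q g ^+ 2 * c b ^+ 2) ->
  forall t, s t ^+ 2 = sin t ^+ 2.
Proof.
move=> hc hq cq E1 t.
have [l lE] := circle_homP hc; have [m mE] := circle_homP hq.
have [gl [glc gl0 glE]] := sin_square_ratio l.
have [gm [gmc gm0 gmE]] := sin_square_ratio m.
have [_ _ _ _ uc] := hc; have [_ _ _ _ uq] := hq.
have lm : l ^+ 2 - m ^+ 2 != 0.
  rewrite subr_eq0 eqf_sqr; apply: contraNN cq => lm.
  rewrite (lE pi).1 (mE pi).1; case/orP: lm => /eqP -> //.
  by rewrite mulNr cosN.
have [bc1 bc2] := legs_continuous t; have [l10 l20] := leg_at0 t.
have comp0 (u v : R -> R) : u 0 = 0 -> {for 0, continuous u} -> {for 0, continuous v} ->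
    {for 0, continuous (v \o u)}.
  by move=> u0 uc0 vc; apply: continuous_comp => //; rewrite u0.
have sq0 (v : R -> R) : {for 0, continuous v} -> {for 0, continuous (fun x => v x ^+ 2)}.
  by move=> vc; apply: (@continuous_comp _ _ _ v (fun y => y ^+ 2)) => //; exact: exprn_continuous.
have cos0c : {for 0, continuous (fun x => cos (leg1 t x))}.
  by apply: continuous_comp => //; exact: continuous_cos.
(* L and M are the two sides of the identity, rearranged and divided by sin x ^ 2 *)
pose L x := gl x + s t ^+ 2 * (gm x - gl x).
pose M x := gl (leg2 t x) * (cos t ^+ 2 / cos (leg1 t x) ^+ 2) + gm (leg1 t x) * sin t ^+ 2
  - s (leg2 t x) ^+ 2 * ((gm (leg1 t x) + gl (leg1 t x)) * sin t ^+ 2).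
have Lc : {for 0, continuous L}.
  by apply: cvgD => //; apply: cvgM; [exact: cvg_cst|exact: cvgB].
have glc1 := comp0 _ _ l10 bc1 glc; have gmc1 := comp0 _ _ l10 bc1 gmc.
have glc2 := comp0 _ _ l20 bc2 glc.
have sc2 : {for 0, continuous (fun x => s (leg2 t x))}.
  have [_ sc _ _ _] := hc; apply: continuous_comp => //; exact: sc.
have Mc : {for 0, continuous M}.
  apply: cvgB; [apply: cvgD|apply: cvgM].
  - apply: cvgM => //; apply: cvgM; first exact: cvg_cst.
    apply: cvgV; last exact: sq0.
    by rewrite l10 cos0 expr1n oner_neq0.
  - by apply: cvgM => //; exact: cvg_cst.
  - exact: sq0.
  - by apply: cvgM; [exact: cvgD|exact: cvg_cst].
have near0 : \forall x \near (0 : R), - (pi / 2) < x < pi / 2.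
  apply/nbhs_ballP; exists (pi / 2) => /=; first by rewrite divr_gt0 // pi_gt0.
  by move=> y; rewrite /ball /= sub0r normrN ltr_norml.
have : L 0 = M 0.
  apply: eq_continuous_at0 => //; near=> x => x0.
  have p0 := @pi_gt0 R.
  have xp : - (pi / 2) < x < pi / 2 by near: x.
  have cx := cos_gt0_pihalf xp; case/andP: xp => xp1 xp2.
  have [pyt cg cb] := legsP t cx; have e1 := E1 _ _ _ _ pyt.
  case: pyt => sg sb cc.
  have rng (y : R) : -1 <= y <= 1 -> - pi < asin y < pi.
    by move=> y1; have := asin_geNpi2 y1; have := asin_lepi2 y1; lra.
  have sx : sin x != 0.
    apply: contraNneq x0 => sx; rewrite -[x]sinK ?sx ?asin_zero //.
    by rewrite in_itv /= !ltW.

  have g1 : - pi < leg1 t x < pi.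
    by apply: rng; rewrite -sg sin_geN1 sin_le1.
  have zE : sin x * cos t / cos (leg1 t x) = sin (leg2 t x).
    by rewrite -sb mulrC mulKf // gt_eqF.
  have g2 : - pi < leg2 t x < pi by apply: rng; rewrite zE sin_geN1 sin_le1.
  have x1 : - pi < x < pi by lra.
  have := glE _ x1; have := gmE _ x1; have := glE _ g2; have := glE _ g1; have := gmE _ g1.
  rewrite -!(lE _).2 -!(mE _).2 => a1 a2 a3 a4 a5.
  have ux := uc x; have vx := uq x; have ut := uc t.
  have vg := uq (leg1 t x); have ub := uc (leg2 t x).
  have sg2 : sin (leg1 t x) ^+ 2 = sin x ^+ 2 * sin t ^+ 2 by rewrite sg exprMn.
  have sb2 : sin (leg2 t x) ^+ 2 = sin x ^+ 2 * (cos t ^+ 2 / cos (leg1 t x) ^+ 2).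
    by rewrite mulrA -exprMn -sb exprMn mulrAC mulfV ?mul1r // expf_neq0 // gt_eqF.
  have main : s x ^+ 2 + s t ^+ 2 * (k x ^+ 2 - s x ^+ 2) =
     s (leg2 t x) ^+ 2 + k (leg1 t x) ^+ 2
     - s (leg2 t x) ^+ 2 * (k (leg1 t x) ^+ 2 + s (leg1 t x) ^+ 2).
    have e2 : q x ^+ 2 = 1 - k x ^+ 2 by lra.
    have e3 : c x ^+ 2 = 1 - s x ^+ 2 by lra.
    have e4 : c t ^+ 2 = 1 - s t ^+ 2 by lra.
    have e5 : c (leg2 t x) ^+ 2 = 1 - s (leg2 t x) ^+ 2 by lra.
    have e6 : q (leg1 t x) ^+ 2 = 1 - k (leg1 t x) ^+ 2 by lra.
    by move: e1; rewrite e2 e3 e4 e5 e6; lra.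
  rewrite sb2 in a3; move: main; rewrite a1 a2 a4 a5 sg2 => main.
  apply: (mulIf (expf_neq0 2 sx)); rewrite /L /M.
  move: a3 main; set r := cos t ^+ 2 / _; set S2 := s (leg2 t x) ^+ 2 => a3 main.
  rewrite (_ : _ * sin x ^+ 2 = gl (leg2 t x) * (sin x ^+ 2 * r) + gm (leg1 t x) * sin t ^+ 2 * sin x ^+ 2
    - S2 * ((gm (leg1 t x) + gl (leg1 t x)) * sin t ^+ 2) * sin x ^+ 2); last by lra.
  by rewrite -a3; lra.
rewrite /L /M l10 l20 (circle_hom0 hc).2 gl0 gm0 cos0 expr0n expr1n /= divr1 mul0r subr0.
have := cos2Dsin2 t => u e; apply/eqP; rewrite -subr_eq0.
suff /eqP : (l ^+ 2 - m ^+ 2) * (s t ^+ 2 - sin t ^+ 2) = 0.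
  by rewrite mulf_eq0 (negbTE lm).
rewrite (_ : cos t ^+ 2 = 1 - sin t ^+ 2) in e; last by lra.
lra.
Unshelve. all: by end_near.
Qed.

(** The sign in front of sin is that of the value at pi / 2. *)
Lemma circle_hom_quarter c s : circle_hom c s -> c (pi / 2) = 0 ->
  (forall t, s t ^+ 2 = sin t ^+ 2) ->
  forall t, c t = cos t /\ s t = s (pi / 2) * sin t.
Proof.
move=> h c0 s2; have [_ _ cD sD uc] := h.
have cE t : c t = cos t.
  have -> : t = 2 * (t / 2) by field.
  rewrite (circle_hom2 _ h).1 cos_double.
  have := uc (t / 2); have := cos2Dsin2 (t / 2); rewrite s2; lra.
move=> t; split=> //.
have -> : t = (t - pi / 2) + pi / 2 by lra.
by rewrite sD c0 mulr0 add0r cE cosBpihalf mulrC subrK.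
Qed.

(** Given angles g <= x in ]0, pi/2[ there is a triangle with hypotenuse x and leg
    g, and the identity says that k^2 / (sin cos)^2 takes the same value at both.
    Hence k ^ 2 = C sin (2 x) ^ 2, and comparing k x with k (2 x) gives C = 1. *)
Lemma double_angle_rigid q (k : R -> R) : circle_hom q k -> (exists t, k t != 0) ->
  (forall t x b g, pythagorean t x b g ->
     sin t ^+ 2 * k x ^+ 2 = cos b ^+ 2 * k g ^+ 2) ->
  forall t, [/\ q t = cos (2 * t), k t = k (pi / 4) * sin (2 * t) & k (pi / 4) ^+ 2 = 1].
Proof.
move=> h [t0 kt0] E; have [q0 k0] := circle_hom0 h; have [_ _ qD kD uq] := h.
have p0 := @pi_gt0 R; set C := k (pi / 4) ^+ 2.
have ratio (g x : R) : 0 < g -> g <= x -> x < pi / 2 ->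
    k x ^+ 2 * (sin g * cos g) ^+ 2 = k g ^+ 2 * (sin x * cos x) ^+ 2.
  move=> g0 gx xp.
  have sg : 0 < sin g by apply: sin_gt0_pihalf; lra.
  have sx : 0 < sin x by apply: sin_gt0_pihalf; lra.
  have cg : 0 < cos g by apply: cos_gt0_pihalf; lra.
  have cx : 0 < cos x by apply: cos_gt0_pihalf; lra.
  have sgx : sin g <= sin x.
    have := @ltr_sin R; move=> mono; rewrite leNgt mono ?in_itv /= -?leNgt //; lra.
  have ug := cos2Dsin2 g; have ux := cos2Dsin2 x.
  have [y yE] : exists y, sin g = y * sin x.
    by exists (sin g / sin x); rewrite divfK ?gt_eqF.
  have y2 : y ^+ 2 <= 1.
    rewrite -(ler_pM2r (exprn_gt0 2 sx)) -exprMn -yE mul1r; nra.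
  have [t [ct st]] : exists t, cos t = Num.sqrt (1 - y ^+ 2) /\ sin t = y.
    by apply: angle_exists; rewrite sqr_sqrtr ?subr_ge0 // subrK.
  have ut := cos2Dsin2 t.
  have [b [cb sb]] : exists b, cos b = cos x / cos g /\ sin b = sin x * cos t / cos g.
    apply: angle_exists; rewrite !expr_div_n -mulrDl exprMn.
    apply: (mulIf (expf_neq0 2 (lt0r_neq0 cg))).
    rewrite divfK ?expf_neq0 ?gt_eqF // mul1r.
    have -> : cos t ^+ 2 = 1 - y ^+ 2 by rewrite -st; lra.
    have -> : cos g ^+ 2 = 1 - (y * sin x) ^+ 2 by rewrite -yE; lra.
    by rewrite exprMn; lra.
  have pyt : pythagorean t x b g.
    split; first by rewrite st mulrC.
      by rewrite sb mulrC divfK ?gt_eqF.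
    by rewrite cb mulrC divfK ?gt_eqF.
  have := E _ _ _ _ pyt; rewrite st cb => e.
  have cbg : (cos x / cos g) ^+ 2 * cos g ^+ 2 = cos x ^+ 2.
    by rewrite -exprMn divfK ?gt_eqF.
  rewrite yE !exprMn -cbg.
  transitivity (y ^+ 2 * k x ^+ 2 * (sin x ^+ 2 * cos g ^+ 2)); first by ring.
  by rewrite e; move: (cos x / cos g) => r; ring.
(* pi / 4 serves as reference point, where sin cos = 1/2 *)
have s4 : (sin (pi / 4) * cos (pi / 4)) ^+ 2 = 4^-1 :> R.
  have := sin_double (pi / 4 : R); rewrite (_ : 2 * (pi / 4) = pi / 2); last by lra.
  rewrite sin_pihalf => e; have -> : sin (pi / 4) * cos (pi / 4) = 2^-1 :> R by lra.
  by field.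
have KE x : 0 < x -> x < pi / 2 -> k x ^+ 2 = C * sin (2 * x) ^+ 2.
  move=> x0 xp; rewrite sin_double.
  have [xq|xq] := leP x (pi / 4).
    have := ratio _ _ x0 xq; rewrite s4 -/C => /(_ _) e; have {e} := e ltac:(lra).
    by lra.
  have := ratio (pi / 4) x; rewrite s4 -/C => e; have {e} := e ltac:(lra) ltac:(lra) xp.
  by lra.
have C0 : C != 0.
  apply: contraNneq kt0 => C0.
  have kz x : 0 < x -> x < pi / 2 -> k x = 0.
    by move=> x0 xp; have := KE _ x0 xp; rewrite C0 mul0r => /eqP; rewrite expf_eq0 => /eqP.
  have kzn x m : 0 < x -> x < pi / 2 -> k (x *+ m) = 0.
    move=> x0 xp; elim: m => [|m IH]; first by rewrite mulr0n.
    by rewrite mulrS kD IH kz // mul0r mulr0 addr0.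
  have kp t : 0 < t -> k t = 0.
    move=> t1; have b0 : 0 <= t / (pi / 2) by rewrite divr_ge0 ?ltW // divr_gt0.
    have := archi_boundP b0; set m := Num.bound _ => mE.
    have m0 : 0 < m%:R :> R by exact: le_lt_trans mE.
    have -> : t = (t / m%:R) *+ m by rewrite -mulr_natr divfK ?gt_eqF.
    apply: kzn; first exact: divr_gt0.
    by rewrite ltr_pdivrMr // mulrC -ltr_pdivrMr // divr_gt0.
  have [t1|t1|->] := ltgtP t0 0; last by rewrite k0.
    by rewrite -[t0]opprK (circle_homN _ h).2 kp ?oppr0 ?oppr_gt0.
  by rewrite kp.
have C1 : C = 1.
  pose x : R := pi / 8.
  have e1 := KE x; have e2 := KE (2 * x).
  have {}e1 : k x ^+ 2 = C * sin (2 * x) ^+ 2 by apply: e1; rewrite /x; lra.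
  have {}e2 : k (2 * x) ^+ 2 = C * sin (2 * (2 * x)) ^+ 2 by apply: e2; rewrite /x; lra.
  move: e2; rewrite (circle_hom2 x h).2.
  rewrite sin_double => e2.
  have := cos2Dsin2 (2 * x); have := uq x => u1 u2.
  have s0 : 0 < sin (2 * x) by apply: sin_gt0_pihalf; rewrite /x; lra.
  have : C * sin (2 * x) ^+ 2 * (sin (2 * x) ^+ 2 * (1 - C)) = 0.
    have e3 : q x ^+ 2 = 1 - C * sin (2 * x) ^+ 2 by lra.
    have e4 : cos (2 * x) ^+ 2 = 1 - sin (2 * x) ^+ 2 by lra.
    by move: e2; rewrite !exprMn e1 e3 e4; lra.
  have nz : C * sin (2 * x) ^+ 2 * sin (2 * x) ^+ 2 != 0.
    have s2 := expf_neq0 2 (lt0r_neq0 s0).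
    exact: mulf_neq0 (mulf_neq0 C0 s2) s2.
  by rewrite mulrA -[RHS](mulr0 (C * sin (2 * x) ^+ 2 * sin (2 * x) ^+ 2)) => /(mulfI nz); lra.
have qE y : 0 <= y -> y < pi -> q y = cos (2 * y).
  move=> y0 yp; have [->|y1] := eqVneq y 0; first by rewrite q0 mulr0 cos0.
  have -> : y = 2 * (y / 2) by field.
  have y2 : 0 < y / 2 by rewrite divr_gt0 // lt_neqAle eq_sym y1.
  have := KE _ y2; rewrite C1 mul1r => kE.
  have {}kE : k (y / 2) ^+ 2 = sin (2 * (y / 2)) ^+ 2 by apply: kE; lra.
  rewrite (circle_hom2 _ h).1 cos_double.
  have := uq (y / 2); have := cos2Dsin2 (2 * (y / 2)); lra.
set d := k (pi / 4); have d2 : d ^+ 2 = 1 by [].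
have h2 : circle_hom q (fun t => d * k t).
  case: (h) => qc kc _ _ _; split=> //.
  - by move=> x; apply: cvgM; [exact: cvg_cst|exact: kc].
  - by move=> a b; rewrite qD mulrACA -expr2 d2 mul1r.
  - by move=> a b; rewrite kD; lra.
  - by move=> a; rewrite exprMn d2 mul1r.
have q8 : q (pi / 8) = cos (2 * (pi / 8)) by apply: qE; lra.
have p8 : 0 < pi / 8 :> R by rewrite divr_gt0.
have pos1 (y : R) : `|y| <= pi / 8 -> 0 < q y.
  rewrite ler_norml => y8; have [yp|yn] := leP 0 y.
    by rewrite qE; [apply: cos_gt0_pihalf; lra|lra|lra].
  by rewrite -[y]opprK (circle_homN _ h).1 qE; [apply: cos_gt0_pihalf; lra|lra|lra].
have pos2 (y : R) : `|y| <= pi / 8 -> 0 < cos (2 * y).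
  by rewrite ler_norml => y8; apply: cos_gt0_pihalf; lra.
have k8 : d * k (pi / 8) = sin (2 * (pi / 8)).
  have := (circle_hom2 (pi / 8) h).2; have := sin_double (2 * (pi / 8)).
  rewrite (_ : 2 * (2 * (pi / 8)) = pi / 2); last by lra.
  rewrite sin_pihalf -q8 (_ : k (2 * _) = d); last by congr (k _); lra.
  move=> e1 e2; have c0 : q (pi / 8) != 0.
    by apply: contra_eq_neq e1 => ->; rewrite mulr0 oner_neq0.
  have e3 : d * (2 * k (pi / 8) * q (pi / 8)) = 1 by rewrite -e2 -expr2.
  by apply: (mulIf c0); lra.
move=> t; have [-> kE] := circle_hom_ext h2 (circle_hom_cossin 2) p8 pos1 pos2 q8 k8 t.
by split=> //; rewrite -kE mulrA -expr2 d2 mul1r.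
Qed.

(** In the application (c, s) is the rotation of the plane spanned by two lines V_jk
    and V_ki, (q, k) is the rotation of the span of V_ij and of a vector of V_0, and
    nu is a matrix coefficient.  The first identity determines the homomorphisms up
    to signs; then the second one is an affine equation in nu and s (pi / 2), and
    two triangles suffice to solve it. *)
Lemma circle_homs_rigid c s q (k : R -> R) nu : circle_hom c s -> circle_hom q k ->
  c (pi / 2) = 0 -> q pi = 1 -> (exists t, k t != 0) ->
  (forall t x b g, pythagorean t x b g ->
     q x ^+ 2 * s t ^+ 2 + c x ^+ 2 * c t ^+ 2 =
     s g ^+ 2 * s b ^+ 2 + q g ^+ 2 * c b ^+ 2) ->
  (forall t x b g, pythagorean t x b g ->
     s t * c t * (c x ^+ 2 - q x ^+ 2) =
     c g * q b * (s g * s b) + nu * (k b * k g * (q g * c b))) ->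
  [/\ forall t, q t = cos (2 * t), forall t, k t = k (pi / 4) * sin (2 * t),
      k (pi / 4) ^+ 2 = 1, nu = 2^-1 & s (pi / 2) = 1].
Proof.
move=> hc hq c2 qpi kn E1 E2.
have cpi : c pi = -1.
  rewrite (_ : pi = 2 * (pi / 2)); last by lra.
  by rewrite (circle_hom2 _ hc).1 c2; lra.
have s2 := sin_square_rigid hc hq _ E1.
have {}s2 : forall t, s t ^+ 2 = sin t ^+ 2 by apply: s2; rewrite cpi qpi; apply/eqP; lra.
have cs := circle_hom_quarter hc c2 s2; have [_ _ _ _ uc] := hc; have [_ _ _ _ uq] := hq.
set h := s (pi / 2) in cs *.
have h2 : h ^+ 2 = 1 by rewrite s2 sin_pihalf expr1n.
have dbl := double_angle_rigid hq kn.
have {}dbl : forall t, [/\ q t = cos (2 * t), k t = k (pi / 4) * sin (2 * t) & k (pi / 4) ^+ 2 = 1].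
  apply: dbl => t x b g pyt; have := E1 _ _ _ _ pyt.
  rewrite !s2 !(cs _).1; case: pyt => e1 e2 e3.
  have u1 := cos2Dsin2 x; have u2 := cos2Dsin2 t; have u3 := cos2Dsin2 g.
  have u4 := cos2Dsin2 b; have u5 := uq x; have u6 := uq g.
  have f2 : cos g ^+ 2 * sin b ^+ 2 = sin x ^+ 2 * cos t ^+ 2 by rewrite -!exprMn e2.
  have -> : q x ^+ 2 = 1 - k x ^+ 2 by lra.
  have -> : q g ^+ 2 = 1 - k g ^+ 2 by lra.
  have -> : cos x ^+ 2 = 1 - sin x ^+ 2 by lra.
  have -> : sin g ^+ 2 = 1 - cos g ^+ 2 by lra.
  by lra.
have kk : k (pi / 4) ^+ 2 = 1 by have [] := dbl 0.
have E3 t x b g : pythagorean t x b g -> sin t * cos t * sin x ^+ 2 != 0 ->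
    h * (4 * cos x ^+ 2 - 1) = 8 * nu * cos x ^+ 2 - 1 + cos b ^+ 2 * (2 - 4 * nu).
  move=> pyt nz; have := E2 _ _ _ _ pyt.
  rewrite !(cs _).1 !(cs _).2; have [-> _ _] := dbl x; have [-> -> _] := dbl b.
  have [-> -> _] := dbl g; rewrite !cos_double !sin_double.
  case: pyt => e1 e2 e3 e4; have u1 := cos2Dsin2 x.
  apply: (mulfI nz).
  have f3 : cos g ^+ 2 * cos b ^+ 2 = cos x ^+ 2 by rewrite -exprMn e3.
  have f1 : cos g * sin b * sin g = sin t * cos t * sin x ^+ 2 by rewrite e2 e1; ring.
  transitivity (h * sin t * cos t * (cos x ^+ 2 - (2 * cos x ^+ 2 - 1) ^+ 2)).
    have -> : sin x ^+ 2 = 1 - cos x ^+ 2 by lra.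
    ring.
  rewrite e4; transitivity (cos g * sin b * sin g * (h ^+ 2 * (2 * cos b ^+ 2 - 1)
      + 4 * nu * k (pi / 4) ^+ 2 * cos b ^+ 2 * (2 * cos g ^+ 2 - 1))); first by ring.
  rewrite h2 kk f1 -f3; ring.
(* The triangles with hypotenuse x and t = x or t = y, where cos x = 3/5 and
   cos y = 4/5, have rational cosines; they give two independent equations. *)
have [x [cx sx]] : exists x : R, cos x = 3 / 5 /\ sin x = 4 / 5.
  by apply: angle_exists; field.
have E4 t : cos t * sin t != 0 -> exists B, B * (1 - 16 / 25 * sin t ^+ 2) = 9 / 25 /\
   h * (11 / 25) = 72 / 25 * nu - 1 + B * (2 - 4 * nu).
  move=> ct; have cx0 : 0 < cos x by rewrite cx; lra.
  have [pyt _ _] := legsP t cx0; exists (cos (leg2 t x) ^+ 2); split.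
    case: pyt => e1 _ e3; have u := cos2Dsin2 (leg1 t x).
    transitivity ((cos (leg1 t x) * cos (leg2 t x)) ^+ 2); last by rewrite e3 cx; field.
    rewrite exprMn mulrC; congr (_ * _).
    have : sin (leg1 t x) ^+ 2 = 16 / 25 * sin t ^+ 2 by rewrite e1 sx; field.
    by lra.
  have := E3 _ _ _ _ pyt; rewrite cx sx => e.
  have {}e := e _; rewrite (_ : _ * (11 / 25) = h * (4 * (3 / 5) ^+ 2 - 1)); last by field.
  rewrite e; first by field.
  by rewrite [sin t * _]mulrC mulf_neq0 // expf_neq0 //; apply: lt0r_neq0; lra.
have [y [cy sy]] : exists y : R, cos y = 4 / 5 /\ sin y = 3 / 5.
  by apply: angle_exists; field.
have nz : (3 / 5 * (4 / 5) : R) != 0 by apply: lt0r_neq0; lra.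
have [|B1 [b1 e1]] := E4 x; first by rewrite cx sx.
have [|B2 [b2 e2]] := E4 y; first by rewrite cy sy mulrC.
rewrite sx in b1; rewrite sy in b2.
have {}b1 : B1 = 25 / 41 by lra.
have {}b2 : B2 = 225 / 481 by lra.
rewrite b1 in e1; rewrite b2 in e2.
have nuE : nu = 2^-1 by lra.
split=> //.
- by move=> t; have [] := dbl t.
- by move=> t; have [] := dbl t.
- by rewrite nuE in e1; lra.
Qed.

End CircleHom.

(** * Coordinate rotations *)

Section Rotations.
Variables (R : realType) (n : nat).
Implicit Types (i j k l : 'I_n) (p q v : 'cV[R]_n) (A B O : 'M[R]_n) (t s : R).

Definition unitv i : 'cV[R]_n := delta_mx i 0.

(** Defined for any orthonormal pair of vectors and not only for coordinate axes, so
    that conjugation by an orthogonal matrix is a change of this pair. *)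
Definition plane_rot p q t : 'M[R]_n :=
  1%:M + (cos t - 1) *: (p *m p^T + q *m q^T) + sin t *: (q *m p^T - p *m q^T).

Definition rot i j t := plane_rot (unitv i) (unitv j) t.

Lemma unitv_dot i j : (unitv i)^T *m unitv j = (i == j)%:R%:M.
Proof.
rewrite trmx_delta mul_delta_mx_cond; apply/matrixP => a b; rewrite !ord1 !mxE.
by case: eqP; rewrite ?mulr1n ?mulr0n mxE.
Qed.

Lemma mx_unitv_ext (A B : 'M[R]_n) : (forall k, A *m unitv k = B *m unitv k) -> A = B.
Proof.
move=> AB; apply/matrixP => i k.
by have := congr1 (fun v : 'cV_n => v i 0) (AB k); rewrite -!colE !mxE.
Qed.

Lemma cv_unitv_sum v : v = \sum_i v i 0 *: unitv i.
Proof.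
rewrite [LHS]matrix_sum_delta; apply: eq_bigr => i _.
by rewrite big_ord1.
Qed.

Lemma plane_rotM p q t v : plane_rot p q t *m v =
  v + (cos t - 1) *: (p *m (p^T *m v) + q *m (q^T *m v))
    + sin t *: (q *m (p^T *m v) - p *m (q^T *m v)).
Proof.
by rewrite /plane_rot !mulmxDl mul1mx -!scalemxAl !mulmxDl mulNmx !mulmxA.
Qed.

Lemma plane_rotE p q t a b : plane_rot p q t a b =
  (a == b)%:R + (cos t - 1) * (p a 0 * p b 0 + q a 0 * q b 0)
    + sin t * (q a 0 * p b 0 - p a 0 * q b 0).
Proof. by rewrite /plane_rot !mxE !big_ord1 !mxE. Qed.

Section TwoAxes.
Variables (i j : 'I_n) (ij : i != j).

Lemma rot_unitvl t : rot i j t *m unitv i = cos t *: unitv i + sin t *: unitv j.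
Proof.
rewrite /rot plane_rotM !unitv_dot eqxx (eq_sym j) (negbTE ij) !mul_mx_scalar.
by apply/colP => a; rewrite !mxE /=; ring.
Qed.

Lemma rot_unitvr t : rot i j t *m unitv j = cos t *: unitv j - sin t *: unitv i.
Proof.
rewrite /rot plane_rotM !unitv_dot eqxx (negbTE ij) !mul_mx_scalar.
by apply/colP => a; rewrite !mxE /=; ring.
Qed.

Lemma rot_unitv_other t k : k != i -> k != j -> rot i j t *m unitv k = unitv k.
Proof.
move=> ki kj; rewrite /rot plane_rotM !unitv_dot ![_ == k]eq_sym (negbTE ki) (negbTE kj).
by rewrite !mul_mx_scalar; apply/colP => a; rewrite !mxE /=; ring.
Qed.

Lemma rotD t s : rot i j (t + s) = rot i j t *m rot i j s.
Proof.
apply: mx_unitv_ext => k; rewrite -mulmxA.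
have [->|ki] := eqVneq k i.
  rewrite !rot_unitvl mulmxDr -!scalemxAr rot_unitvl rot_unitvr cosD sinD.
  apply/colP => a; rewrite !mxE; ring.
have [->|kj] := eqVneq k j.
  rewrite !rot_unitvr mulmxBr -!scalemxAr rot_unitvl rot_unitvr cosD sinD.
  apply/colP => a; rewrite !mxE; ring.
by rewrite !rot_unitv_other.
Qed.

Lemma rot0 : rot i j 0 = 1%:M.
Proof. by rewrite /rot /plane_rot cos0 sin0 subrr !scale0r !addr0. Qed.

Lemma rot_tr t : (rot i j t)^T = rot i j (- t).
Proof.
by apply/matrixP => a b; rewrite mxE !plane_rotE cosN sinN eq_sym; ring.
Qed.

Lemma rotK t : rot i j t *m (rot i j t)^T = 1%:M.
Proof. by rewrite rot_tr -rotD subrr rot0. Qed.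

Lemma SO_rot t : SO (rot i j t).
Proof.
split; first exact: rotK.
have -> : t = t / 2 + t / 2 by lra.
rewrite rotD det_mulmx -expr2.
have := congr1 determinant (rotK (t / 2)).
by rewrite det_mulmx det_tr det1 -expr2.
Qed.

End TwoAxes.

Lemma plane_rotC p q t : plane_rot q p t = plane_rot p q (- t).
Proof. by rewrite /plane_rot cosN sinN [q *m q^T + _]addrC scaleNr -scalerN opprB. Qed.

Lemma plane_rotNl p q t : plane_rot (- p) q t = plane_rot p q (- t).
Proof.
by apply/matrixP => a b; rewrite !plane_rotE !mxE cosN sinN; ring.
Qed.

Lemma plane_rotNr p q t : plane_rot p (- q) t = plane_rot p q (- t).
Proof. by rewrite plane_rotC plane_rotNl plane_rotC opprK. Qed.

Lemma rotC i j t : rot j i t = rot i j (- t).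
Proof. exact: plane_rotC. Qed.

Lemma SO1 : SO (1%:M : 'M[R]_n).
Proof. by split; rewrite ?trmx1 ?mulmx1 ?det1. Qed.

Lemma SO_tr A : SO A -> SO A^T.
Proof. by case=> AA dA; split; rewrite ?trmxK ?det_tr //; exact: mulmx1C. Qed.

Lemma SO_trK A : SO A -> A^T *m A = 1%:M.
Proof. by case=> /mulmx1C. Qed.

Lemma conj_rot A i j t : SO A ->
  A *m rot i j t = plane_rot (A *m unitv i) (A *m unitv j) t *m A.
Proof.
move=> hA; rewrite /rot /plane_rot !mulmxDl mul1mx -!scalemxAl !mulmxDl mulNmx !mulmxDr mulmx1.
rewrite -!scalemxAr !mulmxDr mulmxN !trmx_mul.
have e p q : A *m p *m (q^T *m A^T) *m A = A *m (p *m q^T).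
  by rewrite -!mulmxA SO_trK // mulmx1.
by rewrite !e.
Qed.

Definition quarter i j := rot i j (pi / 2).

Lemma quarter_l i j : i != j -> quarter i j *m unitv i = unitv j.
Proof. by move=> ij; rewrite rot_unitvl // cos_pihalf sin_pihalf scale0r scale1r add0r. Qed.

Lemma quarter_r i j : i != j -> quarter i j *m unitv j = - unitv i.
Proof. by move=> ij; rewrite rot_unitvr // cos_pihalf sin_pihalf scale0r scale1r sub0r. Qed.

Lemma quarter_o i j k : i != j -> k != i -> k != j -> quarter i j *m unitv k = unitv k.
Proof. by move=> ij ki kj; rewrite rot_unitv_other. Qed.

Lemma rot_continuous i j : continuous (rot i j : R -> 'M[R]_n).
Proof.
move=> t; rewrite /rot /plane_rot; apply: cvgD; first apply: cvgD; first exact: cvg_cst.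
  apply: cvgZr_tmp; apply: cvgB; [exact: continuous_cos|exact: cvg_cst].
by apply: cvgZr_tmp; exact: continuous_sin.
Qed.

(** By [SO_rot_gen] below, these are all the elements of SO_n that fix the first [k]
    basis vectors. *)
Inductive rot_gen (k : nat) : 'M[R]_n -> Prop :=
| RotGen1 : rot_gen k 1%:M
| RotGenM i j t A : i != j -> (k <= i)%N -> (k <= j)%N -> rot_gen k A ->
    rot_gen k (rot i j t *m A).

Lemma rot_gen_SO (k : nat) A : rot_gen k A -> SO A.
Proof.
elim=> [|i j t B ij _ _ _ SB]; first exact: SO1.
by apply: SO_mul => //; exact: SO_rot.
Qed.

Lemma rot_gen_rot (k : nat) i j t : i != j -> (k <= i)%N -> (k <= j)%N -> rot_gen k (rot i j t).
Proof. by move=> *; rewrite -[rot _ _ _]mulmx1; apply: RotGenM => //; exact: RotGen1. Qed.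

Lemma rot_gen_mul (k : nat) A B : rot_gen k A -> rot_gen k B -> rot_gen k (A *m B).
Proof.
move=> + hB; elim=> [|i j t C ij ki kj _ IH]; first by rewrite mul1mx.
by rewrite -mulmxA; exact: RotGenM.
Qed.

Lemma rot_gen_tr (k : nat) A : rot_gen k A -> rot_gen k A^T.
Proof.
elim=> [|i j t C ij ki kj _ IH]; first by rewrite trmx1; exact: RotGen1.
by rewrite trmx_mul rot_tr; apply: rot_gen_mul => //; exact: rot_gen_rot.
Qed.

Lemma rot_gen_sub (k l : nat) A : (k <= l)%N -> rot_gen l A -> rot_gen k A.
Proof.
move=> kl; elim=> [|i j t C ij ki kj _ IH]; first exact: RotGen1.
by apply: RotGenM => //; exact: leq_trans kl _.
Qed.

Lemma rot_gen_fix (k : nat) A i : (i < k)%N -> rot_gen k A -> A *m unitv i = unitv i.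
Proof.
move=> ik; elim=> [|a b t C ab ka kb _ IH]; first by rewrite mul1mx.
rewrite -mulmxA IH rot_unitv_other //; apply: contraTneq ik => ->; by rewrite -leqNgt.
Qed.

Lemma rot_coord i j t v : i != j ->
  [/\ (rot i j t *m v) i 0 = cos t * v i 0 - sin t * v j 0,
      (rot i j t *m v) j 0 = sin t * v i 0 + cos t * v j 0 &
      forall k, k != i -> k != j -> (rot i j t *m v) k 0 = v k 0].
Proof.
move=> ij.
have dot k (w : 'cV[R]_n) : (unitv k)^T *m w = (w k 0)%:M.
  rewrite trmx_delta -rowE; apply/matrixP => a b; rewrite !ord1 !mxE eqxx mulr1n //.
have E k : (rot i j t *m v) k 0 = v k 0 + (cos t - 1) * ((k == i)%:R * v i 0 + (k == j)%:R * v j 0)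
   + sin t * ((k == j)%:R * v i 0 - (k == i)%:R * v j 0).
  rewrite /rot plane_rotM !dot !mul_mx_scalar !mxE !eqxx !andbT /=.
  by rewrite ![v _ _ * _]mulrC.
split.
- by rewrite E eqxx (negbTE ij) /=; ring.
- by rewrite E eqxx eq_sym (negbTE ij) /=; ring.
- by move=> k ki kj; rewrite E (negbTE ki) (negbTE kj) /=; ring.
Qed.

Lemma rot_align (a b : R) : exists t, sin t * a + cos t * b = 0 /\ 0 <= cos t * a - sin t * b.
Proof.
have [z|nz] := eqVneq (a ^+ 2 + b ^+ 2) 0.
  exists 0; rewrite cos0 sin0.
  have /andP[/eqP a0 /eqP b0] : (a == 0) && (b == 0).
    by rewrite -(sqrf_eq0 a) -(sqrf_eq0 b) -paddr_eq0 ?sqr_ge0 // z.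
  by rewrite a0 b0; split; lra.
have p : 0 < a ^+ 2 + b ^+ 2 by rewrite lt_neqAle eq_sym nz addr_ge0 ?sqr_ge0.
set r := Num.sqrt (a ^+ 2 + b ^+ 2).
have r0 : 0 < r by rewrite sqrtr_gt0.
have r2 : r ^+ 2 = a ^+ 2 + b ^+ 2 by rewrite sqr_sqrtr // ltW.
have [t [ct st]] : exists t, cos t = a / r /\ sin t = - b / r.
  by apply: angle_exists; rewrite !expr_div_n -mulrDl r2 sqrrN mulfV.
exists t; rewrite ct st; split; first by field; rewrite gt_eqF.
rewrite (_ : _ - _ = (a ^+ 2 + b ^+ 2) / r); last by field; rewrite gt_eqF.
by rewrite divr_ge0 ?ltW.
Qed.

(** The rotation in the plane (k, j) can cancel the coordinate j.  The sign of the
    coordinate k is under control only if at least one rotation is used, whence the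
    condition on k. *)
Lemma rot_eliminate k v : exists2 A, rot_gen k A &
  (forall j, (k < j)%N -> (A *m v) j 0 = 0) /\ ((k.+1 < n)%N -> 0 <= (A *m v) k 0).
Proof.
suff H m : (m <= n)%N -> exists2 A, rot_gen k A &
    (forall j : 'I_n, (k < j < m)%N -> (A *m v) j 0 = 0) /\ ((k.+1 < m)%N -> 0 <= (A *m v) k 0).
  have [A gA [A0 Ak]] := H n (leqnn n); exists A => //; split=> // j kj.
  by apply: A0; rewrite kj /=.
elim: m => [|m IH] mn.
  by exists 1%:M; [exact: RotGen1|split=> // j; rewrite ltn0 andbF].
have [A gA [A0 Ak]] := IH (ltnW mn).
have [km|mk] := ltnP k m; last first.
  exists A => //; split; last by rewrite ltnS ltnNge mk.
  by move=> j /andP[kj jm]; have := leq_trans kj (jm : (j <= m)%N); rewrite ltnNge mk.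
pose j := Ordinal mn; have kj : k != j by rewrite -val_eqE /= neq_ltn km.
have [t [t1 t2]] := rot_align ((A *m v) k 0) ((A *m v) j 0).
exists (rot k j t *m A); first by apply: RotGenM => //=; exact: ltnW.
rewrite -mulmxA; have [ei ej eo] := rot_coord t (A *m v) kj; split; last by rewrite ei.
move=> l /andP[kl lm]; have [->|lj] := eqVneq l j; first by rewrite ej.
have lk : l != k by rewrite -val_eqE /= neq_ltn kl orbT.
rewrite eo //; apply: A0; rewrite kl /= ltn_neqAle -ltnS lm andbT.
by move: lj; rewrite -val_eqE.
Qed.

(** Eliminate column by column.  The last diagonal entry is 1 because the
    determinant is. *)
Lemma SO_rot_gen (k : nat) A : SO A -> (forall i, (i < k)%N -> A *m unitv i = unitv i) ->
  rot_gen k A.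
Proof.
have [m] := ubnP (n - k); elim: m k A => // m IH k A nkm hA fixA.
have [nk|kn] := leqP n k.
  have -> : A = 1%:M; last exact: RotGen1.
  by apply: mx_unitv_ext => i; rewrite mul1mx fixA // (leq_trans (ltn_ord i)).
pose kk := Ordinal kn.
have [B gB [B0 Bk]] := rot_eliminate kk (A *m unitv kk).
have hB := rot_gen_SO gB; set C := B *m A; have hC : SO C by exact: SO_mul.
have fixC i : (i < k)%N -> C *m unitv i = unitv i.
  by move=> ik; rewrite -mulmxA fixA // (rot_gen_fix ik gB).
have dotC i : (unitv i)^T *m (C *m unitv kk) = ((C *m unitv kk) i 0)%:M.
  by rewrite trmx_delta -rowE; apply/matrixP => a b; rewrite !ord1 !mxE eqxx mulr1n.
have Ck i : i != kk -> (C *m unitv kk) i 0 = 0.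
  move=> ik; case: (ltngtP i k) => [lt|gt|eq]; last by rewrite -val_eqE /= eq eqxx in ik.
    have := dotC i; rewrite -{1}(fixC i lt) trmx_mul -mulmxA (mulmxA C^T) SO_trK // mul1mx.
    rewrite unitv_dot (negbTE ik) => /matrixP /(_ 0 0); rewrite !mxE eqxx !mulr1n.
    by [].
  by rewrite /C -mulmxA; apply: B0.
set c := (C *m unitv kk) kk 0 in Ck.
have CE : C *m unitv kk = c *: unitv kk.
  rewrite [LHS]cv_unitv_sum (bigD1 kk) //= big1 ?addr0 // => i ik.
  by rewrite Ck // scale0r.
have c2 : c ^+ 2 = 1.
  have := unitv_dot kk kk; rewrite -{2}[unitv kk]mul1mx -(SO_trK hC) -mulmxA mulmxA -trmx_mul CE.
  have -> : (c *: unitv kk)^T = c *: (unitv kk)^T by apply/matrixP => a b; rewrite !mxE.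
  rewrite -scalemxAl -scalemxAr scalerA unitv_dot eqxx => /matrixP /(_ 0 0).
  by rewrite !mxE eqxx !mulr1n mulr1.
have c1 : c = 1.
  have [k1n|nk1] := ltnP k.+1 n.
    have := Bk k1n; rewrite mulmxA -/C -/c => c0.
    by apply/eqP; rewrite -(@eqrXn2 _ 2) // c2 expr1n.
  have CD : C = diag_mx (\row_i (if i == kk then c else 1)).
    apply: mx_unitv_ext => i; rewrite -[in RHS]colE.
    have -> : C *m unitv i = (if i == kk then c else 1) *: unitv i.
      case: (eqVneq i kk) => [->|ik]; first exact: CE.
      rewrite scale1r fixC // ltn_neqAle -ltnS (leq_trans (ltn_ord i)) // andbT.
      by move: ik; rewrite -val_eqE.
    apply/colP => a; rewrite !mxE eqxx andbT mulr_natr.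
    by case: (eqVneq a i) => [->|ai]; rewrite ?eqxx // !mulr0n.
  case: hC => _; rewrite CD det_diag (bigD1 kk) //= mxE eqxx big1 ?mulr1 // => i ik.
  by rewrite mxE (negbTE ik).
have -> : A = B^T *m C by rewrite mulmxA SO_trK // mul1mx.
apply: rot_gen_mul; first exact: rot_gen_tr.
apply: (@rot_gen_sub k k.+1) => //; apply: IH => //.
  by rewrite subnS -ltnS prednK // subn_gt0.
move=> i; rewrite ltnS leq_eqVlt => /orP[/eqP ik|]; last exact: fixC.
by have -> : i = kk; [exact: val_inj|rewrite CE c1 scale1r].
Qed.

(** Both products send e_k to the same unit vector when b and g solve the right
    spherical triangle; they then differ by a rotation of the plane (i, j). *)
Lemma rot_refactor i j k t x b g : i != j -> j != k -> k != i -> pythagorean t x b g ->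
  exists a, rot i j t *m rot j k x = rot j k b *m rot k i g *m rot i j a.
Proof.
move=> ij jk ki [e1 e2 e3].
have ji : j != i by rewrite eq_sym.
have kj : k != j by rewrite eq_sym.
have ik : i != k by rewrite eq_sym.
have ut := cos2Dsin2 t; have ug := cos2Dsin2 g; have ub := cos2Dsin2 b.
have f : cos t * sin g = sin t * (sin b * cos g).
  by rewrite [sin b * _]mulrC e2 e1; ring.
have [a [ca sa]] : exists a, cos a = cos t * cos g + sin t * sin b * sin g /\ sin a = sin t * cos b.
  apply: angle_exists.
  transitivity ((cos t * cos g + sin t * sin b * sin g) ^+ 2 +
     (cos t * sin g - sin t * (sin b * cos g)) ^+ 2 + (sin t * cos b) ^+ 2).
    by rewrite f subrr; ring.
  transitivity ((cos t ^+ 2 + sin t ^+ 2 * sin b ^+ 2) * (cos g ^+ 2 + sin g ^+ 2)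
     + sin t ^+ 2 * cos b ^+ 2); first by ring.
  by rewrite ug mulr1 -addrA -mulrDr [sin b ^+ 2 + _]addrC ub mulr1.
exists a; apply: mx_unitv_ext => l; rewrite -!mulmxA.
have h1 : cos a * cos g = cos t.
  transitivity (cos t * cos g ^+ 2 + (sin t * (sin b * cos g)) * sin g); first by rewrite ca; ring.
  by rewrite -f -[RHS]mulr1 -ug; ring.
have h2 : cos a * sin g * sin b + sin a * cos b = sin t.
  transitivity (cos t * sin g * cos g * sin b + sin t * (sin b ^+ 2 * sin g ^+ 2 + cos b ^+ 2)).
    by rewrite ca sa; ring.
  transitivity (sin t * (sin b ^+ 2 * (cos g ^+ 2 + sin g ^+ 2) + cos b ^+ 2)); first by rewrite f; ring.
  by rewrite ug mulr1 addrC ub mulr1.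
have h3 : sin a * sin b - cos a * sin g * cos b = 0.
  transitivity (cos b * (sin t * sin b * (1 - sin g ^+ 2) - cos t * sin g * cos g)).
    by rewrite ca sa; ring.
  by rewrite f (_ : 1 - _ = cos g ^+ 2); [ring|lra].
have h4 : sin a * cos g = sin t * cos x by rewrite sa -e3; ring.
have h5 : cos a * cos b - sin a * sin g * sin b = cos t * cos x by rewrite ca sa -e3; ring.
have h6 : cos a * sin b + sin a * sin g * cos b = sin x.
  transitivity (cos t * (cos g * sin b) + sin t * sin g * (cos b ^+ 2 + sin b ^+ 2)).
    by rewrite ca sa; ring.
  by rewrite ub mulr1 e2 e1 -[RHS]mulr1 -ut; ring.
have mD (A : 'M[R]_n) (y z : R) (u w : 'cV[R]_n) : A *m (y *: u + z *: w) = y *: (A *m u) + z *: (A *m w).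
  by rewrite mulmxDr -!scalemxAr.
have mB (A : 'M[R]_n) (y z : R) (u w : 'cV[R]_n) : A *m (y *: u - z *: w) = y *: (A *m u) - z *: (A *m w).
  by rewrite mulmxBr -!scalemxAr.
pose E := (rot_unitv_other _ ij ik, rot_unitv_other _ jk ji, rot_unitv_other _ ki kj,
  rot_unitvl ij, rot_unitvr ij, rot_unitvl jk, rot_unitvr jk, rot_unitvl ki, rot_unitvr ki, mD, mB).
have [->|li] := eqVneq l i.
  rewrite !E; apply/colP => y; rewrite !mxE.
  transitivity (cos t * unitv i y 0 + sin t * unitv j y 0 + 0 * unitv k y 0).
    by rewrite !mxE; ring.
  by rewrite -h1 -h2 -h3 !mxE; ring.
have [->|lj] := eqVneq l j.
  rewrite !E; apply/colP => y; rewrite !mxE.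
  transitivity (cos t * cos x * unitv j y 0 - sin t * cos x * unitv i y 0 + sin x * unitv k y 0).
    by rewrite !mxE; ring.
  by rewrite -h4 -h5 -h6 !mxE; ring.
have [->|lk] := eqVneq l k.
  rewrite !E; apply/colP => y; rewrite !mxE.
  transitivity (- (sin x * cos t) * unitv j y 0 + sin x * sin t * unitv i y 0 + cos x * unitv k y 0).
    by rewrite !mxE; ring.
  by rewrite -e1 -e2 -e3 !mxE; ring.
by rewrite !rot_unitv_other.
Qed.

End Rotations.

(** * Joint eigenspaces of the half turns *)

Section Functionals.
Variables (R : realType) (V : vectType R).
Implicit Types (u v : V) (f : 'Hom(V, R^o)).

Definition ev f v : R := f v.

Lemma evD f u v : ev f (u + v) = ev f u + ev f v. Proof. exact: linearD. Qed.
Lemma evB f u v : ev f (u - v) = ev f u - ev f v. Proof. exact: linearB. Qed.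
Lemma evN f u : ev f (- u) = - ev f u. Proof. exact: linearN. Qed.
Lemma evZ f a u : ev f (a *: u) = a * ev f u. Proof. exact: linearZ. Qed.
Lemma ev0 f : ev f 0 = 0. Proof. exact: linear0. Qed.
Definition evE := (evD, evB, evN, evZ, ev0).

(** Identities between vectors are reduced to identities between scalars, for which
    there are decision procedures. *)
Lemma ev_ext u v : (forall f, ev f u = ev f v) -> u = v.
Proof.
move=> uv; rewrite (coord_vbasis (memvf u)) (coord_vbasis (memvf v)).
apply: eq_bigr => i _; congr (_ *: _).
by have := uv (linfun (coord (vbasis fullv) i : V -> R^o)); rewrite /ev !lfunE.
Qed.

Lemma ev_neq0 v : v != 0 -> exists f, ev f v = 1.
Proof.
move=> v0; have [f fv] : exists f, ev f v != 0.
  apply: contrapT => /forallNP H; move/eqP: v0; apply; apply: ev_ext => f.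
  by rewrite ev0; apply/eqP/negbNE/negP; exact: H.
exists ((ev f v)^-1 *: f); rewrite /ev scale_lfunE.
exact: mulVf.
Qed.

End Functionals.

Ltac module := apply: ev_ext => ?; rewrite ?evE; by field.

Section Linear.
Variables (R : realType) (U V : vectType R) (f : 'Hom(U, V)).
Implicit Types (u v : U) (a : R).
Lemma homD u v : f (u + v) = f u + f v. Proof. exact: linearD. Qed.
Lemma homB u v : f (u - v) = f u - f v. Proof. exact: linearB. Qed.
Lemma homN u : f (- u) = - f u. Proof. exact: linearN. Qed.
Lemma homZ a u : f (a *: u) = a *: f u. Proof. exact: linearZ. Qed.
Lemma hom0 : f 0 = 0. Proof. exact: linear0. Qed.
End Linear.
Definition homE := (homD, homB, homN, homZ, hom0).

Section Weights.
Variables (R : realType) (n : nat) (V : SOrep R n).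
Implicit Types (i j k l : 'I_n) (u v w : V) (A B : 'M[R]_n) (t s : R) (S : 'I_n -> bool).

Local Notation act := (rep_act V).

Lemma actM A B v : SO A -> SO B -> act (A *m B) v = act A (act B v).
Proof. by move=> hA hB; rewrite rep_actM // comp_lfunE. Qed.

Lemma act1 v : act 1%:M v = v.
Proof. by rewrite rep_act1 id_lfunE. Qed.

Lemma actK A v : SO A -> act A^T (act A v) = v.
Proof. by move=> hA; rewrite -actM ?SO_trK ?act1 //; exact: SO_tr. Qed.

Lemma actKV A v : SO A -> act A (act A^T v) = v.
Proof. by move=> hA; rewrite -{1}(trmxK A) actK //; exact: SO_tr. Qed.

Lemma act_inj A : SO A -> injective (act A).
Proof. by move=> hA u v /(congr1 (act A^T)); rewrite !actK. Qed.

(** The eigenvalue of [rot k l pi] on the weight space of [S]; complementary subsets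
    define the same character. *)
Definition chi S k l : R := (-1) ^+ (S k (+) S l).

Definition wt S : {vspace V} :=
  (\bigcap_(kl : 'I_n * 'I_n | kl.1 != kl.2)
     lker (act (rot kl.1 kl.2 pi) - chi S kl.1 kl.2 *: \1%VF))%VS.

Lemma wtP S v :
  reflect (forall k l, k != l -> act (rot k l pi) v = chi S k l *: v) (v \in wt S).
Proof.
apply: (iffP idP) => [|].
  rewrite memvE => /subv_bigcapP.
  move=> H k l kl.
  have := H (k, l) kl; rewrite -memvE memv_ker add_lfunE opp_lfunE scale_lfunE id_lfunE subr_eq0.
  by move/eqP.
move=> H; rewrite memvE; apply/subv_bigcapP => -[k l] /= kl.
by rewrite -memvE memv_ker add_lfunE opp_lfunE scale_lfunE id_lfunE H // subrr.
Qed.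

Lemma eq_wt S S' : S =1 S' -> wt S = wt S'.
Proof.
by move=> SS; congr (wt _); apply/funext.
Qed.

(** The even and odd parts in t of the action of [rot i j t]: like cos and sin, they
    commute with each other and satisfy addition formulas, and they map weight
    spaces to weight spaces although rotations do not. *)
Definition evenrot i j t : 'End(V) := 2^-1 *: (act (rot i j t) + act (rot i j (- t))).
Definition oddrot i j t : 'End(V) := 2^-1 *: (act (rot i j t) - act (rot i j (- t))).

Lemma evenrotE i j t v : evenrot i j t v = 2^-1 *: (act (rot i j t) v + act (rot i j (- t)) v).
Proof. by rewrite scale_lfunE add_lfunE. Qed.
Lemma oddrotE i j t v : oddrot i j t v = 2^-1 *: (act (rot i j t) v - act (rot i j (- t)) v).
Proof. by rewrite scale_lfunE add_lfunE opp_lfunE. Qed.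

Lemma act_rotE i j t v : act (rot i j t) v = evenrot i j t v + oddrot i j t v.
Proof. by rewrite evenrotE oddrotE; module. Qed.

Lemma act_rotNE i j t v : act (rot i j (- t)) v = evenrot i j t v - oddrot i j t v.
Proof. by rewrite evenrotE oddrotE; module. Qed.

Lemma evenrotN i j t : evenrot i j (- t) = evenrot i j t.
Proof. by rewrite /evenrot opprK addrC. Qed.
Lemma oddrotN i j t : oddrot i j (- t) = - oddrot i j t.
Proof. by rewrite /oddrot opprK -scalerN opprB. Qed.

Lemma oddrotC i j t : oddrot j i t = - oddrot i j t.
Proof. by rewrite /oddrot !(rotC i j) opprK -scalerN opprB. Qed.

Section Plane.
Variables (i j : 'I_n) (ij : i != j).

Lemma act_rotD t s v : act (rot i j (t + s)) v = act (rot i j t) (act (rot i j s) v).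
Proof. by rewrite rotD // actM //; exact: SO_rot. Qed.

Lemma act_rot0 v : act (rot i j 0) v = v.
Proof. by rewrite rot0 act1. Qed.

Lemma act_rot_comm t s v :
  act (rot i j t) (act (rot i j s) v) = act (rot i j s) (act (rot i j t) v).
Proof. by rewrite -!act_rotD addrC. Qed.

Lemma evenrot0 v : evenrot i j 0 v = v.
Proof. by rewrite evenrotE oppr0 act_rot0; module. Qed.
Lemma evenrotD t s v : evenrot i j (t + s) v = evenrot i j t (evenrot i j s v) + oddrot i j t (oddrot i j s v).
Proof. by rewrite !evenrotE !oddrotE (opprD t s) (act_rotD t s) (act_rotD (- t) (- s)) !homE; module. Qed.

Lemma oddrotD t s v : oddrot i j (t + s) v = evenrot i j t (oddrot i j s v) + oddrot i j t (evenrot i j s v).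
Proof. by rewrite !evenrotE !oddrotE (opprD t s) (act_rotD t s) (act_rotD (- t) (- s)) !homE; module. Qed.

Lemma evenrot_oddrot t s v : evenrot i j t (oddrot i j s v) = oddrot i j s (evenrot i j t v).
Proof.
rewrite !evenrotE !oddrotE !homE !(act_rot_comm s) !(act_rot_comm (- s)); module.
Qed.

Lemma oddrot_comm t s v : oddrot i j t (oddrot i j s v) = oddrot i j s (oddrot i j t v).
Proof.
rewrite !oddrotE !homE !(act_rot_comm s) !(act_rot_comm (- s)); module.
Qed.

Lemma evenrot_sqr t v : evenrot i j t (evenrot i j t v) = v + oddrot i j t (oddrot i j t v).
Proof.
have := evenrotD t (- t) v; rewrite subrr evenrot0 evenrotN oddrotN opp_lfunE homN => {2}->.
by rewrite subrK.
Qed.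

(** Twice a rotation is controlled by the odd part only. *)
Lemma evenrot_double t v : evenrot i j (2 * t) v = v + 2 *: oddrot i j t (oddrot i j t v).
Proof.
have -> : 2 * t = t + t by ring.
by rewrite evenrotD evenrot_sqr; module.
Qed.

Lemma oddrot_double t v : oddrot i j (2 * t) v = 2 *: evenrot i j t (oddrot i j t v).
Proof.
have -> : 2 * t = t + t by ring.
by rewrite oddrotD -evenrot_oddrot; module.
Qed.

End Plane.

Definition pairS i j : 'I_n -> bool := fun k => (k == i) (+) (k == j).

Definition flip S i j : 'I_n -> bool := fun k => S k (+) ((k == i) (+) (k == j)).

Lemma signr_rot (b : bool) i j t : rot i j ((-1) ^+ b * t) = if b then rot i j (- t) else rot i j t.
Proof. by case: b; rewrite ?expr0 ?expr1 ?mul1r ?mulN1r. Qed.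

(** A matrix permuting the axes up to signs permutes the coordinate rotations up to
    orientation. *)
Lemma conj_rot_sign A i j i' j' (a b : bool) t : SO A ->
  A *m unitv R i = (-1) ^+ a *: unitv R i' -> A *m unitv R j = (-1) ^+ b *: unitv R j' ->
  A *m rot i j t = rot i' j' ((-1) ^+ (a (+) b) * t) *m A.
Proof.
move=> hA Ai Aj; rewrite conj_rot // Ai Aj signr_rot.
case: a b {Ai Aj} => -[] /=; rewrite ?expr1 ?expr0 ?scale1r ?scaleN1r //.
- by rewrite plane_rotNl plane_rotNr opprK.
- by rewrite plane_rotNl.
- by rewrite plane_rotNr.
Qed.

Lemma conj_act A i j i' j' (a b : bool) t v : SO A -> i != j -> i' != j' ->
  A *m unitv R i = (-1) ^+ a *: unitv R i' -> A *m unitv R j = (-1) ^+ b *: unitv R j' ->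
  act A (act (rot i j t) v) = act (rot i' j' ((-1) ^+ (a (+) b) * t)) (act A v).
Proof.
move=> hA ij ij' Ai Aj; rewrite -!actM //; try exact: SO_rot.
by rewrite (conj_rot_sign t hA Ai Aj).
Qed.

Lemma conj_evenrot A i j i' j' (a b : bool) t v : SO A -> i != j -> i' != j' ->
  A *m unitv R i = (-1) ^+ a *: unitv R i' -> A *m unitv R j = (-1) ^+ b *: unitv R j' ->
  act A (evenrot i j t v) = evenrot i' j' t (act A v).
Proof.
move=> hA ij ij' Ai Aj; rewrite !evenrotE homZ homD !(conj_act _ _ hA ij ij' Ai Aj) !signr_rot.
by case: (a (+) b); rewrite // opprK; module.
Qed.

Lemma conj_oddrot A i j i' j' (a b : bool) t v : SO A -> i != j -> i' != j' ->
  A *m unitv R i = (-1) ^+ a *: unitv R i' -> A *m unitv R j = (-1) ^+ b *: unitv R j' ->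
  act A (oddrot i j t v) = (-1) ^+ (a (+) b) *: oddrot i' j' t (act A v).
Proof.
move=> hA ij ij' Ai Aj; rewrite !oddrotE homZ homB !(conj_act _ _ hA ij ij' Ai Aj) !signr_rot.
by case: (a (+) b); rewrite ?opprK ?expr0 ?expr1; module.
Qed.

Lemma rot_pi_unitv k l i : k != l ->
  rot k l pi *m unitv R i = (-1) ^+ ((i == k) (+) (i == l)) *: unitv R i.
Proof.
move=> kl; have [->|ik] := eqVneq i k.
  by rewrite (negbTE kl) rot_unitvl // cospi sinpi scale0r addr0.
have [->|il] := eqVneq i l; first by rewrite rot_unitvr // cospi sinpi scale0r subr0.
by rewrite rot_unitv_other // scale1r.
Qed.

Lemma rot_piN k l : rot k l (- pi) = rot k l pi :> 'M[R]_n.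
Proof. by rewrite /rot /plane_rot cosN sinN sinpi oppr0. Qed.

Lemma chi_flip S i j k l : chi (flip S i j) k l =
  chi S k l * (-1) ^+ (((i == k) (+) (i == l)) (+) ((j == k) (+) (j == l))).
Proof.
rewrite /chi /flip -signr_addb ![_ == k]eq_sym ![_ == l]eq_sym; congr (_ ^+ _).
by case: (S k); case: (S l); do 4 case: (_ == _).
Qed.

Lemma evenrot_wt S i j t v : i != j -> v \in wt S -> evenrot i j t v \in wt S.
Proof.
move=> ij /wtP vS; apply/wtP => k l kl.
rewrite (conj_evenrot _ _ (SO_rot kl _) ij ij (rot_pi_unitv _ kl) (rot_pi_unitv _ kl)).
by rewrite vS // homZ.
Qed.

(** The half turn in the plane (k, l) conjugates [rot i j t] to [rot i j (- t)]
    when exactly one of i, j is among k, l, and to itself otherwise. *)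
Lemma oddrot_wt S i j t v : i != j -> v \in wt S -> oddrot i j t v \in wt (flip S i j).
Proof.
move=> ij /wtP vS; apply/wtP => k l kl.
rewrite (conj_oddrot _ _ (SO_rot kl _) ij ij (rot_pi_unitv _ kl) (rot_pi_unitv _ kl)).
by rewrite vS // homZ chi_flip scalerA mulrC.
Qed.

Definition sgperm A (s : {perm 'I_n}) (e : 'I_n -> bool) :=
  SO A /\ forall i, A *m unitv R i = (-1) ^+ (e i) *: unitv R (s i).

(** Signs are invisible on weights since the half turns are conjugated to half turns. *)
Lemma sgperm_wt A (s : {perm 'I_n}) e S S' v : sgperm A s e -> (forall k, S' (s k) = S k) ->
  v \in wt S -> act A v \in wt S'.
Proof.
move=> [hA As] SS /wtP vS; apply/wtP => k l.
rewrite -[k](permKV s) -[l](permKV s); set k0 := (s^-1)%g k; set l0 := (s^-1)%g l => kl.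
have kl0 : k0 != l0 by apply: contraNneq kl => ->.
have := conj_act pi v hA kl0 kl (As k0) (As l0).
rewrite signr_rot rot_piN if_same => <-; rewrite vS // homZ.
by rewrite /chi !SS.
Qed.

Lemma quarter_sgperm i j : i != j -> sgperm (quarter R i j) (tperm i j) (fun k => k == j).
Proof.
move=> ij; split=> [|k]; first exact: SO_rot.
have [->|kj] := eqVneq k j; first by rewrite tpermR quarter_r // scaleN1r.
rewrite scale1r; have [->|ki] := eqVneq k i; first by rewrite tpermL quarter_l.
by rewrite tpermD 1?eq_sym // quarter_o.
Qed.

Lemma rot_pi_wt S i j v : i != j -> v \in wt S -> act (rot i j pi) v = chi S i j *: v.
Proof. by move=> ij /wtP ->. Qed.

Lemma rot_act_continuous i j (f : 'Hom(V, R^o)) v : i != j ->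
  continuous (fun t => ev f (act (rot i j t) v)).
Proof.
move=> ij t.
have /subspace_continuousP c := @rep_act_continuous _ _ V f v.
apply: (@cvg_comp _ _ _ (rot i j) (fun A => f (act A v)) _ (within (SO (R:=R) (n:=n)) (nbhs (rot i j t)))); last first.
  exact: c (SO_rot ij t).
move=> P; rewrite /within /= => PP.
have := @rot_continuous R n i j t _ PP; rewrite /= /nbhs /=.
by apply: (@filterS _ _ (nbhs_filter t)) => s; apply; exact: SO_rot.
Qed.

Lemma evenrot_continuous i j (f : 'Hom(V, R^o)) v : i != j -> continuous (fun t => ev f (evenrot i j t v)).
Proof.
move=> ij t; under eq_fun do rewrite evenrotE evZ evD.
apply: cvgM; first exact: cvg_cst.
apply: cvgD; first exact: rot_act_continuous.
apply: (@continuous_comp _ _ _ -%R (fun t => ev f (act (rot i j t) v))); first exact: opp_continuous.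
exact: rot_act_continuous.
Qed.

Lemma oddrot_continuous i j (f : 'Hom(V, R^o)) v : i != j -> continuous (fun t => ev f (oddrot i j t v)).
Proof.
move=> ij t; under eq_fun do rewrite oddrotE evZ evB.
apply: cvgM; first exact: cvg_cst.
apply: cvgB; first exact: rot_act_continuous.
apply: (@continuous_comp _ _ _ -%R (fun t => ev f (act (rot i j t) v))); first exact: opp_continuous.
exact: rot_act_continuous.
Qed.

End Weights.

(** * Vectors of weight zero and of weight two *)

Section PairWeights.
Variables (R : realType) (n : nat) (V : SOrep R n).
Implicit Types (i j k l a b : 'I_n) (u v w : V) (A B : 'M[R]_n) (t s : R) (S : 'I_n -> bool).
Local Notation act := (rep_act V).

Definition wt0 : {vspace V} := wt V (fun _ => false).
Definition wt2 i j : {vspace V} := wt V (pairS i j).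

Lemma wt2C i j : wt2 i j = wt2 j i.
Proof. by apply: eq_wt => k; rewrite /pairS addbC. Qed.

Lemma evenrot_wt0 i j t u : i != j -> u \in wt0 -> evenrot V i j t u \in wt0.
Proof. exact: evenrot_wt. Qed.

Lemma evenrot_wt2 a b i j t w : i != j -> w \in wt2 a b -> evenrot V i j t w \in wt2 a b.
Proof. exact: evenrot_wt. Qed.

Lemma oddrot_wt0 i j t u : i != j -> u \in wt0 -> oddrot V i j t u \in wt2 i j.
Proof. by move=> ij /(oddrot_wt t ij); rewrite /wt2 (@eq_wt _ _ _ _ (pairS i j)). Qed.

Lemma oddrot_wt2ij i j t w : i != j -> w \in wt2 i j -> oddrot V i j t w \in wt0.
Proof.
move=> ij /(oddrot_wt t ij); rewrite (@eq_wt _ _ _ _ (fun _ => false)) // => k.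
by rewrite /flip /pairS addbb.
Qed.

Lemma oddrot_wt2ik i j k t w : i != j -> w \in wt2 i k -> oddrot V i j t w \in wt2 j k.
Proof.
move=> ij /(oddrot_wt t ij); rewrite (@eq_wt _ _ _ _ (pairS j k)) // => x.
by rewrite /flip /pairS; do 3 case: (_ == _).
Qed.

Lemma pi_wt0 i j u : i != j -> u \in wt0 -> act (rot i j pi) u = u.
Proof. by move=> ij /rot_pi_wt ->; rewrite // scale1r. Qed.

Lemma pi_wt2ij i j w : i != j -> w \in wt2 i j -> act (rot i j pi) w = w.
Proof.
move=> ij /rot_pi_wt ->; rewrite // /chi /pairS !eqxx (eq_sym j) (negbTE ij).
by rewrite scale1r.
Qed.

Lemma pi_wt2ik i j k w : i != j -> k != i -> k != j -> w \in wt2 i k -> act (rot i j pi) w = - w.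
Proof.
move=> ij ki kj /rot_pi_wt ->; rewrite // /chi /pairS eqxx ![_ == k]eq_sym (eq_sym j).
by rewrite (negbTE ij) (negbTE ki) (negbTE kj) scaleN1r.
Qed.

Lemma pairS_tperm i j k x : i != j -> i != k -> pairS i k (tperm j k x) = pairS i j x.
Proof.
move=> ij ik; have ji : (j == i) = false by rewrite eq_sym (negbTE ij).
have ki : (k == i) = false by rewrite eq_sym (negbTE ik).
rewrite /pairS; case: tpermP => [->|->|/eqP xj /eqP xk].
- by rewrite ji ki !eqxx.
- by rewrite ji ki eq_sym.
- by rewrite (negbTE xj) (negbTE xk).
Qed.

Lemma quarter_wt0 a b u : a != b -> u \in wt0 -> act (quarter R a b) u \in wt0.
Proof. by move=> ab; apply: (sgperm_wt (quarter_sgperm R ab)). Qed.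

Lemma quarter_wt2 i j k w : i != j -> i != k -> j != k -> w \in wt2 i j ->
  act (quarter R j k) w \in wt2 i k.
Proof.
move=> ij ik jk; apply: (sgperm_wt (quarter_sgperm R jk)) => x.
exact: pairS_tperm.
Qed.

Lemma quarter_oddrot i j k t v : i != j -> i != k -> j != k ->
  act (quarter R j k) (oddrot V i j t v) = oddrot V i k t (act (quarter R j k) v).
Proof.
move=> ij ik jk; have [hA As] := quarter_sgperm R jk.
rewrite (@conj_oddrot _ _ _ _ i j i k false false t v hA ij ik) ?scale1r ?expr0 //.
  by rewrite quarter_o // scale1r.
by rewrite quarter_l ?scale1r.
Qed.

Lemma quarter_comm a b t v : a != b ->
  act (quarter R a b) (oddrot V a b t v) = oddrot V a b t (act (quarter R a b) v).
Proof.
by move=> ab; rewrite !oddrotE homZ homB /quarter -!(act_rot_comm ab (pi / 2)).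
Qed.

Lemma SO_stable (P : V -> Prop) :
  (forall i j t v, i != j -> P v -> P (act (rot i j t) v)) ->
  forall A v, SO A -> P v -> P (act A v).
Proof.
move=> H A v hA Pv; have : rot_gen 0 A by apply: SO_rot_gen.
elim=> [|i j t B ij _ _ gB IH]; first by rewrite act1.
by rewrite actM; [apply: H|exact: SO_rot|exact: rot_gen_SO gB].
Qed.

(** If the odd parts vanish on V_0 then V_0 is stable, hence everything, and
    [evenrot_double] shows that all rotations act trivially. *)
Lemma trivial_case : rep_irreducible V -> wt0 != 0%VS ->
  (forall i j t u, i != j -> u \in wt0 -> oddrot V i j t u = 0) ->
  rep_iso V (trivial_rep R n).
Proof.
move=> [V_gt0 irr] V0_neq0 D0.
have V0full : wt0 = fullv.
  case: (irr wt0) => [A hA|V00|//]; last by rewrite V00 eqxx in V0_neq0.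
  apply/subvP => _ /memv_imgP[v vV ->].
  apply: (@SO_stable (fun v => v \in wt0)) => // i j t u ij uV.
  by rewrite act_rotE D0 // addr0 evenrot_wt0.
have fixr i j t v : i != j -> act (rot i j t) v = v.
  move=> ij; have vV : v \in wt0 by rewrite V0full memvf.
  have -> : t = 2 * (t / 2) by field.
  have Dz s w : oddrot V i j s w = 0 by rewrite D0 // V0full memvf.
  by rewrite act_rotE evenrot_double // !Dz scaler0 !addr0.
have fix1 A v : SO A -> act A v = v.
  move=> hA; apply: (@SO_stable (fun w => w = v) _ _ _ hA) => // i j t w ij ->.
  exact: fixr.
have [v0 v0_neq0] : exists v0 : V, v0 != 0.
  exists (vpick fullv); rewrite vpick0; apply: contraTneq V_gt0 => ->.
  by rewrite dimv0.
have vfull v : v \in <[v0]>%VS.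
  case: (irr <[v0]>%VS) => [A hA| /eqP|->]; last exact: memvf.
    by apply/subvP => _ /memv_imgP[w wv ->]; rewrite fix1.
  by rewrite -dimv_eq0 dim_vline v0_neq0.
have [f fv0] := ev_neq0 v0_neq0.
exists f => [|A v hA]; last by rewrite fix1 // id_lfunE.
exists (fun c : R^o => c *: v0) => [v|c].
  by have /vlineP[c ->] := vfull v; rewrite [f _](_ : _ = ev f (c *: v0)) // evZ fv0 mulr1.
by rewrite [f _](_ : _ = ev f (c *: v0)) // evZ fv0 mulr1.
Qed.

(** By [oddrot_wt0] this makes every V_ab non-zero. *)
Definition moving := forall a b, a != b -> exists t u, u \in wt0 /\ oddrot V a b t u != 0.

(** Quarter turns permute the pairs transitively. *)
Lemma moving_all i j t u : i != j -> u \in wt0 -> oddrot V i j t u != 0 -> moving.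
Proof.
pose M a b := exists t u, u \in wt0 /\ oddrot V a b t u != 0.
move=> ij uV Du; have Mij : M i j by exists t, u.
have sym a b : M a b -> M b a.
  by move=> [s [w [wV Dw]]]; exists s, w; rewrite oddrotC opp_lfunE oppr_eq0.
have mv a b c : a != b -> a != c -> M a b -> M a c.
  move=> ab ac [s [w [wV Dw]]]; have [<-|bc] := eqVneq b c; first by exists s, w.
  exists s, (act (quarter R b c) w); split; first exact: quarter_wt0.
  rewrite -quarter_oddrot //; apply: contraNneq Dw => D0.
  apply/eqP/(@act_inj _ _ V (quarter R b c)); first exact: SO_rot.
  by rewrite D0 hom0.
move=> a b ab.
have [ai|ai] := eqVneq a i; first by rewrite ai in ab *; exact: mv Mij.
have Mia : M i a by apply: mv Mij; rewrite // eq_sym.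
exact: mv ai ab (sym _ _ Mia).
Qed.

End PairWeights.

(** * Independence of the weight spaces and the dimension count *)

Section Independence.
Variables (R : realType) (n : nat) (V : SOrep R n).
Implicit Types (i j k l a b : 'I_n) (u v w : V) (S : 'I_n -> bool).
Local Notation act := (rep_act V).

(** The characters attached to two subsets differ. *)
Definition separated S S' := exists k l, k != l /\ S k (+) S l != S' k (+) S' l.

(** The classical independence of eigenspaces: project on the eigenspace of one half
    turn that separates the first term of the sum. *)
Lemma wt_independent (I : Type) (s : seq I) (F : I -> 'I_n -> bool) S v :
  (forall x, List.In x s -> separated S (F x)) -> v \in wt V S ->
  v \in (\sum_(x <- s) wt V (F x))%VS -> v = 0.
Proof.
elim: s v => [|x s IH] v sepF vS; first by rewrite big_nil memv0 => /eqP.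
rewrite big_cons => /memv_addP[a ax [b bs vab]].
have [k [l [kl skl]]] := sepF x (or_introl erefl).
pose E w := 2^-1 *: (w + chi R S k l *: act (rot k l pi) w).
have chi2 S' : chi R S' k l * chi R S' k l = 1 by rewrite /chi -expr2 sqrr_sign.
have Ev : E v = v.
  by rewrite /E (rot_pi_wt kl vS) scalerA chi2 scale1r; module.
have Ea : E a = 0.
  rewrite /E (rot_pi_wt kl ax) scalerA.
  have -> : chi R S k l * chi R (F x) k l = -1.
    by rewrite /chi -signr_addb; move: skl; case: (_ (+) _); case: (F x k (+) F x l).
  by rewrite scaleN1r subrr scaler0.
have Eb : E b \in (\sum_(x <- s) wt V (F x))%VS.
  apply: memvZ; apply: memvD => //; apply: memvZ.
  elim: s b bs {IH sepF vab} => [|y s IH] b; first by rewrite !big_nil !memv0 => /eqP ->; rewrite hom0.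
  rewrite !big_cons => /memv_addP[c cy [d ds ->]]; rewrite homD.
  by apply: memv_add; [rewrite (rot_pi_wt kl cy) memvZ|exact: IH].
apply: (IH v) => //; first by move=> y ys; apply: sepF; right.
have EabE : E (a + b) = E a + E b by rewrite /E homD; module.
by rewrite -Ev vab EabE Ea add0r.
Qed.

Hypotheses (n3 : (3 <= n)%N) (n4 : n <> 4%N).

Lemma separated_nonconst S S' k l : S k (+) S' k != S l (+) S' l -> separated S S'.
Proof.
move=> kl; exists k, l; split; first by apply: contraNneq kl => ->.
by move: kl; case: (S k); case: (S l); case: (S' k); case: (S' l).
Qed.

Lemma card_pairS i j : i != j -> #|[pred x | pairS i j x]| = 2.
Proof.
move=> ij; rewrite (@eq_card _ _ (pred2 i j)) ?card2 ?ij // => x.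
rewrite !inE /pairS; have [->|] := eqVneq x i; last by case: (_ == _).
by rewrite (negbTE ij).
Qed.

Lemma third_index i j : i != j -> exists k, k != i /\ k != j.
Proof.
move=> ij; have : (0 < #|[predC (pred2 i j)]|)%N.
  have := cardC (pred2 i j); rewrite card2 ij card_ord => e.
  by rewrite -(ltn_add2l 2) e addn0.
by case/card_gt0P => k; rewrite !inE negb_or => /andP[]; exists k.
Qed.

Lemma separated_pair i j : i != j -> separated (fun _ => false) (pairS i j).
Proof.
move=> ij; have [k [ki kj]] := third_index ij; apply: (@separated_nonconst _ _ i k).
by rewrite /pairS !eqxx (negbTE ij) (negbTE ki) (negbTE kj).
Qed.

(** The characters of two pairs coincide when the pairs are equal or complementary;
    the latter happens only for n = 4. *)
Lemma separated_pairs i j k l x : i != j -> k != l -> pairS i j x != pairS k l x ->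
  separated (pairS i j) (pairS k l).
Proof.
move=> ij kl xAB.
have [y /eqP yAB] : exists y, pairS i j y = pairS k l y.
  apply: contrapT => /forallNP H.
  have := cardC [pred x | pairS i j x]; rewrite card_pairS // card_ord.
  rewrite (@eq_card _ _ [pred x | pairS k l x]) ?card_pairS // => [e|y].
    by apply: n4; rewrite -e.
  by rewrite !inE; have := H y; case: (pairS i j y); case: (pairS k l y).
apply: (@separated_nonconst _ _ x y).
by move: xAB yAB; do 4 case: (pairS _ _ _).
Qed.

Definition ordpair (p : 'I_n * 'I_n) := (p.1 < p.2)%N.

Lemma ordpair_neq p : ordpair p -> p.1 != p.2.
Proof. by rewrite /ordpair ltn_neqAle -val_eqE => /andP[]. Qed.

Lemma separated_ordpair p q : ordpair p -> ordpair q -> q != p ->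
  separated (pairS p.1 p.2) (pairS q.1 q.2).
Proof.
move=> pP qP qp; have pn := ordpair_neq pP; have qn := ordpair_neq qP.
suff [x] : exists x, pairS p.1 p.2 x != pairS q.1 q.2 x by exact: separated_pairs.
apply: contrapT => /forallNP H; have {}H x : pairS p.1 p.2 x = pairS q.1 q.2 x.
  by have := H x; case: eqP.
move/negP: qp; apply; move: H pP qP pn qn; case: p => a b; case: q => c d.
rewrite /pairS /ordpair /= => H ab cd abn cdn; rewrite xpair_eqE.
have := H a; have := H b; rewrite !eqxx (eq_sym b a) (negbTE abn) /=.
have [<-|ac] := eqVneq a c.
  by rewrite (eq_sym b a) (negbTE abn) (eq_sym b d) => /= <-.
move: cd; have [<-|ad] := eqVneq a d; last by [].
rewrite (eq_sym b a) (negbTE abn) addbF => cd /esym/eqP bc _.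
by move: cd; rewrite -bc => ba; have := ltn_trans ab ba; rewrite ltnn.
Qed.

Lemma In_filter_index (P : pred ('I_n * 'I_n)) q s :
  List.In q [seq x <- s | P x] -> P q.
Proof.
elim: s => //= x s IH; case: ifP => // Px [<- //|]; exact: IH.
Qed.

Lemma sum_lines_independent S (P : pred ('I_n * 'I_n)) v :
  (forall q, P q -> separated S (pairS q.1 q.2)) -> v \in wt V S ->
  v \in (\sum_(p | P p) wt2 V p.1 p.2)%VS -> v = 0.
Proof.
move=> sep vS; rewrite -big_filter => vs.
apply: (@wt_independent _ _ (fun p : 'I_n * 'I_n => pairS p.1 p.2) S) vs => // q.
by move/In_filter_index/sep.
Qed.

Lemma dim_sum_lines : (\dim (wt0 V) + \sum_(p | ordpair p) \dim (wt2 V p.1 p.2) <= \dim {:V})%N.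
Proof.
have dL : directv (\sum_(p | ordpair p) wt2 V p.1 p.2).
  apply/directv_sumP => p pP; apply/eqP; rewrite -subv0; apply/subvP => v.
  rewrite memv_cap => /andP[vp vs]; rewrite memv0; apply/eqP.
  apply: sum_lines_independent vp vs => q /andP[qP qp].
  exact: separated_ordpair.
rewrite -(directvP dL) /= -dimv_disjoint_sum ?dimvS ?subvf //.
apply/eqP; rewrite -subv0; apply/subvP => v; rewrite memv_cap => /andP[v0 vs].
rewrite memv0; apply/eqP; apply: sum_lines_independent v0 vs => q /ordpair_neq.
exact: separated_pair.
Qed.

Lemma dim_wt2_le i j k : i != j -> i != k -> (\dim (wt2 V i j) <= \dim (wt2 V i k))%N.
Proof.
move=> ij ik; have [->//|jk] := eqVneq j k.
have <- : \dim (act (quarter R j k) @: wt2 V i j) = \dim (wt2 V i j).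
  apply: limg_dim_eq; apply/eqP; rewrite -subv0; apply/subvP => v.
  rewrite memv_cap memv_ker => /andP[_ /eqP q0]; rewrite memv0; apply/eqP.
  by apply: (@act_inj _ _ V (quarter R j k)); [exact: SO_rot|rewrite q0 hom0].
apply: dimvS; apply/subvP => _ /memv_imgP[v vV ->].
exact: quarter_wt2.
Qed.

Lemma dim_wt2_const i j k l : i != j -> k != l -> (\dim (wt2 V i j) <= \dim (wt2 V k l))%N.
Proof.
move=> ij kl; have [ki|ki] := eqVneq k i.
  by rewrite ki in kl *; exact: dim_wt2_le.
apply: (@leq_trans (\dim (wt2 V i k))); first by apply: dim_wt2_le; rewrite // eq_sym.
by rewrite wt2C; apply: dim_wt2_le.
Qed.

(** The entries above the diagonal and all diagonal entries but one determine a
    traceless symmetric matrix. *)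
Lemma dim_Sym0_le : (\dim (Sym0 R n) <= #|[pred p : 'I_n * 'I_n | ordpair p]| + n.-1)%N.
Proof.
have n0 : (0 < n)%N by apply: leq_trans n3.
pose o := Ordinal n0.
pose U1 := (\sum_(p | ordpair p) <[delta_mx p.1 p.2 + delta_mx p.2 p.1 : 'M[R]_n]>)%VS.
pose U2 := (\sum_(i | i != o) <[delta_mx i i - delta_mx o o : 'M[R]_n]>)%VS.
apply: (@leq_trans (\dim (U1 + U2))).
  apply: dimvS; apply/subvP => T /Sym0P[Ts Tt].
  have TE : T = \sum_(p | ordpair p) T p.1 p.2 *: (delta_mx p.1 p.2 + delta_mx p.2 p.1)
      + \sum_(i | i != o) T i i *: (delta_mx i i - delta_mx o o).
    pose E (p : 'I_n * 'I_n) := T p.1 p.2 *: delta_mx p.1 p.2.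
    have -> : \sum_(p | ordpair p) T p.1 p.2 *: (delta_mx p.1 p.2 + delta_mx p.2 p.1) =
        \sum_(p | ordpair p) E p + \sum_(p | ~~ ordpair p && ordpair (p.2, p.1)) E p.
      rewrite [X in _ + X](reindex_onto (fun p => (p.2, p.1)) (fun p => (p.2, p.1))); last by case.
      rewrite [X in _ + X](@eq_bigl _ _ _ _ _ _ ordpair); last first.
        by case=> a b; rewrite /ordpair /= eqxx andbT; case: ltngtP.
      rewrite -big_split; apply: eq_bigr => p _ /=.
      by rewrite scalerDr /E /= -[in T p.2 p.1]Ts mxE.
    have -> : \sum_(i | i != o) T i i *: (delta_mx i i - delta_mx o o) =
        \sum_(p | ~~ ordpair p && ~~ ordpair (p.2, p.1)) E p.
      rewrite (reindex_onto (fun i => (i, i)) (fun p => p.1)); last first.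
        by case=> a b; rewrite /ordpair /=; case: ltngtP => // /val_inj ->.
      rewrite [RHS](@eq_bigl _ _ _ _ _ _ predT); last first.
        by move=> i; rewrite /ordpair /= ltnn eqxx.
      rewrite [RHS](bigD1 o) //= /E /=.
      have -> : T o o = - \sum_(i | i != o) T i i.
        by apply/eqP; rewrite -addr_eq0; apply/eqP; move: Tt; rewrite /mxtrace (bigD1 o).
      rewrite scaleNr scaler_suml addrC -sumrB; apply: eq_bigr => i _.
      by rewrite scalerBr.
    rewrite [LHS]matrix_sum_delta pair_bigA (bigID ordpair) /= -addrA; congr (_ + _).
    by rewrite (bigID (fun p => ordpair (p.2, p.1))).
  rewrite TE; apply: memv_add; apply: memv_suml => p pP.
    by apply/memvZ/(subvP (sumv_sup p pP (subvv _)))/memv_line.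
  by apply/memvZ/(subvP (sumv_sup p pP (subvv _)))/memv_line.
apply: (leq_trans (leq_of_leqif (dimv_add_leqif _ _))); apply: leq_add.
  apply: (leq_trans (dimv_leq_sum _ _ _)); rewrite -sum1_card.
  by apply: leq_sum => p _; rewrite dim_vline; case: (_ != 0).
apply: (leq_trans (dimv_leq_sum _ _ _)).
apply: (@leq_trans (\sum_(i < n | i != o) 1)).
  by apply: leq_sum => p _; rewrite dim_vline; case: (_ != 0).
by rewrite sum1_card cardC1 card_ord.
Qed.

(** All V_ij have the same dimension.  If it were at least 2, then V would have
    dimension at least 1 + 2 n(n-1)/2, more than n(n-1)/2 + n - 1. *)
Lemma lines_dim1 : wt0 V != 0%VS -> moving V -> (\dim {:V} <= \dim (Sym0 R n))%N ->
  forall i j, i != j -> \dim (wt2 V i j) = 1%N.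
Proof.
move=> V0n mv dimV i j ij.
have d1 : (0 < \dim (wt2 V i j))%N.
  have [t [u [uV Du]]] := mv i j ij.
  rewrite lt0n dimv_eq0; apply: contraNneq Du => L0.
  by have := oddrot_wt0 t ij uV; rewrite L0 memv0.
apply/eqP; rewrite eqn_leq d1 andbT leqNgt; apply/negP => d2.
set d := \dim (wt2 V i j) in d1 d2.
have s2 : (2 * #|[pred p : 'I_n * 'I_n | ordpair p]| <= \sum_(p | ordpair p) \dim (wt2 V p.1 p.2))%N.
  rewrite -sum1_card big_distrr /=; apply: leq_sum => p pP; rewrite muln1.
  by apply: (leq_trans d2); apply: dim_wt2_const => //; exact: ordpair_neq.
have c1 : (n.-1 <= #|[pred p : 'I_n * 'I_n | ordpair p]|)%N.
  have n0 : (0 < n)%N by apply: leq_trans n3.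
  pose o := Ordinal n0.
  rewrite -[n in n.-1]card_ord -(cardC1 o).
  rewrite -(@card_in_imset _ _ (fun i => (o, i)) [pred i | i != o]); last by move=> a b _ _ [].
  apply: subset_leq_card; apply/fintype.subsetP => p /imsetP[a]; rewrite inE => ao ->.
  by rewrite inE /ordpair /= lt0n -(inj_eq val_inj) in ao *.
have d0 : (0 < \dim (wt0 V))%N by rewrite lt0n dimv_eq0.
have := leq_trans dim_sum_lines (leq_trans dimV dim_Sym0_le).
move: d0 c1 s2; set m := \dim (wt0 V); set P := #|_|; set T := \sum_(_ | _) _.
move: (n.-1) => N; lia.
Qed.

End Independence.

(** * The action of three coordinate rotations *)

(** Comparison of the matrix coefficients of both sides of A3 A1 = B1 B2 B3 on the
    vectors w1 and w2.  The functionals f1 and f2 pick the coordinates on w1 and w2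
    and vanish on every other vector that occurs, except for B1 x2, whose coordinate
    nu is the unknown of the problem. *)
Lemma rotation_coefs (R : realType) (V : vectType R) (A3 A1 B1 B2 B3 : 'End(V))
    (w1 w2 w3 x1 x2 : V) (f1 f2 : 'Hom(V, R^o))
    (ct st cx sx qx kx cb sb qb kb cg sg qg kg ca sa nu : R) :
  (forall v, A3 (A1 v) = B1 (B2 (B3 v))) ->
  A3 w1 = ct *: w1 - st *: w2 -> A3 w2 = ct *: w2 + st *: w1 ->
  A1 w1 = qx *: w1 + kx *: x1 -> A1 w2 = cx *: w2 - sx *: w3 ->
  B1 w1 = qb *: w1 + kb *: x1 -> B1 w2 = cb *: w2 - sb *: w3 ->
  B1 w3 = cb *: w3 + sb *: w2 ->
  B2 w1 = cg *: w1 + sg *: w3 -> B2 w2 = qg *: w2 + kg *: x2 ->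
  B3 w1 = ca *: w1 - sa *: w2 -> B3 w2 = ca *: w2 + sa *: w1 ->
  ev f1 w1 = 1 /\ ev f2 w1 = 0 -> ev f1 w2 = 0 /\ ev f2 w2 = 1 ->
  ev f1 w3 = 0 /\ ev f2 w3 = 0 -> ev f1 x1 = 0 /\ ev f2 x1 = 0 ->
  ev f1 (A3 x1) = 0 /\ ev f2 (A3 x1) = 0 -> ev f1 (A3 w3) = 0 /\ ev f2 (A3 w3) = 0 ->
  ev f1 (B1 x2) = kb * nu /\ ev f2 (B1 x2) = 0 ->
  [/\ qx * ct = ca * (cg * qb) - sa * (nu * (kb * kg)),
    - (qx * st) = ca * (sg * sb) - sa * (qg * cb),
    cx * st = ca * (nu * (kb * kg)) + sa * (cg * qb) &
    cx * ct = ca * (qg * cb) + sa * (sg * sb)].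
Proof.
move=> E A31 A32 A11 A12 B11 B12 B13 B21 B22 B31 B32 [a1 a2] [a3 a4] [a5 a6] [a7 a8] [a9 b1] [b2 b3] [b4 b5].
have E1 := E w1; have E2 := E w2.
rewrite A11 B31 !homE B21 B22 !homE A31 B11 B12 B13 in E1.
rewrite A12 B32 !homE B21 B22 !homE A32 B11 B12 B13 in E2.
have := congr1 (ev f1) E1; have := congr1 (ev f2) E1.
have := congr1 (ev f1) E2; have := congr1 (ev f2) E2.
rewrite !(evE, a1, a2, a3, a4, a5, a6, a7, a8, a9, b1, b2, b3, b4, b5) => e1 e2 e3 e4; split; lra.
Qed.

Section CircleActions.
Variables (R : realType) (n : nat) (V : SOrep R n).
Implicit Types (i j k : 'I_n) (u v w x : V) (t s : R).
Local Notation act := (rep_act V).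

Hypothesis lines : forall i j, i != j -> \dim (wt2 V i j) = 1%N.

Lemma line_gen i j w : i != j -> w \in wt2 V i j -> w != 0 ->
  forall v, v \in wt2 V i j -> exists c, v = c *: w.
Proof.
move=> ij wL w0 v vL; apply/vlineP.
have /eqP -> // : <[w]>%VS == wt2 V i j.
by rewrite eqEdim -memvE wL dim_vline w0 lines.
Qed.

Lemma line_nonzero i j : i != j -> exists2 w, w \in wt2 V i j & w != 0.
Proof.
move=> ij; exists (vpick (wt2 V i j)); first exact: memv_pick.
by rewrite vpick0 -dimv_eq0 lines.
Qed.

Lemma rot_pi_iter i j v (m : nat) : i != j -> act (rot i j pi) v = v ->
  act (rot i j (pi * m%:R)) v = v.
Proof.
move=> ij fv; elim: m => [|m IH]; first by rewrite mulr0 act_rot0.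
by rewrite -natr1 mulrDr mulr1 act_rotD // fv.
Qed.

Lemma oddrot_pi_iter i j v (m : nat) : i != j -> act (rot i j pi) v = v ->
  evenrot V i j (pi * m%:R) v = v /\ oddrot V i j (pi * m%:R) v = 0.
Proof.
move=> ij fv; have f1 := rot_pi_iter m ij fv.
have f2 : act (rot i j (- (pi * m%:R))) v = v.
  by rewrite -{1}f1 -act_rotD // addNr act_rot0.
by rewrite evenrotE oddrotE f1 f2 subrr scaler0; split=> //; module.
Qed.

(** The rotations in the plane (i, j) preserve the span of [w] and [x] and act there
    through the homomorphism (q, k), up to a sign convention; the other vectors of
    V_0 are moved along [w] by the same function k, in proportion to [phi]. *)
Record circle_action i j w (q k : R -> R) x (phi : V -> R) : Prop := CircleAction {
  ca_hom : circle_hom q k;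
  ca_pi : q pi = 1;
  ca_neq0 : exists t, k t != 0;
  ca_wt0 : x \in wt0 V;
  ca_Cw : forall t, evenrot V i j t w = q t *: w;
  ca_Dw : forall t, oddrot V i j t w = k t *: x;
  ca_Du : forall t u, u \in wt0 V -> oddrot V i j t u = (k t * phi u) *: w;
  ca_phi : phi x = -1 }.

(** The odd parts commute, so that D(t) w is proportional to D(t0) w as soon as
    D(t0)^2 w is not 0, that is as soon as q(t0)^2 <> 1.  Such a t0 is found among
    the dyadic multiples of pi that move u: if q(t0)^2 >= 1, then doubling preserves
    both this and D(t0) u <> 0, until a multiple of pi is reached, which fixes u. *)
Lemma circle_actionP i j w : i != j -> w \in wt2 V i j -> w != 0 ->
  (exists t u, u \in wt0 V /\ oddrot V i j t u != 0) ->
  exists (q k : R -> R) x phi, circle_action i j w q k x phi.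
Proof.
move=> ij wL w0 [t1 [u [uV Du1]]].
have [f fw] := ev_neq0 w0.
have line v : v \in wt2 V i j -> v = ev f v *: w.
  by move=> /(line_gen ij wL w0)[c ->]; rewrite evZ fw mulr1.
pose q t := ev f (evenrot V i j t w).
have Cw t : evenrot V i j t w = q t *: w by apply: line; exact: evenrot_wt2.
have DDw t : oddrot V i j t (oddrot V i j t w) = (q t ^+ 2 - 1) *: w.
  have := evenrot_sqr ij t w; rewrite !Cw homZ Cw scalerA -expr2 => e.
  by rewrite scalerBl e scale1r addrC addKr.
have CL t v : v \in wt2 V i j -> evenrot V i j t v = q t *: v.
  by move=> /line ->; rewrite homZ Cw !scalerA mulrC.
have q2 t : q (2 * t) = 2 * q t ^+ 2 - 1.
  by rewrite {1}/q evenrot_double // DDw scalerA evD evZ fw mulr1; ring.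
(* the dyadic multiples of pi are dense, so one of them moves u *)
have [m [e Du]] : exists m e : nat, oddrot V i j (pi * m%:R / 2 ^+ e) u != 0.
  apply: contrapT => H.
  have z (m e : nat) : oddrot V i j (pi * m%:R / 2 ^+ e) u = 0.
    by apply/eqP/negPn/negP => D; apply: H; exists m, e.
  have [g g1] := ev_neq0 Du1.
  have g0 t : 0 <= t -> ev g (oddrot V i j t u) = 0.
    apply: (@eq0_dyadic _ (fun t => ev g (oddrot V i j t u)) pi).
    - exact: oddrot_continuous.
    - exact: pi_gt0.
    - by move=> m e; rewrite z ev0.
  have [/g0|t1n] := leP 0 t1; first by rewrite g1 => /eqP; rewrite oner_eq0.
  have := g0 (- t1); rewrite oppr_ge0 oddrotN opp_lfunE evN g1 => /(_ (ltW t1n)) /eqP.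
  by rewrite oppr_eq0 oner_eq0.
set t0 := pi * m%:R / 2 ^+ e in Du.
have q0 : q t0 ^+ 2 < 1.
  rewrite ltNge; apply/negP => q1.
  have H d : oddrot V i j (t0 * 2 ^+ d) u != 0 /\ 1 <= q (t0 * 2 ^+ d) ^+ 2.
    elim: d => [|d [IH1 IH2]]; first by rewrite expr0 mulr1.
    rewrite exprS mulrCA; set s := t0 * _ in IH1 IH2 *; split.
      rewrite oddrot_double // CL; last exact: oddrot_wt0.
      rewrite scalerA scaler_eq0 negb_or IH1 andbT mulf_neq0 //.
      by apply: contraTneq IH2 => ->; rewrite expr0n /= -ltNge ltr01.
    rewrite q2; have : 1 <= 2 * q s ^+ 2 - 1 by lra.
    by move=> h; rewrite expr_ge1 // (le_trans _ h).
  have [+ _] := H e; rewrite divfK ?expf_neq0 //.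
  by rewrite (oddrot_pi_iter _ ij (pi_wt0 ij uV)).2 eqxx.
(* the factor sqrt (1 - q(t0)^2) normalises k so that q^2 + k^2 = 1 *)
pose M := 1 - q t0 ^+ 2; have M0 : 0 < M by rewrite subr_gt0.
pose r := Num.sqrt M; have r0 : 0 < r by rewrite sqrtr_gt0.
have rN : r != 0 by rewrite gt_eqF.
have rr : r * r = M by rewrite -expr2 sqr_sqrtr // ltW.
pose x0 := oddrot V i j t0 w.
have x0V : x0 \in wt0 V by exact: oddrot_wt2ij.
have Dx0 : oddrot V i j t0 x0 = (- M) *: w by rewrite /x0 DDw /M opprB.
have x0N : x0 != 0.
  apply: contraTneq isT => x00; move: Dx0; rewrite x00 hom0 => /esym/eqP.
  by rewrite scaler_eq0 (negbTE w0) oppr_eq0 gt_eqF.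
pose xi t := - ev f (oddrot V i j t x0) / M.
have Dw t : oddrot V i j t w = xi t *: x0.
  have Dtx : oddrot V i j t x0 = ev f (oddrot V i j t x0) *: w by apply: line; exact: oddrot_wt0.
  have e1 : oddrot V i j t0 (oddrot V i j t x0) = (- M) *: oddrot V i j t w.
    by rewrite oddrot_comm // Dx0 homZ.
  rewrite Dtx homZ -/x0 in e1.
  rewrite /xi mulrC -scalerA scaleNr e1 scaleNr opprK scalerA mulVf ?scale1r //.
  by rewrite gt_eqF.
have Du' t v : v \in wt0 V -> oddrot V i j t v = (xi t * ev f (oddrot V i j t0 v)) *: w.
  move=> vV; have e1 : oddrot V i j t v = ev f (oddrot V i j t v) *: w by apply: line; exact: oddrot_wt0.
  have e2 : oddrot V i j t0 v = ev f (oddrot V i j t0 v) *: w by apply: line; exact: oddrot_wt0.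
  have : oddrot V i j t0 (oddrot V i j t v) = oddrot V i j t (oddrot V i j t0 v) by exact: oddrot_comm.
  rewrite {1}e1 {1}e2 !homZ -/x0 Dw scalerA => /eqP.
  rewrite -subr_eq0 -scalerBl scaler_eq0 (negbTE x0N) orbF subr_eq0 => /eqP e3.
  by rewrite e1 e3 mulrC.
pose k t := r * xi t; pose x := r^-1 *: x0; pose phi v := ev f (oddrot V i j t0 v) / r.
have Dwk t : oddrot V i j t w = k t *: x.
  by rewrite Dw /k /x scalerA mulrAC mulfV ?mul1r.
have Duk t v : v \in wt0 V -> oddrot V i j t v = (k t * phi v) *: w.
  by move=> vV; rewrite Du' // /k /phi; congr (_ *: _); field.
have phix : phi x = -1.
  rewrite /phi /x homZ evZ Dx0 evZ fw mulr1 -rr; field.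
  by rewrite rN.
have xV : x \in wt0 V by rewrite memvZ.
have Cx t : evenrot V i j t x = q t *: x.
  by rewrite /x homZ evenrot_oddrot // Cw homZ !scalerA mulrC.
have inj (a b : R) : a *: w = b *: w -> a = b.
  by move=> /(congr1 (ev f)); rewrite !evZ fw !mulr1.
have xN : x != 0 by rewrite scaler_eq0 negb_or invr_eq0 rN.
have injx (a b : R) : a *: x = b *: x -> a = b.
  by have [g gx] := ev_neq0 xN => /(congr1 (ev g)); rewrite ![ev g (_ *: x)]evZ gx !mulr1.
exists q, k, x, phi; split=> //.
- split.
  + exact: evenrot_continuous.
  + rewrite /k /xi => t; apply: cvgM; first exact: cvg_cst.
    apply: cvgM; last exact: cvg_cst.
    by apply: cvgN; exact: oddrot_continuous.
  + move=> a b; apply: inj; rewrite -Cw evenrotD // Cw homZ Cw Dwk homZ Duk // phix.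
    by rewrite !scalerA -scalerDl; congr (_ *: _); ring.
  + move=> a b; apply: injx; rewrite -Dwk oddrotD // Cw homZ !Dwk homZ Cx.
    by rewrite !scalerA -scalerDl; congr (_ *: _); ring.
  + move=> a; apply: inj; have := evenrot_sqr ij a w.
    rewrite Cw homZ Cw Dwk homZ Duk // phix !scalerA => e1.
    have -> : q a ^+ 2 + k a ^+ 2 = q a * q a - k a * (k a * -1) by ring.
    by rewrite scalerBl e1 addrK scale1r.
- by rewrite /q -[pi]mulr1 (oddrot_pi_iter 1 ij (pi_wt2ij ij wL)).1.
- exists t0; apply: contraNneq x0N => k0.
  by rewrite /x0 Dwk k0 scale0r.
Qed.

Lemma quarter_commC i j t v : i != j ->
  act (quarter R i j) (evenrot V i j t v) = evenrot V i j t (act (quarter R i j) v).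
Proof.
by move=> ij; rewrite !evenrotE homZ homD /quarter -!(act_rot_comm ij (pi / 2)).
Qed.

(** A functional that factors through the projection onto the joint eigenspace of two
    half turns. *)
Lemma line_functional i j k w : i != j -> j != k -> k != i -> w \in wt2 V j k -> w != 0 ->
  exists f : 'Hom(V, R^o), [/\ ev f w = 1, forall u, u \in wt0 V -> ev f u = 0,
    forall v, v \in wt2 V i j -> ev f v = 0 & forall v, v \in wt2 V k i -> ev f v = 0].
Proof.
move=> ij jk ki wL w0; have [f fw] := ev_neq0 w0.
have ik : i != k by rewrite eq_sym.
have ji : j != i by rewrite eq_sym.
have kj : k != j by rewrite eq_sym.
pose E1 : 'End(V) := 2^-1 *: (\1%VF - act (rot i j pi)).
pose E2 : 'End(V) := 2^-1 *: (\1%VF + act (rot j k pi)).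
have E1E v : E1 v = 2^-1 *: (v - act (rot i j pi) v).
  by rewrite scale_lfunE add_lfunE opp_lfunE id_lfunE.
have E2E v : E2 v = 2^-1 *: (v + act (rot j k pi) v).
  by rewrite scale_lfunE add_lfunE id_lfunE.
exists (f \o (E2 \o E1))%VF.
have fE v : ev (f \o (E2 \o E1))%VF v = ev f (E2 (E1 v)) by rewrite /ev !comp_lfunE.
split.
- have hw : act (rot i j pi) w = - w.
    by rewrite rotC rot_piN; apply: (@pi_wt2ik _ _ V j i k).
  have -> : ev (f \o (E2 \o E1))%VF w = ev f w.
    rewrite fE E1E hw E2E homZ homB homN (pi_wt2ij jk wL).
    by congr (ev f _); module.
  exact: fw.
- by move=> u uV; rewrite fE E1E (pi_wt0 ij uV) subrr scaler0 hom0 ev0.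
- by move=> v vL; rewrite fE E1E (pi_wt2ij ij vL) subrr scaler0 hom0 ev0.
- move=> v vL; have vL' : v \in wt2 V i k by rewrite wt2C.
  rewrite fE E1E E2E (pi_wt2ik ij ki kj vL') homZ homB homN.
  have -> : act (rot j k pi) v = - v.
    by rewrite rotC rot_piN; apply: (@pi_wt2ik _ _ V k j i).
  by rewrite [X in ev f X](_ : _ = 0) ?ev0 //; module.
Qed.

Section Triple.
Variables (i j k : 'I_n) (ij : i != j) (jk : j != k) (ki : k != i).
Hypothesis mv : exists t u, u \in wt0 V /\ oddrot V i j t u != 0.

Let ji : j != i. Proof. by rewrite eq_sym. Qed.
Let kj : k != j. Proof. by rewrite eq_sym. Qed.
Let ik : i != k. Proof. by rewrite eq_sym. Qed.

Let G := quarter R i j *m quarter R j k.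

Let SOG : SO G.
Proof. by apply: SO_mul; exact: SO_rot. Qed.

Let Gi : G *m unitv R i = unitv R j.
Proof. by rewrite -mulmxA quarter_o // quarter_l. Qed.
Let Gj : G *m unitv R j = unitv R k.
Proof. by rewrite -mulmxA quarter_l // quarter_o. Qed.
Let Gk : G *m unitv R k = unitv R i.
Proof. by rewrite -mulmxA quarter_r // mulmxN quarter_r // opprK. Qed.
Let Go l : l != i -> l != j -> l != k -> G *m unitv R l = unitv R l.
Proof. by move=> li lj lk; rewrite -mulmxA !quarter_o. Qed.

Let G3 v : act G (act G (act G v)) = v.
Proof.
rewrite -!actM ?(SO_mul SOG) //.
have -> : G *m G *m G = 1%:M; last by rewrite act1.
apply: mx_unitv_ext => l; rewrite mul1mx -(mulmxA (G *m G)) -(mulmxA G).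
have [->|li] := eqVneq l i; first by rewrite Gi Gj Gk.
have [->|lj] := eqVneq l j; first by rewrite Gj Gk Gi.
have [->|lk] := eqVneq l k; first by rewrite Gk Gi Gj.
  by rewrite !Go.
by exact: SO_mul.
Qed.

Let G_sgperm : sgperm G (tperm j k * tperm i j)%g (fun => false).
Proof.
split=> // l; rewrite permM scale1r.
have [->|li] := eqVneq l i; first by rewrite Gi (tpermD ji ki) tpermL.
have [->|lj] := eqVneq l j; first by rewrite Gj tpermL tpermD.
have [->|lk] := eqVneq l k; first by rewrite Gk tpermR tpermR.
by rewrite Go // [tperm j k l]tpermD 1?eq_sym // tpermD // eq_sym.
Qed.

Let cyc : {perm 'I_n} := (tperm j k * tperm i j)%g.
Let cyc_i : cyc i = j. Proof. by rewrite permM (tpermD ji ki) tpermL. Qed.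
Let cyc_j : cyc j = k. Proof. by rewrite permM tpermL tpermD. Qed.
Let cyc_k : cyc k = i. Proof. by rewrite permM tpermR tpermR. Qed.

Let G_wt2 a b v : v \in wt2 V a b -> act G v \in wt2 V (cyc a) (cyc b).
Proof.
apply: (sgperm_wt G_sgperm) => x.
by rewrite /pairS !(inj_eq perm_inj).
Qed.

Let G_wt0 u : u \in wt0 V -> act G u \in wt0 V.
Proof. exact: (sgperm_wt G_sgperm). Qed.

Let G_evenrot a b t v : a != b -> act G (evenrot V a b t v) = evenrot V (cyc a) (cyc b) t (act G v).
Proof.
move=> ab; apply: (@conj_evenrot _ _ _ _ _ _ _ _ false false) => //.
- by rewrite (inj_eq perm_inj).
- exact: G_sgperm.2.
- exact: G_sgperm.2.
Qed.

Let G_oddrot a b t v : a != b -> act G (oddrot V a b t v) = oddrot V (cyc a) (cyc b) t (act G v).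
Proof.
move=> ab; rewrite -[RHS]scale1r; apply: (@conj_oddrot _ _ _ _ _ _ _ _ false false) => //.
- by rewrite (inj_eq perm_inj).
- exact: G_sgperm.2.
- exact: G_sgperm.2.
Qed.

(** The product G of two quarter turns permutes i, j, k cyclically.  It carries w3
    to vectors w1 and w2 of V_jk and V_ki, and copies the circle action of the plane
    (i, j) to the two other planes.  The plane (i, j) rotates the span of w1 and w2
    through a second circle homomorphism (c, s).  Reading [rot_refactor] on w1 and
    w2 gives the identities of [circle_homs_rigid]. *)
Lemma triple_structure w3 : w3 \in wt2 V i j -> w3 != 0 ->
  let X := oddrot V i j (pi / 4) in
  [/\ forall t, evenrot V i j t w3 = cos (2 * t) *: w3,
      forall t, oddrot V i j t w3 = sin (2 * t) *: X w3,
      X (X w3) = - w3,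
      forall t u, u \in wt0 V -> oddrot V i j t u = sin (2 * t) *: X u &
      X (act (quarter R j k) (X w3)) = - (2^-1 *: w3)].
Proof.
move=> w3L w3N X.
have [q [kk [x3 [phi ca]]]] := circle_actionP ij w3L w3N mv.
have [hq qpi kN x3V Cw3 Dw3 Du3 phix3] := ca.
pose w1 := act G w3; pose w2 := act G w1.
have Gw2 : act G w2 = w3 by exact: G3.
have w1L : w1 \in wt2 V j k by have := G_wt2 w3L; rewrite cyc_i cyc_j.
have w2L : w2 \in wt2 V k i by have := G_wt2 w1L; rewrite cyc_j cyc_k.
have nz v : v != 0 -> act G v != 0.
  by apply: contraNneq => G0; apply/eqP/(act_inj (V:=V) SOG); rewrite G0 hom0.
have w1N : w1 != 0 by exact: nz.
have w2N : w2 != 0 by exact: nz.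
pose x1 := act G x3; pose x2 := act G x1.
have x1V : x1 \in wt0 V by exact: G_wt0.
have x2V : x2 \in wt0 V by exact: G_wt0.
pose phi1 u := phi (act G (act G u)).
have Cw1 t : evenrot V j k t w1 = q t *: w1.
  by have := G_evenrot t w3 ij; rewrite cyc_i cyc_j Cw3 homZ => <-.
have Cw2 t : evenrot V k i t w2 = q t *: w2.
  by have := G_evenrot t w1 jk; rewrite cyc_j cyc_k Cw1 homZ => <-.
have Dw1 t : oddrot V j k t w1 = kk t *: x1.
  by have := G_oddrot t w3 ij; rewrite cyc_i cyc_j Dw3 homZ => <-.
have Dw2 t : oddrot V k i t w2 = kk t *: x2.
  by have := G_oddrot t w1 jk; rewrite cyc_j cyc_k Dw1 homZ => <-.
have Du1 t u : u \in wt0 V -> oddrot V j k t u = (kk t * phi1 u) *: w1.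
  move=> uV; have := G_oddrot t (act G (act G u)) ij; rewrite cyc_i cyc_j G3 => <-.
  by rewrite Du3 ?homZ // !G_wt0.
have [f1 [f1w f1V f1ij f1ki]] := line_functional ij jk ki w1L w1N.
have [f2 [f2w f2V f2jk f2ij]] := line_functional jk ki ij w2L w2N.
have line1 v : v \in wt2 V j k -> v = ev f1 v *: w1.
  by move=> /(line_gen jk w1L w1N)[c ->]; rewrite evZ f1w mulr1.
have line2 v : v \in wt2 V k i -> v = ev f2 v *: w2.
  by move=> /(line_gen ki w2L w2N)[c ->]; rewrite evZ f2w mulr1.
have w2L' : w2 \in wt2 V i k by rewrite wt2C.
pose c t := ev f2 (evenrot V i j t w2); pose s t := ev f1 (oddrot V i j t w2).
have Cij2 t : evenrot V i j t w2 = c t *: w2 by apply: line2; exact: evenrot_wt2.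
have Dij2 t : oddrot V i j t w2 = s t *: w1 by apply: line1; exact: oddrot_wt2ik.
have c2 : c (pi / 2) = 0.
  have e : act (rot i j (- (pi / 2))) w2 = - act (rot i j (pi / 2)) w2.
    have -> : - (pi / 2) = pi / 2 + - pi :> R by lra.
    by rewrite act_rotD // rot_piN (pi_wt2ik ij ki kj w2L') homN.
  by rewrite /c evenrotE e subrr scaler0 ev0.
pose h := s (pi / 2).
have J2 : act (quarter R i j) w2 = h *: w1.
  by rewrite /quarter act_rotE Cij2 c2 scale0r add0r Dij2.
have Q3 : act (quarter R j k) w3 = h *: w2.
  have := G_oddrot (pi / 2) w2 ij; rewrite cyc_i cyc_j Gw2 Dij2 homZ => e1.
  have := G_evenrot (pi / 2) w2 ij; rewrite cyc_i cyc_j Gw2 Cij2 c2 scale0r hom0 => e2.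
  by rewrite /quarter act_rotE -e1 -e2 add0r.
have hh : h * h = 1.
  have : act G w3 = act (quarter R i j) (act (quarter R j k) w3).
    by rewrite -actM //; exact: SO_rot.
  rewrite Q3 homZ J2 scalerA -/w1 => /(congr1 (ev f1)).
  by rewrite evZ f1w mulr1.
have J2' : w1 = h *: act (quarter R i j) w2 by rewrite J2 scalerA hh scale1r.
have Qw1 : act (quarter R i j) w1 = - h *: w2.
  have := pi_wt2ik ij ki kj w2L'; rewrite (_ : pi = pi / 2 + pi / 2 :> R); last by lra.
  rewrite act_rotD // -/(quarter R i j) J2 homZ => e.
  by rewrite -[LHS]scale1r -hh -scalerA e scalerN scaleNr.
have Cij1 t : evenrot V i j t w1 = c t *: w1.
  rewrite {1}J2' homZ -quarter_commC // Cij2 homZ scalerA mulrC -scalerA.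
  by rewrite -homZ -/(quarter _ _ _) homZ -J2'.
have Dij1 t : oddrot V i j t w1 = - s t *: w2.
  rewrite {1}J2' homZ -quarter_comm // Dij2 homZ Qw1 !scalerA; congr (_ *: _).
  by transitivity (- (h * h * s t)); [ring|rewrite hh mul1r].
have inj1 (a b : R) : a *: w1 = b *: w1 -> a = b.
  by move=> /(congr1 (ev f1)); rewrite !evZ f1w !mulr1.
have inj2 (a b : R) : a *: w2 = b *: w2 -> a = b.
  by move=> /(congr1 (ev f2)); rewrite !evZ f2w !mulr1.
have hc : circle_hom c s.
  split.
  - exact: evenrot_continuous.
  - exact: oddrot_continuous.
  - move=> a b; apply: inj2; rewrite -Cij2 evenrotD // Cij2 Dij2 !homZ Cij2 Dij1.
    by rewrite !scalerA -scalerDl; congr (_ *: _); ring.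
  - move=> a b; apply: inj1; rewrite -Dij2 oddrotD // Cij2 Dij2 !homZ Cij1 Dij2.
    by rewrite !scalerA -scalerDl; congr (_ *: _); ring.
  - move=> a; apply: inj2; have := evenrot_sqr ij a w2.
    rewrite Cij2 homZ Cij2 Dij2 homZ Dij1 !scalerA => e1.
    have -> : c a ^+ 2 + s a ^+ 2 = c a * c a - s a * - s a by ring.
    by rewrite scalerBl e1 addrK scale1r.
have rij1 t : act (rot i j t) w1 = c t *: w1 - s t *: w2 by rewrite act_rotE Cij1 Dij1 scaleNr.
have rij2 t : act (rot i j t) w2 = c t *: w2 + s t *: w1 by rewrite act_rotE Cij2 Dij2.
have rij3 t : act (rot i j t) w3 = q t *: w3 + kk t *: x3 by rewrite act_rotE Cw3 Dw3.
have Grot (a b a' b' : 'I_n) t v : a != b -> cyc a = a' -> cyc b = b' ->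
    act (rot a' b' t) (act G v) = act G (act (rot a b t) v).
  by move=> ab <- <-; rewrite !act_rotE homD G_evenrot ?G_oddrot.
have rjk1 t : act (rot j k t) w1 = q t *: w1 + kk t *: x1 by rewrite act_rotE Cw1 Dw1.
have rjk2 t : act (rot j k t) w2 = c t *: w2 - s t *: w3.
  by rewrite (Grot i j) // rij1 homB !homZ Gw2.
have rjk3 t : act (rot j k t) w3 = c t *: w3 + s t *: w2.
  by rewrite -{1}Gw2 (Grot i j) // rij2 homD !homZ Gw2.
have rki1 t : act (rot k i t) w1 = c t *: w1 + s t *: w3.
  by rewrite (Grot j k) // rjk3 homD !homZ Gw2.
have rki2 t : act (rot k i t) w2 = q t *: w2 + kk t *: x2 by rewrite act_rotE Cw2 Dw2.
have f1w2 : ev f1 w2 = 0 by exact: f1ki.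
have f1w3 : ev f1 w3 = 0 by exact: f1ij.
have f2w1 : ev f2 w1 = 0 by exact: f2jk.
have f2w3 : ev f2 w3 = 0 by exact: f2ij.
have f1x2 : ev f1 x2 = 0 by exact: f1V.
have f1x1 : ev f1 x1 = 0 by exact: f1V.
have f2x1 : ev f2 x1 = 0 by exact: f2V.
have rijx1 t : ev f1 (act (rot i j t) x1) = 0 /\ ev f2 (act (rot i j t) x1) = 0.
  have C1 := evenrot_wt0 t ij x1V.
  by rewrite act_rotE (Du3 _ _ x1V) !evD !evZ f1w3 f2w3 (f1V _ C1) (f2V _ C1) mulr0 addr0.
have rijw3 t : ev f1 (act (rot i j t) w3) = 0 /\ ev f2 (act (rot i j t) w3) = 0.
  by rewrite rij3 !evD !evZ f1w3 f2w3 (f1V _ x3V) (f2V _ x3V) !mulr0 addr0.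
have rjkx2 t : ev f1 (act (rot j k t) x2) = kk t * phi1 x2 /\ ev f2 (act (rot j k t) x2) = 0.
  have C1 := evenrot_wt0 t jk x2V.
  by rewrite act_rotE (Du1 _ _ x2V) !evD !evZ f1w f2w1 (f1V _ C1) (f2V _ C1) mulr0 !add0r mulr1.
pose nu := phi1 x2.
have coefs (t x b g : R) : pythagorean t x b g -> exists a, [/\
    q x * c t = c a * (c g * q b) - s a * (nu * (kk b * kk g)),
    - (q x * s t) = c a * (s g * s b) - s a * (q g * c b),
    c x * s t = c a * (nu * (kk b * kk g)) + s a * (c g * q b) &
    c x * c t = c a * (q g * c b) + s a * (s g * s b)].
  move=> pyt; have [a eqA] := @rot_refactor R n i j k t x b g ij jk ki pyt; exists a.
  have E v : act (rot i j t) (act (rot j k x) v) =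
      act (rot j k b) (act (rot k i g) (act (rot i j a) v)).
    by rewrite -!actM ?eqA ?mulmxA //; do ?[apply: SO_mul]; exact: SO_rot.
  apply: (rotation_coefs E (rij1 t) (rij2 t) (rjk1 x) (rjk2 x) (rjk1 b) (rjk2 b) (rjk3 b)
    (rki1 g) (rki2 g) (rij1 a) (rij2 a) (conj f1w f2w1) (conj f1w2 f2w)
    (conj f1w3 f2w3) (conj f1x1 f2x1) (rijx1 t) (rijw3 t) (rjkx2 b)).
have [qE kE k4 nuE hE] : [/\ forall t, q t = cos (2 * t),
    forall t, kk t = kk (pi / 4) * sin (2 * t), kk (pi / 4) ^+ 2 = 1, nu = 2^-1 & h = 1].
  apply: (@circle_homs_rigid R c s q kk nu hc hq c2 qpi kN) => t x b g /coefs[a [e1 e2 e3 e4]].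
    have -> : q x ^+ 2 * s t ^+ 2 + c x ^+ 2 * c t ^+ 2 = (- (q x * s t)) ^+ 2 + (c x * c t) ^+ 2 by ring.
    rewrite e2 e4; have [_ _ _ _ /(_ a) ua] := hc.
    transitivity ((c a ^+ 2 + s a ^+ 2) * (s g ^+ 2 * s b ^+ 2 + q g ^+ 2 * c b ^+ 2)); first by ring.
    by rewrite ua mul1r.
  have -> : s t * c t * (c x ^+ 2 - q x ^+ 2) = (q x * c t) * (- (q x * s t)) + (c x * s t) * (c x * c t) by ring.
  rewrite e1 e2 e3 e4; have [_ _ _ _ /(_ a) ua] := hc.
  transitivity ((c a ^+ 2 + s a ^+ 2) * (c g * q b * (s g * s b) + nu * (kk b * kk g * (q g * c b)))); first by ring.
  by rewrite ua mul1r.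
have Xw3 : X w3 = kk (pi / 4) *: x3 by exact: Dw3.
have Xu u : u \in wt0 V -> X u = (kk (pi / 4) * phi u) *: w3 by exact: Du3.
have kk1 : kk (pi / 4) * kk (pi / 4) = 1 by rewrite -expr2.
split.
- by move=> t; rewrite Cw3 qE.
- by move=> t; rewrite Dw3 kE Xw3 scalerA mulrC.
- by rewrite Xw3 homZ Xu // phix3 scalerA mulrA kk1 mul1r scaleN1r.
- by move=> t u uV; rewrite Du3 // kE Xu // scalerA; congr (_ *: _); ring.
(* the quarter turns exchange the vectors x_a up to sign *)
have e1 : act (quarter R j k) (X w3) = - kk (pi / 4) *: x2.
  by rewrite /X quarter_oddrot // Q3 hE scale1r oddrotC opp_lfunE Dw2 scaleNr.
have Qji1 : act (quarter R j i) w1 = w2.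
  rewrite /quarter rotC act_rotNE Cij1 Dij1 c2 -/h hE scale0r scaleN1r opprK add0r.
  by [].
have e2 : act (quarter R j i) x1 = - x2.
  have := @quarter_oddrot _ _ V k j i (pi / 4) w1 kj ki ji.
  rewrite Qji1 oddrotC opp_lfunE Dw1 Dw2 homN homZ => /(congr1 (fun v => - (kk (pi / 4) *: v))).
  by rewrite scalerN opprK !scalerA kk1 !scale1r.
have e3 : act (quarter R j i) w3 = - w3.
  rewrite /quarter rotC act_rotNE Cw3 Dw3 qE kE (_ : 2 * (pi / 2) = pi); last by lra.
  by rewrite cospi sinpi mulr0 scale0r subr0 scaleN1r.
have e4 : phi x2 = phi x1.
  have := quarter_comm (pi / 4) x1 ji.
  rewrite e2 homN oddrotC !opp_lfunE opprK homN -/X !Xu // homZ e3 scalerN opprK => e.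
  have [f fw] := ev_neq0 w3N; move/(congr1 (ev f)): e; rewrite !evZ fw !mulr1.
  move/(congr1 (fun y => kk (pi / 4) * y)); rewrite !mulrA kk1 !mul1r.
  by [].
rewrite e1 homZ Xu // scalerA mulrA mulNr kk1 mulN1r scaleNr; congr (- (_ *: _)).
by rewrite e4 -nuE /nu /phi1 G3.
Qed.

End Triple.
End CircleActions.

(** * A vector fixed by the stabiliser of an axis *)

Section InvariantVector.
Variables (R : realType) (n : nat) (V : SOrep R n).
Implicit Types (i j k l a b : 'I_n) (u v w x : V) (t s : R).
Local Notation act := (rep_act V).
Local Notation X i j := (oddrot V i j (pi / 4)).

Hypotheses (n3 : (3 <= n)%N) (n4 : n <> 4%N).
Hypothesis lines : forall i j, i != j -> \dim (wt2 V i j) = 1%N.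
Hypothesis mv : moving V.

Lemma triple i j k w : i != j -> j != k -> k != i -> w \in wt2 V i j -> w != 0 ->
  [/\ forall t, evenrot V i j t w = cos (2 * t) *: w,
      forall t, oddrot V i j t w = sin (2 * t) *: X i j w,
      X i j (X i j w) = - w,
      forall t u, u \in wt0 V -> oddrot V i j t u = sin (2 * t) *: X i j u &
      X i j (act (quarter R j k) (X i j w)) = - (2^-1 *: w)].
Proof. by move=> ij jk ki; apply: triple_structure => //; exact: mv. Qed.

Lemma oddrot_sin i j t u : i != j -> u \in wt0 V -> oddrot V i j t u = sin (2 * t) *: X i j u.
Proof.
move=> ij uV; have [k [ki kj]] := third_index n3 ij.
have [w wL wN] := line_nonzero lines ij.
have jk : j != k by rewrite eq_sym.
have [_ _ _ H _] := triple ij jk ki wL wN; exact: H.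
Qed.

Lemma line_action i j w : i != j -> w \in wt2 V i j ->
  [/\ forall t, evenrot V i j t w = cos (2 * t) *: w,
      forall t, oddrot V i j t w = sin (2 * t) *: X i j w &
      X i j (X i j w) = - w].
Proof.
move=> ij wL; have [->|wN] := eqVneq w 0.
  by rewrite !hom0 oppr0; split=> // t; rewrite !hom0 scaler0.
have [k [ki kj]] := third_index n3 ij; have jk : j != k by rewrite eq_sym.
by have [? ? ? _ _] := triple ij jk ki wL wN.
Qed.

Lemma quarter_line i j w : i != j -> w \in wt2 V i j -> act (quarter R i j) w = - w.
Proof.
move=> ij wL; have [C D _] := line_action ij wL.
rewrite /quarter act_rotE C D (_ : 2 * (pi / 2) = pi); last by lra.
by rewrite cospi sinpi scale0r addr0 scaleN1r.
Qed.

Lemma oddrot0_fixed i j v : i != j -> (forall t, oddrot V i j t v = 0) ->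
  forall t, act (rot i j t) v = v.
Proof.
move=> ij D0 t; rewrite (_ : t = 2 * (t / 2)); last by lra.
by rewrite act_rotE evenrot_double // !D0 hom0 scaler0 !addr0.
Qed.

Lemma disjoint_oddrot i j k l t s v : i != j -> k != l -> i != k -> i != l -> j != k -> j != l ->
  oddrot V k l s (oddrot V i j t v) = oddrot V i j t (oddrot V k l s v).
Proof.
move=> ij kl ik il jk jl.
have C r : act (rot k l r) (oddrot V i j t v) = oddrot V i j t (act (rot k l r) v).
  rewrite -[RHS]scale1r; apply: (@conj_oddrot _ _ _ _ i j i j false false) => //.
  - exact: SO_rot.
  - by rewrite scale1r rot_unitv_other.
  - by rewrite scale1r rot_unitv_other.
have comm (f g d : 'End(V)) : f (d v) = d (f v) -> g (d v) = d (g v) ->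
    2^-1 *: (f (d v) - g (d v)) = d (2^-1 *: (f v - g v)).
  by move=> -> ->; rewrite homZ homB.
apply: etrans (oddrotE k l s _) (etrans (comm _ _ _ (C s) (C (- s))) _).
exact: congr1 (esym (oddrotE k l s v)).
Qed.

Definition kernel_sub i j k l := forall u, u \in wt0 V -> X k l u = 0 -> X i j u = 0.

Lemma kernel_sub_perm a b i j k l : a != b -> i != j -> k != l -> kernel_sub i j k l ->
  kernel_sub (tperm a b i) (tperm a b j) (tperm a b k) (tperm a b l).
Proof.
move=> ab ij kl H u uV Xu.
have [SQ As] := quarter_sgperm R ab; set Q := quarter R a b in SQ As.
pose u' := act Q^T u.
have uE : u = act Q u' by rewrite actKV.
have u'V : u' \in wt0 V.
  have -> : u' = act (quarter R b a) u by rewrite /u' /Q /quarter rot_tr (@rotC _ _ a b).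
  by apply: quarter_wt0; rewrite // eq_sym.
have conj c d : c != d -> X (tperm a b c) (tperm a b d) u = 0 <-> X c d u' = 0.
  move=> cd; have cd' : tperm a b c != tperm a b d by rewrite (inj_eq perm_inj).
  have := conj_oddrot (pi / 4) u' SQ cd cd' (As c) (As d); rewrite -uE => e.
  split=> e0.
    by apply: (@act_inj _ _ V Q SQ); rewrite e e0 scaler0 hom0.
  by apply/eqP; move/eqP: e; rewrite e0 (hom0 (act Q)) eq_sym scaler_eq0 signr_eq0.
by apply/(conj i j ij); apply: H => //; apply/(conj k l kl).
Qed.

(** With x = X_ij w and Q the quarter turn of the plane (j, k), the vector Q x - x / 2
    is killed by X_ij, while X_ik maps it to - (3/4) Q w. *)
Lemma kernel_not_sub i j k : i != j -> j != k -> k != i -> ~ kernel_sub i k i j.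
Proof.
move=> ij jk ki H; have [w wL wN] := line_nonzero lines ij.
have ik : i != k by rewrite eq_sym.
have [_ _ XX _ XQX] := triple ij jk ki wL wN.
set x := X i j w in XX XQX; set Q := act (quarter R j k) in XQX.
have xV : x \in wt0 V by exact: oddrot_wt2ij.
have QxV : Q x \in wt0 V by exact: quarter_wt0.
have conj v : X i k (Q v) = Q (X i j v) by rewrite /Q quarter_oddrot.
have QQ v : v \in wt0 V -> Q (Q v) = v.
  move=> vV; rewrite /Q /quarter -act_rotD // (_ : pi / 2 + pi / 2 = pi); last by lra.
  exact: pi_wt0.
have Xx : X i k x = - (2^-1 *: Q w).
  by rewrite -{1}(QQ x xV) conj XQX homN homZ.
have XB a b y z : X a b (y - 2^-1 *: z) = X a b y - 2^-1 *: X a b z.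
  by rewrite (homB (X a b)) (homZ (X a b)).
have uV : Q x - 2^-1 *: x \in wt0 V by rewrite memvB ?memvZ.
have e : Q (- w) - 2^-1 *: - (2^-1 *: Q w) = 0.
  by rewrite -Xx -XX -conj -XB; apply: H => //; rewrite XB XQX XX; module.
have : (3 / 4) *: Q w = 0.
  by rewrite homN in e; rewrite -[RHS]oppr0 -e; module.
have c0 : (3 / 4 : R) != 0 by apply: lt0r_neq0; lra.
move/eqP; rewrite scaler_eq0 (negbTE c0) /= => /eqP h.
by move/eqP: wN; apply; apply: (@act_inj _ _ V (quarter R j k)); [exact: SO_rot|rewrite hom0].
Qed.

(** If X_kl w were not 0 for a generator w of V_ij, then writing X_ij u = c w the
    commutation of X_ij and X_kl would show that X_kl u = 0 implies X_ij u = 0.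
    Permuting the indices, with a fifth index m at disposal, would give that
    X_kl u = 0 implies X_km u = 0, against [kernel_not_sub]. *)
Lemma disjoint_fixed i j k l w t : i != j -> k != l -> i != k -> i != l -> j != k -> j != l ->
  w \in wt2 V i j -> act (rot k l t) w = w.
Proof.
move=> ij kl ik il jk jl wL; apply: oddrot0_fixed => // s.
apply/eqP/negPn/negP => Dw.
have wN : w != 0 by apply: contraNneq Dw => ->; rewrite hom0.
have H : kernel_sub i j k l.
  move=> u uV Xu.
  have [c Xc] := line_gen lines ij wL wN (oddrot_wt0 (pi / 4) ij uV).
  have Du : oddrot V k l s u = 0 by rewrite (oddrot_sin s kl uV) Xu scaler0.
  have comm (f d : 'End(V)) : d (f u) = f (d u) -> d u = 0 -> f u = c *: w -> c *: d w = 0.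
    by move=> df du fu; rewrite -homZ -fu df du hom0.
  have /eqP := comm _ _ (disjoint_oddrot (pi / 4) s u ij kl ik il jk jl) Du Xc.
  by rewrite scaler_eq0 (negbTE Dw) orbF Xc => /eqP ->; rewrite scale0r.
(* four distinct indices force n >= 4, and n <> 4 leaves a fifth one *)
have [m] : exists m, m \notin [:: i; j; k; l].
  have un : uniq [:: i; j; k; l] by rewrite /= !inE !negb_or ij ik il jk jl kl.
  have n5 : (size [:: i; j; k; l] <= #|'I_n|)%N by rewrite -(card_uniqP un) max_card.
  apply: contrapT => /forallNP Hm.
  have : (#|'I_n| <= size [:: i; j; k; l])%N.
    rewrite -(card_uniqP un).
    by apply: subset_leq_card; apply/fintype.subsetP => x _; apply/negPn/negP/Hm.
  by move: n5 n4; rewrite card_ord /=; clear; lia.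
rewrite !inE !negb_or => /and4P[mi mj mk ml].
have ki : k != i by rewrite eq_sym.
have li : l != i by rewrite eq_sym.
have lj : l != j by rewrite eq_sym.
have kj : k != j by rewrite eq_sym.
have ji : j != i by rewrite eq_sym.
have lk : l != k by rewrite eq_sym.
have H1 := kernel_sub_perm ik ij kl H.
rewrite tpermL tpermR (tpermD ij kj) (tpermD il kl) in H1.
have H2 := kernel_sub_perm jl kj il H1.
rewrite tpermL tpermR (tpermD jk lk) (tpermD ji li) in H2.
have lm : l != m by rewrite eq_sym.
have H3 := kernel_sub_perm lm kl ij H2.
rewrite tpermL (tpermD lk mk) (tpermD li mi) (tpermD lj mj) in H3.
by apply: (kernel_not_sub kl lm mk) => u uV Xu; exact: (H3 u uV (H u uV Xu)).
Qed.

(** On V_0 the half turns are trivial, so that quarter turns act as transpositions. *)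
Lemma quarter_wt0C a b u : a != b -> u \in wt0 V ->
  act (quarter R b a) u = act (quarter R a b) u.
Proof.
move=> ab uV; rewrite /quarter (rotC a b) -{1}(pi_wt0 ab uV) -act_rotD //.
by congr (act (rot a b _) u); lra.
Qed.

Lemma quarter_wt0K a b u : a != b -> u \in wt0 V ->
  act (quarter R a b) (act (quarter R a b) u) = u.
Proof.
move=> ab uV; rewrite /quarter -act_rotD // (_ : pi / 2 + pi / 2 = pi); last by lra.
exact: pi_wt0.
Qed.

Lemma quarter_wt0_conj a b c d u : a != b -> c != d -> u \in wt0 V ->
  act (quarter R a b) (act (quarter R c d) u) =
  act (quarter R (tperm a b c) (tperm a b d)) (act (quarter R a b) u).
Proof.
move=> ab cd uV; have [SQ As] := quarter_sgperm R ab.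
have cd' : tperm a b c != tperm a b d by rewrite (inj_eq perm_inj).
rewrite (conj_act (pi / 2) u SQ cd cd' (As c) (As d)) signr_rot.
case: ifP => // _; rewrite -rotC; apply: quarter_wt0C => //; exact: quarter_wt0.
Qed.

Variables (o p : 'I_n) (op : o != p) (w : V) (wL : w \in wt2 V o p) (wN : w != 0).

Let x := X o p w.
Let xV : x \in wt0 V. Proof. exact: oddrot_wt2ij. Qed.

(** In the model of symmetric matrices, x is a multiple of E_pp - E_oo and this vector
    the same multiple of E_jj - E_oo. *)
Definition orbit_vec j := if j == p then x else act (quarter R p j) x.

Lemma orbit_vec_wt0 j : j != o -> orbit_vec j \in wt0 V.
Proof.
move=> jo; rewrite /orbit_vec; case: eqVneq => // jp.
by apply: quarter_wt0; rewrite // eq_sym.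
Qed.

Lemma quarter_x a b : a != b -> a != o -> b != o -> a != p -> b != p ->
  act (quarter R a b) x = x.
Proof.
move=> ab ao bo ap bp.
have D := disjoint_oddrot (pi / 4) _ w op ab; rewrite eq_sym in ao; rewrite eq_sym in bo.
rewrite eq_sym in ap; rewrite eq_sym in bp.
apply: oddrot0_fixed => // s; rewrite /x D //.
have wf t := disjoint_fixed t op ab ao bo ap bp wL.
by rewrite (oddrotE a b) !wf subrr scaler0 (hom0 (X o p)).
Qed.

Lemma quarter_orbit a b j : a != b -> a != o -> b != o -> j != o ->
  act (quarter R a b) (orbit_vec j) = orbit_vec (tperm a b j).
Proof.
have pj j' : j' != p -> orbit_vec j' = act (quarter R p j') (orbit_vec p).
  by move=> jp; rewrite /orbit_vec eqxx (negbTE jp).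
have po : p != o by rewrite eq_sym.
have Qsym c d v : c != d -> v \in wt0 V -> act (quarter R c d) v = act (quarter R d c) v.
  by move=> cd vV; rewrite (@quarter_wt0C c d).
have xE : orbit_vec p = x by rewrite /orbit_vec eqxx.
have swap c d : c != d -> c != o -> d != o -> act (quarter R c d) (orbit_vec c) = orbit_vec d.
  move=> cd co dO; have [cp|cp] := eqVneq c p.
    by rewrite cp in cd *; rewrite (pj d) // eq_sym.
  have pc : p != c by rewrite eq_sym.
  have [dp|dp] := eqVneq d p.
    by rewrite dp (pj c cp) Qsym ?quarter_wt0K ?xE // quarter_wt0.
  rewrite (pj c cp) (pj d dp) quarter_wt0_conj ?orbit_vec_wt0 // tpermL (tpermD cp dp).
  by rewrite xE quarter_x.
have triv_p d j' : d != p -> d != o -> j' != p -> j' != d -> j' != o ->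
    act (quarter R p d) (orbit_vec j') = orbit_vec j'.
  move=> dp dO jp jd jo; have pj' : p != j' by rewrite eq_sym.
  have pd : p != d by rewrite eq_sym.
  have := @quarter_wt0_conj p j' j' d x pj' jd xV.
  by rewrite tpermR (tpermD pd jd) quarter_x // (pj _ jp) xE.
have triv c d j' : c != d -> c != o -> d != o -> j' != c -> j' != d -> j' != o ->
    act (quarter R c d) (orbit_vec j') = orbit_vec j'.
  move=> cd co dO jc jd jo; have [cp|cp] := eqVneq c p.
    by rewrite cp in cd jc *; apply: triv_p; rewrite // eq_sym.
  have [dp|dp] := eqVneq d p.
    by rewrite dp in cd jd *; rewrite Qsym ?orbit_vec_wt0 // triv_p.
  have [jp|jp] := eqVneq j' p; first by rewrite jp xE quarter_x.
  have pj' : p != j' by rewrite eq_sym.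
  rewrite (pj _ jp) quarter_wt0_conj ?orbit_vec_wt0 // (tpermD cp dp) tpermD 1?eq_sym //.
  by rewrite xE quarter_x.
move=> ab ao bo jo.
have [->|ja] := eqVneq j a; first by rewrite tpermL swap.
have [->|jb] := eqVneq j b.
  by rewrite tpermR Qsym ?orbit_vec_wt0 // swap // eq_sym.
by rewrite tpermD 1?eq_sym // triv.
Qed.

(** In the model of symmetric matrices, a multiple of 1 - n E_oo. *)
Definition axis_vec := \sum_(j | j != o) orbit_vec j.

Lemma axis_vec_wt0 : axis_vec \in wt0 V.
Proof. by apply: memv_suml => j; exact: orbit_vec_wt0. Qed.

Lemma quarter_axis_vec a b : a != b -> a != o -> b != o -> act (quarter R a b) axis_vec = axis_vec.
Proof.
move=> ab ao bo; rewrite /axis_vec linear_sum /=.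
rewrite [RHS](reindex_inj (@perm_inj _ (tperm a b))) /=.
apply: eq_big => [j|j jo]; last exact: quarter_orbit.
by rewrite -{2}(@tpermD _ a b o) // (inj_eq perm_inj).
Qed.

(** The quarter turn of the plane (a, b) fixes the vector, commutes with the odd part
    D of the rotations of this plane, and is -1 on V_ab; hence D kills the vector. *)
Lemma rot_axis_vec a b t : a != b -> a != o -> b != o -> act (rot a b t) axis_vec = axis_vec.
Proof.
move=> ab ao bo; apply: oddrot0_fixed => // s.
have := quarter_comm s axis_vec ab; rewrite quarter_axis_vec // quarter_line //; last exact: oddrot_wt0 axis_vec_wt0.
move=> /eqP; rewrite eq_sym -addr_eq0 -mulr2n -scaler_nat scaler_eq0 pnatr_eq0 /= => /eqP.
by [].
Qed.

(** The term j = p contributes -1 and each of the n - 2 others -1/2. *)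
Lemma X_axis_vec : X o p axis_vec = - ((n%:R / 2) *: w).
Proof.
rewrite /axis_vec linear_sum /= (bigD1 p) /=; last by rewrite eq_sym.
have po : p != o by rewrite eq_sym.
have [_ _ XX] := line_action op wL.
rewrite {1}/orbit_vec eqxx XX (eq_bigr (fun=> - (2^-1 *: w))); last first.
  move=> j /andP[jo jp]; rewrite /orbit_vec (negbTE jp).
  have pj : p != j by rewrite eq_sym.
  by have [_ _ _ _] := triple op pj jo wL wN.
rewrite sumr_const -scaler_nat.
have -> : #|[pred j : 'I_n | (j != o) && (j != p)]| = n.-2.
  have := cardC (pred2 o p); rewrite card2 op card_ord.
  rewrite (@eq_card _ [predC pred2 o p] [pred j : 'I_n | (j != o) && (j != p)]); last first.
    by move=> j; rewrite !inE negb_or.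
  by rewrite /= => e; rewrite -[n in n.-2]e.
have nE : n%:R = (n.-2)%:R + 2 :> R.
  by rewrite -natrD; congr (_%:R); move: n3; clear; lia.
by rewrite nE; module.
Qed.

End InvariantVector.

(** * The quadratic map of a vector fixed by the stabiliser of an axis *)

Section QuadraticMap.
Variables (R : realType) (n : nat) (V : SOrep R n).
Implicit Types (i j k l : 'I_n) (u v w : V) (t s r y z : R) (a b c : 'cV[R]_n) (g A : 'M[R]_n).
Local Notation act := (rep_act V).
Local Notation e := (unitv R).

Variables (o p : 'I_n) (o0 : o = 0%N :> nat) (p1 : p = 1%N :> nat).
Variables (v0 v1 v2 : V).
Hypothesis v0V : v0 \in wt0 V.
Hypothesis v0_fix : forall i j t, i != j -> i != o -> j != o -> act (rot i j t) v0 = v0.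
Hypothesis v0_plane : forall t, act (rot o p t) v0 =
  cos t ^+ 2 *: v0 + sin t ^+ 2 *: v1 + (2 * (cos t * sin t)) *: v2.

Let op : o != p.
Proof. by rewrite -val_eqE /= o0 p1. Qed.

Lemma stabilizer_fix A : SO A -> A *m e o = e o -> act A v0 = v0.
Proof.
move=> hA Ao; have : rot_gen 1 A.
  apply: SO_rot_gen => // i; rewrite ltnS leqn0 => /eqP i0.
  by have -> : i = o by apply: val_inj; rewrite /= i0 o0.
elim=> [|i j t B ij i1 j1 gB IH]; first by rewrite act1.
have no (k : 'I_n) : (1 <= k)%N -> k != o by move=> k1; rewrite -val_eqE /= o0 -lt0n.
rewrite actM ?IH ?v0_fix ?no //; [exact: SO_rot|exact: rot_gen_SO gB].
Qed.

Lemma polar a : exists gr : 'M[R]_n * R, SO gr.1 /\ a = gr.2 *: (gr.1 *m e o).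
Proof.
have [A gA [A0 _]] := rot_eliminate o a; have hA := rot_gen_SO gA.
exists (A^T, (A *m a) o 0); split; first exact: SO_tr.
rewrite /= -{1}[a]mul1mx -(SO_trK hA) -mulmxA scalemxAr; congr (_ *m _).
rewrite [LHS]cv_unitv_sum (bigD1 o) //= big1 ?addr0 // => i io.
rewrite A0 ?scale0r //; move: io; rewrite -val_eqE /= o0.
by case: (i : nat).
Qed.

(** In the model of symmetric matrices, a |-> a a^T - |a|^2 / n, up to a scalar. *)
Definition quadmap a : V := let gr := sval (cid (polar a)) in gr.2 ^+ 2 *: act gr.1 v0.

Lemma SO_dot g a b : SO g -> (g *m a)^T *m (g *m b) = a^T *m b.
Proof. by move=> hg; rewrite trmx_mul -mulmxA (mulmxA g^T) SO_trK // mul1mx. Qed.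

(** Two presentations of a vector differ by the stabiliser of e_o and by a sign; the
    half turn of the plane (o, p), which fixes v0, changes the sign of e_o. *)
Lemma quadmapE g r : SO g -> quadmap (r *: (g *m e o)) = r ^+ 2 *: act g v0.
Proof.
move=> hg; rewrite /quadmap; case: cid => -[g' r'] /= [hg' E].
have r2 : r ^+ 2 = r' ^+ 2.
  have dot (x : R) (h : 'M[R]_n) : SO h -> (x *: (h *m e o))^T *m (x *: (h *m e o)) = (x ^+ 2)%:M.
    move=> hh; rewrite (_ : (x *: _)^T = x *: (h *m e o)^T); last by apply/matrixP => ? ?; rewrite !mxE.
    by rewrite -scalemxAl -scalemxAr scalerA SO_dot // unitv_dot eqxx scale_scalar_mx mulr1.
  have := dot r g hg; rewrite E dot // => /matrixP /(_ 0 0).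
  by rewrite !mxE eqxx !mulr1n.
rewrite r2; have [->|rN] := eqVneq r' 0; first by rewrite expr0n /= !scale0r.
congr (_ *: _).
have key h : SO h -> h *m e o = g' *m e o -> act g' v0 = act h v0.
  move=> hh he; have fx : act (h^T *m g') v0 = v0.
    apply: stabilizer_fix; first by apply: SO_mul => //; exact: SO_tr.
    by rewrite -mulmxA -he mulmxA SO_trK // mul1mx.
  by rewrite -{2}fx actM ?actKV //; exact: SO_tr.
have /eqP := r2; rewrite eqf_sqr => /orP[/eqP rE|/eqP rE].
  by apply: key => //; apply: (scalerI rN); rewrite -E rE.
have SP : SO (rot o p pi : 'M[R]_n) by exact: SO_rot.
rewrite (key (g *m rot o p pi)); first by rewrite actM // pi_wt0.
  exact: SO_mul.
apply: (scalerI rN); rewrite -E rE -mulmxA rot_pi_unitv // eqxx (negbTE op) expr1.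
by rewrite scaleN1r mulmxN scalerN scaleNr.
Qed.

Lemma quadmap_act g a : SO g -> quadmap (g *m a) = act g (quadmap a).
Proof.
move=> hg; have [[h r] /= [hh ->]] := polar a.
by rewrite -scalemxAr mulmxA !quadmapE ?homZ ?actM //; exact: SO_mul.
Qed.

Lemma quadmap_plane y z : quadmap (y *: e o + z *: e p) = y ^+ 2 *: v0 + z ^+ 2 *: v1 + (2 * (y * z)) *: v2.
Proof.
have [t [r [yE zE]]] : exists t r, y = r * cos t /\ z = r * sin t.
  have [N|N] := eqVneq (y ^+ 2 + z ^+ 2) 0.
    exists 0, 0; rewrite !mul0r.
    move/eqP: N; rewrite paddr_eq0 ?sqr_ge0 // !sqrf_eq0.
    by move=> /andP[/eqP -> /eqP ->].
  pose r := Num.sqrt (y ^+ 2 + z ^+ 2).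
  have r2 : r ^+ 2 = y ^+ 2 + z ^+ 2 by rewrite sqr_sqrtr // addr_ge0 ?sqr_ge0.
  have rN : r != 0 by rewrite -sqrf_eq0 r2.
  have [t [ct st]] : exists t, cos t = y / r /\ sin t = z / r.
    by apply: angle_exists; rewrite !expr_div_n -mulrDl r2 mulfV.
  by exists t, r; rewrite ct st; split; field.
have -> : y *: e o + z *: e p = r *: (rot o p t *m e o).
  by rewrite rot_unitvl // scalerDr !scalerA yE zE.
rewrite quadmapE; last exact: SO_rot.
by rewrite v0_plane yE zE; module.
Qed.

Lemma two_vectors a b : exists g y z z', [/\ SO g, g *m a = y *: e o & g *m b = z *: e o + z' *: e p].
Proof.
have [[h y] /= [hh aE]] := polar a.
have [A gA [A0 _]] := rot_eliminate p (h^T *m b).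
have hA := rot_gen_SO gA.
exists (A *m h^T), y, ((A *m (h^T *m b)) o 0), ((A *m (h^T *m b)) p 0); split.
- by apply: SO_mul => //; exact: SO_tr.
- rewrite aE -scalemxAr -mulmxA (mulmxA h^T) SO_trK // mul1mx (rot_gen_fix _ gA) //.
  by rewrite o0 p1.
- rewrite -mulmxA [LHS]cv_unitv_sum (bigD1 o) //= (bigD1 p) /=; last by rewrite eq_sym.
  rewrite big1 ?addr0 // => i /andP[io ip]; rewrite A0 ?scale0r // p1.
  move: io ip; rewrite -!val_eqE /= o0 p1.
  by case: (i : nat) => [|[]].
Qed.

Lemma quadmap_parallelogram a b : quadmap (a + b) + quadmap (a - b) = 2 *: quadmap a + 2 *: quadmap b.
Proof.
have [g [y [z [z' [hg ga gb]]]]] := two_vectors a b.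
have Fa c : act g (quadmap c) = quadmap (g *m c) by rewrite quadmap_act.
have Fg c : quadmap c = act g^T (quadmap (g *m c)) by rewrite -Fa actK.
rewrite (Fg (a + b)) (Fg (a - b)) (Fg a) (Fg b) -!homZ -!homD; congr (act _ _).
rewrite mulmxDr mulmxBr ga gb.
have -> : y *: e o + (z *: e o + z' *: e p) = (y + z) *: e o + z' *: e p.
  by rewrite scalerDl addrA.
have -> : y *: e o - (z *: e o + z' *: e p) = (y - z) *: e o + (- z') *: e p.
  by rewrite scalerBl opprD addrA scaleNr.
have -> : y *: e o = y *: e o + 0 *: e p by rewrite scale0r addr0.
by rewrite !quadmap_plane; module.
Qed.

Definition polarform a b := quadmap (a + b) - quadmap a - quadmap b.

Lemma polarform_act g a b : SO g -> polarform (g *m a) (g *m b) = act g (polarform a b).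
Proof. by move=> hg; rewrite /polarform -mulmxDr !quadmap_act // !homB. Qed.

Lemma polarformC a b : polarform a b = polarform b a.
Proof. by rewrite /polarform (addrC a) addrAC. Qed.

(** The argument of Jordan and von Neumann: four instances of the parallelogram law. *)
Lemma polarformD a b c : polarform (a + b) c = polarform a c + polarform b c.
Proof.
have h1 := quadmap_parallelogram (a + b) c.
have h2 := quadmap_parallelogram (a + c) b.
have h3 := quadmap_parallelogram a (b - c).
have h4 := quadmap_parallelogram b c.
rewrite (_ : a + c + b = a + b + c) in h2; last by rewrite addrAC.
rewrite (_ : a + (b - c) = a + b - c) in h3; last by rewrite addrA.
rewrite (_ : a - (b - c) = a + c - b) in h3; last by rewrite opprB addrA.
apply: ev_ext => f; rewrite /polarform !evE.
move/(congr1 (ev f)): h1; move/(congr1 (ev f)): h2; move/(congr1 (ev f)): h3.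
move/(congr1 (ev f)): h4; rewrite !evE; lra.
Qed.

Lemma polarformZ r a b : polarform (r *: a) b = r *: polarform a b.
Proof.
have [g [y [z [z' [hg ga gb]]]]] := two_vectors a b.
apply: (act_inj hg); rewrite homZ -!polarform_act // -scalemxAr ga gb scalerA /polarform.
have -> : (r * y) *: e o + (z *: e o + z' *: e p) = (r * y + z) *: e o + z' *: e p.
  by rewrite scalerDl addrA.
have E (x : R) : quadmap (x *: e o) = x ^+ 2 *: v0.
  have -> : x *: e o = x *: e o + 0 *: e p by rewrite scale0r addr0.
  by rewrite quadmap_plane; module.
rewrite addrA !E; have -> : y *: e o + z *: e o = (y + z) *: e o by rewrite scalerDl.
by rewrite !quadmap_plane; module.
Qed.

Lemma polarform_sum (I : Type) (s : seq I) (P : pred I) (x : I -> R) (a : I -> 'cV[R]_n) b :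
  polarform (\sum_(i <- s | P i) x i *: a i) b = \sum_(i <- s | P i) x i *: polarform (a i) b.
Proof.
elim/big_rec2: _ => [|i v c _ <-]; last by rewrite polarformD polarformZ.
by rewrite -(scale0r (0 : 'cV[R]_n)) polarformZ scale0r.
Qed.

(** The linear extension of a a^T |-> quadmap a to all matrices; the factor 1/2 comes
    from the polarisation. *)
Definition symmap (T : 'M[R]_n) : V := 2^-1 *: \sum_i \sum_j T i j *: polarform (e i) (e j).

Lemma symmap_is_linear : linear symmap.
Proof.
move=> r S T; rewrite /symmap scalerA mulrC -scalerA -scalerDr; congr (_ *: _).
rewrite scaler_sumr -big_split; apply: eq_bigr => i _ /=.
rewrite scaler_sumr -big_split; apply: eq_bigr => j _ /=.
by rewrite !mxE scalerDl scalerA.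
Qed.
HB.instance Definition _ := GRing.isLinear.Build R 'M[R]_n V _ symmap symmap_is_linear.

Lemma symmapZ r T : symmap (r *: T) = r *: symmap T.
Proof. exact: linearZ. Qed.

(** Equivariance can be checked on matrices of rank one, where it is that of the
    polarisation. *)
Lemma symmap_outer a b : symmap (a *m b^T) = 2^-1 *: polarform a b.
Proof.
congr (_ *: _); rewrite [in RHS](cv_unitv_sum a) polarform_sum; apply: eq_bigr => i _.
rewrite [in RHS](cv_unitv_sum b) polarformC polarform_sum scaler_sumr; apply: eq_bigr => j _.
by rewrite !mxE big_ord1 !mxE scalerA polarformC.
Qed.

Lemma symmap_act g T : SO g -> symmap (g *m T *m g^T) = act g (symmap T).
Proof.
move=> hg; rewrite [T]matrix_sum_delta.
have dE i j : delta_mx i j = e i *m (e j)^T :> 'M[R]_n.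
  by rewrite /unitv trmx_delta mul_delta_mx.
under eq_bigr do under eq_bigr do rewrite dE.
rewrite mulmx_sumr mulmx_suml !linear_sum; apply: eq_bigr => i _ /=.
rewrite mulmx_sumr mulmx_suml !linear_sum; apply: eq_bigr => j _ /=.
rewrite -scalemxAr -scalemxAl !symmapZ homZ; congr (_ *: _).
rewrite mulmxA -(mulmxA (g *m e i)) -trmx_mul (symmap_outer (g *m e i)) polarform_act //.
by rewrite symmap_outer homZ.
Qed.

Hypotheses (n3 : (3 <= n)%N) (n4 : n <> 4%N) (v2N : v2 != 0).

Lemma polarformZr r a b : polarform a (r *: b) = r *: polarform a b.
Proof. by rewrite polarformC polarformZ polarformC. Qed.

Lemma polarform_line i j : polarform (e i) (e j) \in wt2 V i j.
Proof.
apply/wtP => k l kl.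
have hP : SO (rot k l pi : 'M[R]_n) by exact: SO_rot.
rewrite -polarform_act // !rot_pi_unitv // polarformZ polarformZr scalerA -signr_addb.
congr (_ *: _); rewrite /chi /pairS ![k == _]eq_sym ![l == _]eq_sym.
by do 4 case: (_ == _).
Qed.

Lemma polarform_plane : polarform (e o) (e p) = 2 *: v2.
Proof.
have E (x y : R) : quadmap (x *: e o + y *: e p) = x ^+ 2 *: v0 + y ^+ 2 *: v1 + (2 * (x * y)) *: v2.
  exact: quadmap_plane.
have := E 1 1; have := E 1 0; have := E 0 1; rewrite !scale1r !scale0r addr0 add0r.
by rewrite /polarform => -> -> ->; module.
Qed.

(** Rotating e_i and e_j to the axes o and p, up to signs, turns the value into 2 v2. *)
Lemma polarform_neq0 i j : i != j -> polarform (e i) (e j) != 0.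
Proof.
move=> ij; have [g [y [z [z' [hg gi gj]]]]] := two_vectors (e i) (e j).
have D (a b : 'cV[R]_n) : ((g *m a)^T *m (g *m b)) 0 0 = (a^T *m b) 0 0 by rewrite SO_dot.
have U k l : ((e k)^T *m e l) 0 0 = (k == l)%:R by rewrite unitv_dot mxE eqxx mulr1n.
have lin (x x' y' z1 : R) : ((x *: e o + x' *: e p)^T *m (y' *: e o + z1 *: e p)) 0 0 = x * y' + x' * z1.
  have -> : (x *: e o + x' *: e p)^T = x *: (e o)^T + x' *: (e p)^T.
    by apply/matrixP => ? ?; rewrite !mxE.
  rewrite mulmxDl !mulmxDr -!scalemxAl -!scalemxAr !unitv_dot !mxE !eqxx [p == o]eq_sym.
  by rewrite (negbTE op) /= mulr1n mul0rn; ring.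
have gi' : g *m e i = y *: e o + 0 *: e p by rewrite scale0r addr0.
have := D (e i) (e i); have := D (e i) (e j); have := D (e j) (e j).
rewrite !U gi' gj !lin !eqxx (negbTE ij) !mul0r !addr0 => jj yz yy.
have yN : y != 0 by apply: contraPneq yy => ->; rewrite mul0r => /esym/eqP; rewrite oner_eq0.
have z0 : z = 0 by apply/eqP; move/eqP: yz; rewrite mulf_eq0 (negbTE yN).
have zN : z' != 0.
  by apply: contraPneq jj => ->; rewrite z0 !mul0r addr0 => /esym/eqP; rewrite oner_eq0.
apply/eqP => B0; have := polarform_act (e i) (e j) hg.
rewrite B0 hom0 gi gj z0 scale0r add0r polarformZ polarformZr polarform_plane !scalerA => /eqP.
by rewrite scaler_eq0 (negbTE v2N) !mulf_eq0 (negbTE yN) (negbTE zN) pnatr_eq0.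
Qed.

(** The entry (i, j) is the coefficient of a non-zero vector of V_ij, whereas the other
    terms lie in weight spaces independent of V_ij. *)
Lemma symmap_ker_offdiag T i j : T^T = T -> symmap T = 0 -> i != j -> T i j = 0.
Proof.
move=> Ts T0 ij.
pose P (q : 'I_n * 'I_n) := (q != (i, j)) && (q != (j, i)).
have Tji : T j i = T i j by rewrite -{1}Ts mxE.
have ne : (j, i) != (i, j) by rewrite xpair_eqE (negbTE (contra_neq _ ij)) // => ->.
have E : (2 * T i j) *: polarform (e i) (e j) =
    - \sum_(q | P q) T q.1 q.2 *: polarform (e q.1) (e q.2).
  have /eqP := T0; rewrite scaler_eq0 invr_eq0 pnatr_eq0 /= pair_bigA /=.
  rewrite (bigD1 (i, j)) //= (bigD1 (j, i)) //= Tji (polarformC (e j)) addrA addr_eq0.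
  by move/eqP <-; module.
have sep q : P q -> separated (pairS i j) (pairS q.1 q.2).
  case: q => k l; rewrite /P !xpair_eqE /= => /andP[q1 q2].
  have [kl|kl] := eqVneq k l.
    have [x [y [xy]]] := separated_pair n3 ij; exists x, y; split=> //.
    by rewrite kl /pairS !addbb eq_sym.
  have [x] : exists x, pairS i j x != pairS k l x; last exact: separated_pairs.
  have [ik|ik] := eqVneq i k.
    exists j; rewrite -ik /pairS !eqxx [j == i]eq_sym (negbTE ij).
    by move: q1; rewrite -ik eqxx /= eq_sym => /negbTE ->.
  have [il|il] := eqVneq i l.
    exists j; rewrite -il /pairS !eqxx (eq_sym j i) (negbTE ij).
    by move: q2; rewrite -il eqxx andbT eq_sym => /negbTE ->.
  by exists i; rewrite /pairS eqxx (negbTE ij) (negbTE ik) (negbTE il).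
have /eqP : (2 * T i j) *: polarform (e i) (e j) = 0.
  apply: (sum_lines_independent sep); first by apply: memvZ; exact: polarform_line.
  rewrite E memvN; apply: memv_suml => q Pq; apply: memvZ.
  exact: (subvP (sumv_sup q Pq (subvv _))) (polarform_line _ _).
by rewrite scaler_eq0 (negbTE (polarform_neq0 ij)) orbF mulf_eq0 pnatr_eq0 /= => /eqP.
Qed.

(** Rotating by pi / 4 in the plane (i, j) puts (T_ii - T_jj) / 2 off the diagonal, up
    to terms that vanish. *)
Lemma symmap_ker_scalar T i j : T^T = T -> symmap T = 0 -> T i i = T j j.
Proof.
move=> Ts T0; have [->//|ij] := eqVneq i j.
have hg : SO (rot i j (pi / 4) : 'M[R]_n) by exact: SO_rot.
set g := rot i j (pi / 4) in hg.
have := @symmap_ker_offdiag (g *m T *m g^T) i j.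
rewrite symmap_act // T0 hom0 !trmx_mul trmxK Ts mulmxA => /(_ erefl erefl ij).
have ent (A : 'M[R]_n) k l : A k l = ((e k)^T *m A *m e l) 0 0.
  by rewrite /unitv trmx_delta -rowE -colE !mxE.
rewrite ent !mulmxA -(trmxK ((e i)^T *m g)) trmx_mul trmxK -2!mulmxA /g rot_tr //.
rewrite rot_unitvl // rot_unitvr // cosN sinN.
set c := cos _; set s := sin _.
have cs : 2 * (c * s) = 1.
  have := sinD (pi / 4) (pi / 4 : R).
  rewrite (_ : pi / 4 + pi / 4 = pi / 2) ?sin_pihalf; last by lra.
  by rewrite -/c -/s => e2; lra.
have -> : (c *: e i + - s *: e j)^T = c *: (e i)^T + (- s) *: (e j)^T.
  by apply/matrixP => ? ?; rewrite !mxE.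
rewrite mulmxDl !mulmxDr -!scalemxAl mulmxN -!scalemxAr.
have TE k l : (e k)^T *m (T *m e l) = (T k l)%:M.
  by rewrite mulmxA (ent T) -mx11_scalar.
have Tij : T i j = 0 by exact: symmap_ker_offdiag.
have Tji : T j i = 0 by rewrite -Ts mxE.
rewrite !mulmxN -?scalemxAr !TE Tij Tji !mxE !mulr1n => E; nra.
Qed.

Lemma symmap_ker T : T \in Sym0 R n -> symmap T = 0 -> T = 0.
Proof.
move=> /Sym0P[Ts Tt] T0; apply/matrixP => i j; rewrite mxE.
have [<-|ij] := eqVneq i j; last exact: symmap_ker_offdiag.
move: Tt; rewrite /mxtrace (eq_bigr (fun=> T i i)) => [|k _]; last exact: symmap_ker_scalar.
rewrite sumr_const card_ord => /eqP; rewrite mulrn_eq0.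
by case/orP=> [/eqP n0|/eqP//]; have := ltn_ord i; rewrite [X in (_ < X)%N]n0.
Qed.

Lemma Sym0_neq0 : exists2 T : 'M[R]_n, T \in Sym0 R n & T != 0.
Proof.
exists (delta_mx o p + delta_mx p o); last first.
  apply/eqP => /matrixP /(_ o p); rewrite !mxE !eqxx (negbTE op) /= addr0 => /eqP.
  by rewrite oner_eq0.
apply/Sym0P; split; first by rewrite linearD /= !trmx_delta addrC.
by rewrite linearD /= /mxtrace !big1 ?addr0 // => k _; rewrite !mxE; case: eqVneq => // ->;
  rewrite ?(negbTE op) // eq_sym (negbTE op).
Qed.

Hypothesis Virr : rep_irreducible V.

Lemma symmap_iso : rep_iso V (Sym0_rep R n).
Proof.
pose f : 'Hom(subvs_of (Sym0 R n), V) := linfun (symmap \o vsval).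
have fE T : f T = symmap (vsval T) by rewrite lfunE.
have f_act A T : SO A -> f (Sym0_act A T) = act A (f T).
  by move=> hA; rewrite !fE Sym0_actE // symmap_act.
have kf : lker f == 0%VS.
  apply/lker0P => S T; rewrite !fE => ST; apply: val_inj; apply/eqP; rewrite -subr_eq0.
  apply/eqP/symmap_ker; first by rewrite memvB ?subvsP.
  by rewrite linearB /= ST subrr.
have limf : limg f = fullv.
  case: (Virr.2 (limg f)) => [A hA|lf0|//].
    apply/subvP => _ /memv_imgP[_ /memv_imgP[T _ ->] ->].
    by rewrite -f_act // memv_img ?memvf.
  have [T TS TN] := Sym0_neq0; case/eqP: TN.
  apply: symmap_ker => //; have := memv_img f (memvf (Subvs TS)).
  by rewrite lf0 memv0 fE => /eqP.
have fK : cancel f^-1%VF f by move=> v; rewrite limg_lfunVK // limf memvf.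
exists (f^-1)%VF => [|A v hA]; first by exists f => //; exact: lker0_lfunK.
apply: (can_inj (lker0_lfunK kf)).
by rewrite fK -{1}(fK v) -f_act // lker0_lfunK.
Qed.

End QuadraticMap.

(** * Conclusion *)

Section Main.
Variables (R : realType) (n : nat) (V : SOrep R n).
Implicit Types (i j k l : 'I_n) (u v w : V) (t : R).
Local Notation act := (rep_act V).
Hypotheses (n3 : (3 <= n)%N) (n4 : n <> 4%N) (Virr : rep_irreducible V).
Hypothesis dimV : (\dim {:V} <= \dim (Sym0 R n))%N.

Lemma diagSO_rot_pi k l : k != l -> diagSO (rot k l pi : 'M[R]_n).
Proof.
move=> kl; split; first exact: SO_rot.
apply/is_diag_mxP => i j ij.
have -> : (rot k l pi : 'M[R]_n) i j = (rot k l pi *m unitv R j) i 0.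
  by rewrite /unitv -colE [RHS]mxE.
by rewrite val_eqE in ij; rewrite rot_pi_unitv // !mxE (negbTE ij) mulr0.
Qed.

(** Since X v0 is a multiple of w and X^2 = -1 on V_op, the orbit of v0 under the
    rotations of the plane (o, p) is quadratic in (cos t, sin t); here v1 is the
    image of v0 under the quarter turn and v2 = X v0. *)
Lemma moving_case : wt0 V != 0%VS -> moving V -> rep_iso V (Sym0_rep R n).
Proof.
move=> V0N mv; have lines := lines_dim1 n3 n4 V0N mv dimV.
pose o := Ordinal (leq_trans (isT : (0 < 3)%N) n3).
pose p := Ordinal (leq_trans (isT : (1 < 3)%N) n3).
have op : o != p by [].
have [w wL wN] := line_nonzero lines op.
pose v0 := axis_vec o p w; pose v2 := oddrot V o p (pi / 4) v0.
have v0V : v0 \in wt0 V by exact: axis_vec_wt0.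
have v2L : v2 \in wt2 V o p by exact: oddrot_wt0.
have v2N : v2 != 0.
  rewrite /v2 (X_axis_vec n3 lines mv op wL wN) oppr_eq0 scaler_eq0 (negbTE wN) orbF.
  by rewrite mulf_eq0 invr_eq0 !pnatr_eq0 orbF -lt0n; apply: leq_trans n3.
pose v1 := v0 + 2 *: oddrot V o p (pi / 4) v2.
have v0_plane t : act (rot o p t) v0 =
    cos t ^+ 2 *: v0 + sin t ^+ 2 *: v1 + (2 * (cos t * sin t)) *: v2.
  have D s := oddrot_sin n3 lines mv s op v0V.
  have [_ Dv2 _] := line_action n3 lines mv op v2L.
  rewrite act_rotE D -/v2.
  have -> : evenrot V o p t v0 = v0 + (2 * sin t ^+ 2) *: oddrot V o p (pi / 4) v2.
    rewrite {1}(_ : t = 2 * (t / 2)); last by field.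
    rewrite evenrot_double // D homZ -/v2 Dv2 (_ : 2 * (t / 2) = t); last by field.
    by rewrite !scalerA; congr (_ + _ *: _); ring.
  have -> : sin (2 * t) = 2 * (cos t * sin t).
    by rewrite mulrC mulr_natr sin_mulr2n mulr_natl.
  have -> : cos t ^+ 2 = 1 - sin t ^+ 2 by rewrite -(cos2Dsin2 t) addrK.
  rewrite /v1; module.
apply: (@symmap_iso _ _ _ o p erefl erefl v0 v1 v2) => // i j t ij io jo.
by apply: rot_axis_vec.
Qed.
End Main.

Theorem proposition2p3 (R : realType) (n : nat) (hn3 : (3 <= n)%N)
    (hn4 : n <> 4%N) (V : SOrep R n) (Virr : rep_irreducible V)
    (dimV : (\dim {:V} <= \dim (Sym0 R n))%N)
    (Vfix : exists2 v : V, v != 0 & forall A, diagSO A -> rep_act V A v = v) :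
  rep_iso V (trivial_rep R n) \/ rep_iso V (Sym0_rep R n).
Proof.
have [v vN vfix] := Vfix.
have V0N : wt0 V != 0%VS.
  apply: contraNneq vN => V00; rewrite -memv0 -V00; apply/wtP => k l kl.
  by rewrite vfix; [rewrite /chi expr0 scale1r|exact: diagSO_rot_pi].
have [mv|mv] := pselect (moving V); [right; exact: moving_case|left].
apply: trivial_case => // i j t u ij uV.
by apply/eqP/negPn/negP => /(moving_all ij uV).
Qed.
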